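(* Assume that $(p_i,q_i,r_i)$, $i=1,2$, and $\tilde\lambda$ solve the system $$d\tilde\lambda(t)=\frac{\partial\mathcal H}{\partial w}(t)dt+\frac{\partial\mathcal H}{\partial z}(t)dB(t)+\int_{\mathbb R}\nabla_k\mathcal H(t,\zeta)\tilde N(dt,d\zeta),\qquad\tilde\lambda(0)=\phi'(W(0)),$$ $$dp_1(t)=-E[\mu_1(t)|\mathcal F_t]dt+q_1(t)dB(t)+\int_{\mathbb R}r_1(t,\zeta)\tilde N(dt,d\zeta),\qquad p_1(T)=\varphi'(X(T))+h'(X(T))\tilde\lambda(T),$$ $$dp_2(t)=-E[\mu_2(t)|\mathcal F_t]dt+q_2(t)dB(t)+\int_{\mathbb R}r_2(t,\zeta)\tilde N(dt,d\zeta),\qquad p_2(T)=0,$$ where $$\mu_1(t)=q_2(t)+\frac{\partial H}{\partial x}(t)+\frac{\partial H}{\partial y}(t+\delta)\mathbf 1_{[0,T-\delta]}(t),\qquad\mu_2(t)=\frac{\partial H}{\partial\Lambda}(t)-\frac{\partial H}{\partial\Lambda}(t+\delta)\mathbf 1_{[0,T-\delta]}(t),$$ with $H$ evaluated at the adjoint variables $(\tilde\lambda,p_1,q_1,r_1)$. Define $\lambda=\tilde\lambda$, $p(t)=p_1(t)$, $q(t)=q_1(t)$, $r(t,\cdot)=r_1(t,\cdot)$, and assume that $E[\int_0^T(\frac{\partial H}{\partial z}(t))^2dt]<\infty$. Then $(p,q,r,\lambda)$ solves the noisy memory FBSDE $$d\lambda(t)=\frac{\partial H}{\partial w}(t)dt+\frac{\partial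 H}{\partial z}(t)dB(t)+\int_{\mathbb R}\nabla_kH(t,\zeta)\tilde N(dt,d\zeta),\qquad\lambda(0)=\phi'(W(0)),$$ $$dp(t)=-E[\mu(t)|\mathcal F_t]dt+q(t)dB(t)+\int_{\mathbb R}r(t,\zeta)\tilde N(dt,d\zeta),\qquad p(T)=\varphi'(X(T))+h'(X(T))\lambda(T),$$ where $$\mu(t)=\frac{\partial H}{\partial x}(t)+\frac{\partial H}{\partial y}(t+\delta)\mathbf 1_{[0,T-\delta]}(t)+\int_t^{t+\delta}E\Big[D_t\Big[\frac{\partial H}{\partial\Lambda}(s)\Big]\Big|\mathcal F_t\Big]\mathbf 1_{[0,T]}(s)ds,$$ and moreover $$q_2(t)=\int_t^{t+\delta}E\Big[D_t\Big[\frac{\partial H}{\partial\Lambda}(s)\Big]\Big|\mathcal F_t\Big]\mathbf 1_{[0,T]}(s)ds.$$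
   Context: Setting. $T>0$; $(\Omega,\mathcal F,P)$ carries a Brownian motion $B(t)$, $t\in[0,T]$, and an independent compensated Poisson random measure $\tilde N(dt,d\zeta)$ with Lévy measure $\nu$; $(\mathcal F_t)$ is the $P$-augmented filtration they generate. Controls $\boldsymbol u=(u_1,u_2)$ are fixed. With memory lengths $\delta_1,\delta_2\ge0$, $Y_j(t)=X(t-\delta_j)$, $\Lambda_j(t)=\int_{t-\delta_j}^tX(s)dB(s)$, $\boldsymbol Y=(Y_1,Y_2)$, $\boldsymbol\Lambda=(\Lambda_1,\Lambda_2)$, the process $X$ solves $$dX(t)=b(t,X(t),\boldsymbol Y(t),\boldsymbol\Lambda(t),\boldsymbol u(t))dt+\sigma(t,X(t),\boldsymbol Y(t),\boldsymbol\Lambda(t),\boldsymbol u(t))dB(t)+\int_{\mathbb R}\gamma(t^-,X(t^-),\boldsymbol Y(t^-),\boldsymbol\Lambda(t^-),\boldsymbol u(t^-),\zeta)\tilde N(dt,d\zeta),\quad X(0)=x.$$ One of the two players is fixed and his index suppressed: $\delta$ is that player's memory length and $y,\Lambda$ (without index) are the corresponding components among $y_1,y_2$ and $\Lambda_1,\Lambda_2$. The triple $(W,Z,K)$ solves $$dW(t)=-g(t,X(t),\boldsymbol Y(t),\boldsymbol\Lambda(t),W(t),Z(t),K(t,\cdot),\boldsymbol u(t))dt+Z(t)dB(t)+\int_{\mathbb R}K(t,\zeta)\tilde N(dt,d\zeta),\quad W(T)=h(X(T)).$$ The coefficients $b,\sigma,\gamma,g$ are predictable (possibly depending on $\omega$)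 and $h$ is $\mathcal F_T$-measurable for each $x$; $\phi,\varphi:\mathbb R\to\mathbb R$ are given differentiable functions and $f$ a given function. Hamiltonians: $$H(t,x,y_1,y_2,\Lambda_1,\Lambda_2,w,z,k,u_1,u_2,\lambda,p,q,r)=f(t,x,y,\Lambda,u_1,u_2)+\lambda g(t,x,y_1,y_2,\Lambda_1,\Lambda_2,w,z,k,u_1,u_2)+pb(t,x,y_1,y_2,\Lambda_1,\Lambda_2,u_1,u_2)+q\sigma(t,x,y_1,y_2,\Lambda_1,\Lambda_2,u_1,u_2)+\int_{\mathbb R}r(\zeta)\gamma(t,x,y_1,y_2,\Lambda_1,\Lambda_2,u_1,u_2,\zeta)\nu(d\zeta),$$ assumed $C^1$ in $x,y_1,y_2,\Lambda_1,\Lambda_2,w,z,k,u_1,u_2$, and $$\mathcal H(t,x,y_1,y_2,\Lambda_1,\Lambda_2,w,z,k,u_1,u_2,\tilde\lambda,p_1,p_2,q_1,q_2,r_1,r_2)=q_2x+H(t,x,y_1,y_2,\Lambda_1,\Lambda_2,w,z,k,u_1,u_2,\tilde\lambda,p_1,q_1,r_1).$$ $H(t)$, $\frac{\partial H}{\partial x}(t)$, etc. denote evaluation along $X,\boldsymbol Y,\boldsymbol\Lambda,W,Z,K,\boldsymbol u$ and the adjoint processes at time $t$ (similarly for $\mathcal H$). $\nabla_kH(t,\zeta)$ is the Fréchet derivative in $k$, identified with its $\nu$-density in $\zeta$. $D_t$ is the Malliavin derivative with respect to $B$, extended (Aase–Øksendal–Privault–Ubøe) to $L^2(\mathcal F_T,P)$,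 with values in the Hida distribution space $(\mathcal S)^*$, so that $(t,\omega)\mapsto E[D_tF|\mathcal F_t]$ is in $L^2(dt\times P)$ and $E[F\int_0^T\theta(t)dB(t)]=E[\int_0^TE[D_tF|\mathcal F_t]\theta(t)dt]$ for $F\in L^2(\mathcal F_T,P)$ and adapted $\theta\in L^2(dt\times P)$.
   Formalization: Besides the printed bound on ∂H/∂z, it is assumed that E[∫_0^T (∂H/∂Λ(t))² dt] < ∞ (z in the printed condition is presumably a slip for Λ); otherwise D_t[∂H/∂Λ(s)] may be undefined, since D_t acts only on L²(F_T,P). *)

(* Defs.v *)
From HB Require Import structures.
From mathcomp Require Import all_boot all_order all_algebra.
From mathcomp Require Import all_classical all_reals all_analysis.
From mathcomp Require Import measurable_realfun.
Set Implicit Arguments.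
Unset Strict Implicit.
Unset Printing Implicit Defensive.
Import Order.TTheory GRing.Theory Num.Def Num.Theory.
Import numFieldNormedType.Exports.
Local Open Scope classical_set_scope.
Local Open Scope ring_scope.

Definition leb {R : realType} : set (measurableTypeR R) -> \bar R :=
  lebesgue_measure.

(* Time runs over [0, hor]; only the restriction of [bm] to [0, hor] and of
   [prm w] to ]0, hor] x R matters. The points of [prm w] are the pairs
   (jump time, jump size). *)
Record noise (R : realType) d (Om : measurableType d) := Noise {
  hor : R ;
  prob : probability Om R ;
  bm : R -> Om -> R ;
  nu : {sigma_finite_measure set (measurableTypeR R) -> \bar R} ;
  prm : Om -> {measure set (measurableTypeR R * measurableTypeR R)%type
                 -> \bar R} }.

Section noise_theory.
Context {R : realType} {d : measure_display} {Om : measurableType d}.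
Context (S : noise R Om).
Local Notation T := (hor S).
Local Notation P := (prob S).
Local Notation B := (bm S).

Definition independent_families (G H : set (set Om)) :=
  forall A C, G A -> H C -> P (A `&` C) = (P A * P C)%E.

Definition sigma_bm (t : R) : set (set Om) :=
  <<s [set A | exists (s : R) (V : set (measurableTypeR R)),
        [/\ 0 <= s <= t, measurable V & A = B s @^-1` V] ]>>.

Definition sigma_prm (t : R) : set (set Om) :=
  <<s [set A | exists (C : set (measurableTypeR R * measurableTypeR R)%type)
                      (V : set (\bar R)),
        [/\ measurable C, C `<=` `]0, t] `*` setT, measurable V
          & A = (fun w => prm S w C) @^-1` V] ]>>.

(* The events of probability 0 are those of the given sigma-algebra of Om, which
   is not assumed to be P-complete. *)
Definition filt (t : R) : set (set Om) :=
  <<s sigma_bm t `|` sigma_prm t `|` [set A | measurable A /\ P A = 0%E] >>.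

Definition brownian_motion :=
  [/\ (forall t : R, 0 <= t <= T -> measurable_fun setT (B t)),
      {ae P, forall w, B 0 w = 0 /\ {within `[0, T], continuous (B ^~ w)}},
      (forall (s t : R) (V : set (measurableTypeR R)),
         0 <= s -> s < t -> t <= T -> measurable V ->
         P ((fun w => B t w - B s w) @^-1` V)
         = normal_prob 0 (Num.sqrt (t - s)) V)
    & (forall s t : R, 0 <= s -> s < t -> t <= T ->
         independent_families (sigma_bm s)
           [set A | exists V : set (measurableTypeR R),
              measurable V /\ A = (fun w => B t w - B s w) @^-1` V])].

Definition levy_measure :=
  nu S [set 0] = 0%E /\
  (\int[nu S]_z (Num.min 1 (z ^+ 2))%:E < +oo)%E.

Definition intensity (C : set (measurableTypeR R * measurableTypeR R)%type)
  : \bar R := (leb \x nu S)%E C.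

(* Subsets of ]0, T] x R on which the compensated measure is defined. *)
Definition finite_mass (C : set (measurableTypeR R * measurableTypeR R)%type) :=
  [/\ measurable C, C `<=` `]0, T] `*` setT & (intensity C < +oo)%E].

(* The second argument of [poisson_prob] is a dummy of the library. *)
Definition poisson_random_measure :=
  [/\ (forall C, measurable C -> C `<=` `]0, T] `*` setT ->
         measurable_fun setT (fun w => prm S w C)),
      (forall C (k : nat), finite_mass C ->
         P [set w | prm S w C = k%:R%:E]
         = poisson_prob (fine (intensity C)) 0%N [set k])
    & (forall n (C : 'I_n -> set (measurableTypeR R * measurableTypeR R)%type)
              (k : 'I_n -> nat),
         (forall j, finite_mass (C j)) -> trivIset setT C ->
         P [set w | forall j, prm S w (C j) = (k j)%:R%:E]
         = (\prod_(j < n) P [set w | prm S w (C j) = (k j)%:R%:E])%E)].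

Definition compensated (C : set (measurableTypeR R * measurableTypeR R)%type)
  (w : Om) : R := fine (prm S w C) - fine (intensity C).

Definition driving_noise :=
  [/\ 0 < T, brownian_motion, levy_measure, poisson_random_measure
    & independent_families (sigma_bm T) (sigma_prm T)].

Definition wrt (G : set (set Om)) (F : Om -> R) :=
  forall V : set (measurableTypeR R), measurable V -> G (F @^-1` V).

Definition adapted (a : R -> Om -> R) :=
  forall t : R, 0 <= t <= T -> wrt (filt t) (a t).

Definition time_space : set (measurableTypeR R * Om)%type := `[0, T] `*` setT.

Definition predictable_sets : set (set (measurableTypeR R * Om)%type) :=
  <<s time_space,
      [set D | (exists (s t : R) A, [/\ 0 <= s, s < t, t <= T, filt s A
                                & D = `]s, t] `*` A])
            \/ (exists2 A, filt 0 A & D = [set 0] `*` A)] >>.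

Definition predictable (a : R -> Om -> R) :=
  forall V : set (measurableTypeR R), measurable V ->
    predictable_sets (time_space `&` (fun z => a z.1 z.2) @^-1` V).

Definition jointly_measurable (a : R -> Om -> R) :=
  measurable_fun time_space
    (fun z : (measurableTypeR R * Om)%type => a z.1 z.2).

Definition sqnorm (a : R -> Om -> R) : \bar R :=
  (\int[P]_w \int[leb]_(t in `[0%R, T]) ((a t w) ^+ 2)%:E)%E.

(* L^2(dt x P) *)
Definition L2_process (a : R -> Om -> R) :=
  jointly_measurable a /\ (sqnorm a < +oo)%E.

(* L^2(nu) *)
Definition L2_jump (k : R -> R) :=
  measurable_fun setT (k : measurableTypeR R -> R) /\
  (\int[nu S]_z ((k z) ^+ 2)%:E < +oo)%E.

Definition norm_jump (k : R -> R) : R :=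
  Num.sqrt (fine (\int[nu S]_z ((k z) ^+ 2)%:E)).

Definition sqnorm_jump (a : R -> Om -> R -> R) : \bar R :=
  (\int[P]_w \int[leb]_(t in `[0%R, T]) \int[nu S]_z ((a t w z) ^+ 2)%:E)%E.

(* L^2(dt x P x nu) *)
Definition L2_jump_process (a : R -> Om -> R -> R) :=
  measurable_fun (time_space `*` setT)
    (fun z : (measurableTypeR R * Om * measurableTypeR R)%type =>
       a z.1.1 z.1.2 z.2) /\
  (sqnorm_jump a < +oo)%E.

Definition cadlag (x : R -> R) :=
  (forall t : R, 0 <= t < T -> x s @[s --> t^'+] --> x t) /\
  (forall t : R, 0 < t <= T -> cvg (x s @[s --> t^'-])).

Definition almost_all_times (Q : R -> Prop) :=
  {ae leb, forall t : measurableTypeR R, 0 <= t <= T -> Q t}.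

(* [Y] is a version of E[X | G]. *)
Definition cond_exp (G : set (set Om)) (X Y : Om -> R) :=
  [/\ P.-integrable setT (EFin \o X), P.-integrable setT (EFin \o Y), wrt G Y
    & forall A, G A -> (\int[P]_(w in A) (Y w)%:E = \int[P]_(w in A) (X w)%:E)%E].

(* The elementary integrand  coef 1_]lo, hi]. *)
Record step := Step { lo : R ; hi : R ; coef : Om -> R }.

Definition step_ok (e : step) :=
  [/\ 0 <= lo e, lo e <= hi e, hi e <= T, wrt (filt (lo e)) (coef e)
    & exists M : R, forall w, `|coef e w| <= M].

Definition simple (s : seq step) := forall n, (n < size s)%N ->
  step_ok (nth (Step 0 0 (cst 0)) s n).

Definition simple_val (s : seq step) (t : R) (w : Om) : R :=
  \sum_(e <- s) coef e w * \1_(`]lo e, hi e]) t.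

Definition simple_int (s : seq step) (t : R) (w : Om) : R :=
  \sum_(e <- s) coef e w * (B (Num.min (hi e) t) w - B (Num.min (lo e) t) w).

(* [I t] is the Ito integral of [a] over ]0, t], in a continuous version. *)
Definition ito_integral (a I : R -> Om -> R) :=
  [/\ L2_process a,
      (forall t : R, 0 <= t <= T -> measurable_fun setT (I t)),
      {ae P, forall w, {within `[0, T], continuous (I ^~ w)}}
    & exists s : nat -> seq step,
      [/\ (forall n, simple (s n)),
          sqnorm (fun t w => simple_val (s n) t w - a t w)
            @[n --> \oo] --> 0%E
        & forall t : R, 0 <= t <= T ->
          (\int[P]_w ((simple_int (s n) t w - I t w) ^+ 2)%:E)%E
            @[n --> \oo] --> 0%E]].

(* The elementary integrand  coef 1_(]lo, hi] x A). *)
Definition jump_step := (step * set (measurableTypeR R))%type.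

Definition jump_simple (s : seq jump_step) := forall n, (n < size s)%N ->
  let e := nth (Step 0 0 (cst 0), set0) s n in
  [/\ step_ok e.1, measurable e.2 & (nu S e.2 < +oo)%E].

Definition jump_simple_val (s : seq jump_step) (t : R) (w : Om) (z : R) : R :=
  \sum_(e <- s) coef e.1 w * \1_(`]lo e.1, hi e.1]) t * \1_(e.2) z.

Definition jump_simple_int (s : seq jump_step) (t : R) (w : Om) : R :=
  \sum_(e <- s) coef e.1 w *
    compensated (`]Num.min (lo e.1) t, Num.min (hi e.1) t] `*` e.2) w.

(* [J t] is the integral of [a] over ]0, t] x R against the compensated
   Poisson random measure, in a cadlag version. *)
Definition jump_integral (a : R -> Om -> R -> R) (J : R -> Om -> R) :=
  [/\ L2_jump_process a,
      (forall t : R, 0 <= t <= T -> measurable_fun setT (J t)),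
      {ae P, forall w, cadlag (J ^~ w)}
    & exists s : nat -> seq jump_step,
      [/\ (forall n, jump_simple (s n)),
          sqnorm_jump (fun t w z => jump_simple_val (s n) t w z - a t w z)
            @[n --> \oo] --> 0%E
        & forall t : R, 0 <= t <= T ->
          (\int[P]_w ((jump_simple_int (s n) t w - J t w) ^+ 2)%:E)%E
            @[n --> \oo] --> 0%E]].

(* dX(t) = a(t) dt + c(t) dB(t) + int_R k(t, z) N~(dt, dz) on [0, T] *)
Definition has_differential (X a c : R -> Om -> R) (k : R -> Om -> R -> R) :=
  exists I J : R -> Om -> R,
  [/\ adapted X, jointly_measurable a, ito_integral c I, jump_integral k J
    & {ae P, forall w,
        [/\ cadlag (X ^~ w),
            leb.-integrable `[0%R, T] (fun t => (a t w)%:E)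
          & forall t : R, 0 <= t <= T ->
            X t w = X 0 w + (\int[leb]_(s in `[0, t]) a s w) + I t w + J t w]}].

(* L(t) = int_{t - delta}^t X(s) dB(s); the noise starts at time 0. *)
Definition noisy_memory (delta : R) (X L : R -> Om -> R) :=
  exists2 I, ito_integral X I &
    {ae P, forall w, forall t : R, 0 <= t <= T ->
      L t w = I t w - I (Num.max 0 (t - delta)) w}.

(* dp(t) = - E[mu(t) | F_t] dt + q(t) dB(t) + int_R r(t, z) N~(dt, dz),
   p(T) = xi *)
Definition backward_equation (p mu q : R -> Om -> R) (r : R -> Om -> R -> R)
    (xi : Om -> R) :=
  exists m : R -> Om -> R,
  [/\ almost_all_times (fun t => cond_exp (filt t) (mu t) (m t)),
      has_differential p (fun t w => - m t w) q r
    & {ae P, forall w, p T w = xi w}].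

(* C^1 functions of n variables, bounded together with their derivatives. *)
Definition C1_bounded n (phi : 'rV[R]_n -> R) :=
  [/\ (exists M : R, forall x, `|phi x| <= M),
      (forall x, differentiable phi x)
    & forall v, continuous ('D_v phi) /\ exists M : R, forall x, `|'D_v phi x| <= M].

(* F = phi(B(t_1), ..., B(t_n), N(C_1), ..., N(C_m)) is a cylindrical
   functional and D is its Malliavin derivative with respect to B,
     D_t F = sum_j d_j phi(...) 1_[0, t_j](t),
   which is the derivative of phi in the direction whose j-th coordinate is
   1_[0, t_j](t) for j <= n and 0 for j > n. *)
Definition cylindrical (F : Om -> R) (D : R -> Om -> R) :=
  exists n m (ti : 'I_n -> R)
         (C : 'I_m -> set (measurableTypeR R * measurableTypeR R)%type)
         (phi : 'rV[R]_(n + m) -> R),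
  let arg w := row_mx (\row_(j < n) B (ti j) w)
                      (\row_(j < m) fine (prm S w (C j))) in
  let dir t := row_mx (\row_(j < n) \1_(`[0, ti j]) t) 0 in
  [/\ (forall j, 0 <= ti j <= T), (forall j, finite_mass (C j)),
      C1_bounded phi, F = (fun w => phi (arg w))
    & D = (fun t w => 'D_(dir t) phi (arg w))].

(* [G] is a version of (t, w) |-> E[D_t F | F_t](w), for F in L^2(F_T, P).
   The derivative D_t F of such an F is a Hida distribution in general, but
   F |-> E[D_. F | F_.] is continuous from L^2(F_T, P) to L^2(dt x P), and the
   cylindrical functionals are dense: it is the continuous extension of its
   restriction to these functionals. *)
Definition cond_malliavin (F : Om -> R) (G : R -> Om -> R) :=
  exists (Fn : nat -> Om -> R) (Dn Mn : nat -> R -> Om -> R),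
  [/\ L2_process G, (forall n, cylindrical (Fn n) (Dn n)),
      (forall n, jointly_measurable (Mn n) /\
         almost_all_times (fun t => cond_exp (filt t) (Dn n t) (Mn n t))),
      (measurable_fun setT F /\
       (\int[P]_w ((Fn n w - F w) ^+ 2)%:E)%E @[n --> \oo] --> 0%E)
    & sqnorm (fun t w => Mn n t w - G t w) @[n --> \oo] --> 0%E].

(* [G s t w] is a version of E[D_t[A(s)] | F_t](w) which is square integrable
   with respect to ds x dt x P. *)
Definition cond_malliavin_field (A : R -> Om -> R) (G : R -> R -> Om -> R) :=
  [/\ measurable_fun (`[0, T] `*` time_space)
        (fun z : (measurableTypeR R * (measurableTypeR R * Om))%type =>
           G z.1 z.2.1 z.2.2),
      (\int[leb]_(s in `[0%R, T]) sqnorm (G s) < +oo)%E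
    & almost_all_times (fun s => cond_malliavin (A s) (G s))].

(* The arguments (x, y_1, y_2, Lambda_1, Lambda_2, w, z, k, u_1, u_2). *)
Record harg := Harg {
  arg_x : R ; arg_y : 'I_2 -> R ; arg_L : 'I_2 -> R ; arg_w : R ; arg_z : R ;
  arg_k : R -> R ; arg_u : 'I_2 -> R }.

Inductive hvar := Cx | Cy of 'I_2 | CL of 'I_2 | Cw | Cz | Cu of 'I_2.

Definition get (c : hvar) (v : harg) : R :=
  match c with
  | Cx => arg_x v | Cy j => arg_y v j | CL j => arg_L v j
  | Cw => arg_w v | Cz => arg_z v | Cu j => arg_u v j
  end.

Definition upd (y : 'I_2 -> R) (j : 'I_2) (a : R) : 'I_2 -> R :=
  fun l => if l == j then a else y l.

Definition put (c : hvar) (v : harg) (a : R) : harg :=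
  let: Harg x y L w z k u := v in
  match c with
  | Cx => Harg a y L w z k u
  | Cy j => Harg x (upd y j a) L w z k u
  | CL j => Harg x y (upd L j a) w z k u
  | Cw => Harg x y L a z k u
  | Cz => Harg x y L w a k u
  | Cu j => Harg x y L w z k (upd u j a)
  end.

Definition putk (v : harg) (k : R -> R) : harg :=
  Harg (arg_x v) (arg_y v) (arg_L v) (arg_w v) (arg_z v) k (arg_u v).

Definition partial (c : hvar) (Phi : harg -> R) (v : harg) : R :=
  derive1 (fun a => Phi (put c v a)) (get c v).

(* [D] is the nu-density of the Frechet derivative at [arg_k v], on L^2(nu), of
   k |-> Phi(..., k, ...). *)
Definition frechet_density (Phi : harg -> R) (v : harg) (D : R -> R) :=
  [/\ L2_jump (arg_k v), L2_jump D
    & forall e : R, 0 < e -> exists2 eta : R, 0 < eta &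
      forall l, L2_jump l -> norm_jump l <= eta ->
        `|Phi (putk v (fun z => arg_k v z + l z)) - Phi v
          - \int[nu S]_z (D z * l z)| <= e * norm_jump l].

Definition harg_cvg (vn : nat -> harg) (v : harg) :=
  (forall c, get c (vn n) @[n --> \oo] --> get c v) /\
  norm_jump (fun z => arg_k (vn n) z - arg_k v z) @[n --> \oo] --> (0 : R).

(* Continuously differentiable in all the arguments, on the domain where the
   argument k belongs to L^2(nu). *)
Definition continuously_differentiable (Phi : harg -> R) :=
  [/\ (forall c v, L2_jump (arg_k v) ->
         derivable (fun a => Phi (put c v a)) (get c v) 1),
      (forall c vn v, (forall n, L2_jump (arg_k (vn n))) -> L2_jump (arg_k v) ->
         harg_cvg vn v ->
         partial c Phi (vn n) @[n --> \oo] --> partial c Phi v)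
    & exists2 grad : harg -> R -> R,
        (forall v, L2_jump (arg_k v) -> frechet_density Phi v (grad v)) &
        forall vn v, (forall n, L2_jump (arg_k (vn n))) -> L2_jump (arg_k v) ->
          harg_cvg vn v ->
          norm_jump (fun z => grad (vn n) z - grad v z) @[n --> \oo] --> (0 : R)].

(* The coefficients b, sigma take (t, x, y, Lambda, u, w) as arguments, gamma
   moreover the jump size and g moreover the values of W, Z and K. The running
   payoff f of the fixed player i only sees y_i and Lambda_i. *)
Definition diff_coef := R -> R -> ('I_2 -> R) -> ('I_2 -> R) -> ('I_2 -> R) ->
  Om -> R.
Definition jump_coef := R -> R -> ('I_2 -> R) -> ('I_2 -> R) -> ('I_2 -> R) ->
  R -> Om -> R.
Definition driver := R -> R -> ('I_2 -> R) -> ('I_2 -> R) -> R -> R ->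
  (R -> R) -> ('I_2 -> R) -> Om -> R.
Definition payoff := R -> R -> R -> R -> ('I_2 -> R) -> Om -> R.

Context (b sigma : diff_coef) (gamma : jump_coef) (g : driver) (f : payoff)
  (i : 'I_2).

Definition predictable_coefficients :=
  [/\ (forall x y L u, predictable (fun t => b t x y L u)),
      (forall x y L u, predictable (fun t => sigma t x y L u)),
      (forall x y L u z, predictable (fun t => gamma t x y L u z))
    & (forall x y L w z k u, L2_jump k ->
         predictable (fun t => g t x y L w z k u))].

Definition hamiltonian (t : R) (om : Om) (v : harg) (lam p q : R)
    (r : R -> R) : R :=
  let: Harg x y L w z k u := v in
  f t x (y i) (L i) u om + lam * g t x y L w z k u om
  + p * b t x y L u om + q * sigma t x y L u om
  + \int[nu S]_zeta (r zeta * gamma t x y L u zeta om).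

(* p2 and r2 are arguments of the extended Hamiltonian but do not occur in it. *)
Definition extended_hamiltonian (t : R) (om : Om) (v : harg)
    (lam p1 p2 q1 q2 : R) (r1 r2 : R -> R) : R :=
  q2 * arg_x v + hamiltonian t om v lam p1 q1 r1.

(* For all values of the adjoint variables, the integral in H is defined and H
   is C^1. *)
Definition regular_hamiltonian :=
  forall t om lam p q r, 0 <= t <= T -> L2_jump r ->
    (forall x y L u, (nu S).-integrable setT
       (fun zeta => (r zeta * gamma t x y L u zeta om)%:E)) /\
    continuously_differentiable (fun v => hamiltonian t om v lam p q r).

(* The adjoint equation for lambda, where [Ham t w] is the Hamiltonian as a
   function of the arguments (x, ..., u_2) and [V t w] the current value of these
   arguments. [grad t w] is grad_k Ham(t, .). *)
Definition forward_adjoint_equation (lam : R -> Om -> R)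
    (Ham : R -> Om -> harg -> R) (V : R -> Om -> harg) (init : Om -> R) :=
  exists grad : R -> Om -> R -> R,
  [/\ almost_all_times (fun t =>
         {ae P, forall w, frechet_density (Ham t w) (V t w) (grad t w)}),
      has_differential lam (fun t w => partial Cw (Ham t w) (V t w))
        (fun t w => partial Cz (Ham t w) (V t w)) grad
    & {ae P, forall w, lam 0 w = init w}].

End noise_theory.

(* Main.v *)
Require Import Defs.
From HB Require Import structures.
From mathcomp Require Import all_boot all_order all_algebra.
From mathcomp Require Import all_classical all_reals all_analysis.
From mathcomp Require Import measurable_realfun lra ring.
Set Implicit Arguments.
Unset Strict Implicit.
Unset Printing Implicit Defensive.
Import Order.TTheory GRing.Theory Num.Def Num.Theory.
Import numFieldNormedType.Exports.
Local Open Scope classical_set_scope.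
Local Open Scope ring_scope.

(** Write A for the process dH/dLambda and
      G(t) = int_t^(t + delta) E[D_t A(s) | F_t] ds.
   The point is that q2 = G, dt x P-almost everywhere. Given this, the term q2 x by
   which the two Hamiltonians differ depends neither on w nor on z nor on k, so that it
   disappears from the equation of lambda (forward_linear_state); and in the equation
   of p1, where q2 enters through a conditional expectation, it may be replaced by G
   for almost every t (cond_exp_swap).

   The identity q2 = G is obtained in L^2(dt x P) from two facts about D = q2 - G.

   First, D is orthogonal to all the elementary processes c 1_]u, v], where c is bounded
   and F_u-measurable (adjoint_gap_orth). To see this, take the equation of p2 over the
   whole of [0, T] and multiply it by c (B(v) - B(u)). The Ito integral contributes the
   inner product of q2 with c 1_]u, v], by the isometry (ito_ip). The initial value
   contributes nothing, since increments are orthogonal to their past, nor does the jump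
   integral, since the jumps after a time l are independent of B and of the jumps before
   l (indep_late, jump_ip). In the drift, m(s) = E[mu2(s) | F_s] only sees the part of
   the increment that precedes s; there it may be replaced by A(s) minus the delayed
   term A(s + delta), and the substitution of s for s + delta in the latter leaves
     int E[A(s) c (B(b_s) - B(a_s))] ds,  with ]a_s, b_s] = ]u, v] cap ]s - delta, s].
   By the duality formula (malliavin_duality) this is the inner product of G with
   c 1_]u, v] (drift_step, memory_step).

   Second, q2 and G are limits of elementary processes, so that D is orthogonal to both
   (ito_orth, memory_orth) and therefore to itself. For q2 this is the definition of the
   Ito integral. For G it is enough to consider E[D_t F | F_t] for a cylindrical
   functional F of the values of B at times t_j and of jump counts. Between consecutive
   times t_j the variable D_t F = Q does not depend on t, so that E[D_t F | F_t] is the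
   bounded martingale E[Q | F_t]; by orthogonality of its increments, it is approximated
   by the step processes obtained by freezing it along a fine subdivision (free_orth).

   The duality formula is proved likewise for cylindrical functionals on the intervals
   that contain no t_j. There F depends on B(b) - B(a) through phi(xi + x e), with xi and
   c independent of this Gaussian increment, and the formula is Stein's identity
   (normal_ibp, cylinder_ibp); it extends to ]u, v] by additivity, and to the functionals
   A(s) by continuity. *)

Lemma cvgn_unique {R : realType} (u : nat -> R) (a b : R) :
  u n @[n --> \oo] --> a -> u n @[n --> \oo] --> b -> a = b.
Proof. by move=> ua ub; rewrite -(cvg_lim _ ua)// -(cvg_lim _ ub). Qed.

Lemma young {R : realType} (e x y : R) : 0 < e ->
  `|x * y| <= (2 * e)^-1 * x ^+ 2 + e / 2 * y ^+ 2.
Proof.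
move=> e0.
have -> : (2 * e)^-1 * x ^+ 2 + e / 2 * y ^+ 2 = (2 * e)^-1 * (x ^+ 2 + (e * y) ^+ 2).
  by field; rewrite gt_eqF.
rewrite ler_pdivlMl ?mulr_gt0// -[2 * e](@gtr0_norm _ (2 * e)) ?mulr_gt0// -normrM.
have -> : 2 * e * (x * y) = x * (e * y) *+ 2 by rewrite mulr2n; ring.
have := sqr_ge0 (x - e * y); have := sqr_ge0 (x + e * y).
rewrite sqrrB sqrrD ler_norml; move: (x * _) => u.
by move=> h1 h2; apply/andP; split; lra.
Qed.

(** * Square integrable functions *)

Section square_integrable.
Context {R : realType} d (T : measurableType d) (mu : {measure set T -> \bar R}).
Implicit Types f g : T -> R.

Definition sqint f :=
  measurable_fun setT f /\ (\int[mu]_x ((f x) ^+ 2)%:E < +oo)%E.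

Lemma sqintP f : sqint f <->
  measurable_fun setT f /\ mu.-integrable setT (fun x => ((f x) ^+ 2)%:E).
Proof.
split=> -[mf]; last first.
  by move=> /integrableP[_]; under eq_integral do rewrite /= ger0_norm ?sqr_ge0//.
move=> fi; split=> //; apply/integrableP; split.
  by apply/measurable_EFinP; exact: measurable_funX.
by under eq_integral do rewrite /= ger0_norm ?sqr_ge0//.
Qed.

Lemma integrable_le f g : measurable_fun setT f ->
  mu.-integrable setT (EFin \o g) -> (forall x, `|f x| <= g x) ->
  mu.-integrable setT (EFin \o f).
Proof.
move=> mf ig fg; apply: (le_integrable measurableT _ _ ig).
  exact/measurable_EFinP.
by move=> x _ /=; rewrite lee_fin (le_trans (fg x))// ler_norm.
Qed.

Lemma integrableRD f g : mu.-integrable setT (EFin \o f) ->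
  mu.-integrable setT (EFin \o g) -> mu.-integrable setT (EFin \o (f \+ g)).
Proof. by move=> fi gi; apply: integrableD fi gi. Qed.

Lemma integrableRB f g : mu.-integrable setT (EFin \o f) ->
  mu.-integrable setT (EFin \o g) -> mu.-integrable setT (EFin \o (f \- g)).
Proof. by move=> fi gi; apply: integrableB fi gi. Qed.

Lemma integrableRZ c f : mu.-integrable setT (EFin \o f) ->
  mu.-integrable setT (EFin \o (fun x => c * f x)).
Proof. by move=> fi; have := integrableZl measurableT c fi. Qed.

Lemma sqint_mulr_integrable f g : sqint f -> sqint g ->
  mu.-integrable setT (EFin \o (fun x => f x * g x)).
Proof.
move=> /sqintP[mf fi] /sqintP[mg gi].
apply: (integrable_le _ (integrableRD fi gi)); first exact: measurable_funM.
by move=> x /=; rewrite ler_norml; apply/andP; split; nra.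
Qed.

Lemma sqintD f g : sqint f -> sqint g -> sqint (f \+ g).
Proof.
move=> /sqintP[mf fi] /sqintP[mg gi]; apply/sqintP; split.
  exact: measurable_funD.
apply: (integrable_le _ (integrableRZ 2 (integrableRD fi gi))).
  by apply: measurable_funX; exact: measurable_funD.
move=> x /=; rewrite ger0_norm ?sqr_ge0//.
by have := sqr_ge0 (f x - g x); rewrite sqrrB sqrrD; lra.
Qed.

Lemma sqintM_bounded f g (M : R) : sqint f -> measurable_fun setT g ->
  (forall x, `|g x| <= M) -> sqint (fun x => g x * f x).
Proof.
move=> /sqintP[mf fi] mg gM; apply/sqintP; split; first exact: measurable_funM.
apply: (integrable_le _ (integrableRZ (M ^+ 2) fi)).
  by apply: measurable_funX; exact: measurable_funM.
move=> x /=; rewrite ger0_norm ?sqr_ge0// exprMn ler_wpM2r ?sqr_ge0//.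
by rewrite -(real_normK (num_real (g x))) ler_sqr ?nnegrE// (le_trans _ (gM x)).
Qed.

Lemma sqintZ c f : sqint f -> sqint (fun x => c * f x).
Proof. by move=> fi; apply: (@sqintM_bounded f (cst c) `|c|). Qed.

Lemma sqintN f : sqint f -> sqint (\- f).
Proof.
by move=> /(sqintZ (-1)); congr sqint; apply/funext => x; rewrite mulN1r.
Qed.

Lemma sqintB f g : sqint f -> sqint g -> sqint (f \- g).
Proof. by move=> fi gi; apply: sqintD => //; exact: sqintN. Qed.

Lemma sqint0 : sqint (cst 0).
Proof.
split; first exact: measurable_cst.
by under eq_integral do rewrite expr0n/=; rewrite integral0.
Qed.

(** By Young's inequality |f_n g - f g| <= (f_n - f)^2 / (2 k) + k g^2 / 2, with k
   proportional to the tolerance. The approximating sequences used below are only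
   known to converge, whence the first conclusion. *)
Lemma ip_cvg (f_ : nat -> T -> R) f g :
  (forall n, measurable_fun setT (f_ n)) -> sqint f -> sqint g ->
  (\int[mu]_x ((f_ n x - f x) ^+ 2)%:E)%E @[n --> \oo] --> 0%E ->
  (\forall n \near \oo, sqint (f_ n)) /\
  (\int[mu]_x (f_ n x * g x)) @[n --> \oo] --> \int[mu]_x (f x * g x).
Proof.
move=> mf_ fi gi f_f.
have near_lt (e : R) : 0 < e -> \forall n \near \oo,
    (\int[mu]_x ((f_ n x - f x) ^+ 2)%:E < e%:E)%E.
  move=> e0.
  move/fine_cvgP: f_f => [fin_n /cvgrPdist_lt /(_ e e0)].
  apply: filterS2 fin_n => n fin_n /=; rewrite sub0r normrN.
  by rewrite -[X in (X < _)%E]fineK// lte_fin; exact/le_lt_trans/ler_norm.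
have sqd : \forall n \near \oo, sqint (f_ n \- f).
  apply: filterS (near_lt 1 ltr01) => n fn1; split.
    by apply: measurable_funB => //; have [] := fi.
  by rewrite (lt_trans fn1)// ltry.
split.
  apply: filterS sqd => n sqd.
  suff -> : f_ n = (f_ n \- f) \+ f by exact: sqintD.
  by apply/funext => x /=; rewrite subrK.
apply/cvgrPdist_le => /= e e0.
pose G := \int[mu]_x (g x) ^+ 2.
have G0 : 0 <= G by apply: Rintegral_ge0 => x _; exact: sqr_ge0.
pose k := e / (G + 1).
have k0 : 0 < k by rewrite divr_gt0// ltr_wpDl.
have ek0 : 0 < e * k by rewrite mulr_gt0.
apply: filterS2 sqd (near_lt _ ek0) => n sqd dn.
have fni : sqint (f_ n).
  suff -> : f_ n = (f_ n \- f) \+ f by exact: sqintD.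
  by apply/funext => x /=; rewrite subrK.
rewrite -RintegralB//; last 2 first.
- exact: sqint_mulr_integrable.
- exact: sqint_mulr_integrable.
have /sqintP[_ di] := sqd; have /sqintP[_ g2i] := gi.
have bi : mu.-integrable setT (EFin \o
   (fun x => (2 * k)^-1 * (f_ n x - f x) ^+ 2 + k / 2 * (g x) ^+ 2)).
  by apply: integrableRD; apply: integrableRZ.
have fgi : mu.-integrable setT (EFin \o (fun x => f x * g x - f_ n x * g x)).
  by apply: integrableRB; exact: sqint_mulr_integrable.
apply: (@le_trans _ _ (\int[mu]_x `|f x * g x - f_ n x * g x|)).
  exact: le_normr_Rintegral.
apply: (@le_trans _ _ (\int[mu]_x
   ((2 * k)^-1 * (f_ n x - f x) ^+ 2 + k / 2 * (g x) ^+ 2))).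
  apply: le_Rintegral => //; first exact: (@integrable_norm _ _ _ mu).
  by move=> x _; rewrite -mulrBl -normrN -mulNr opprB; exact: young.
rewrite RintegralD//; last 2 first.
- by apply: integrableRZ.
- by apply: integrableRZ.
rewrite !RintegralZl// -/G.
have : \int[mu]_x (f_ n x - f x) ^+ 2 <= e * k.
  rewrite -lee_fin /Rintegral fineK; first exact: ltW.
  rewrite ge0_fin_numE; last by apply: integral_ge0 => x _; rewrite lee_fin sqr_ge0.
  exact: lt_trans dn (ltry _).
move=> h.
have h1 : (2 * k)^-1 * \int[mu]_x (f_ n x - f x) ^+ 2 <= 2^-1 * e.
  rewrite -(ler_pM2l k0).
  have -> : k * ((2 * k)^-1 * \int[mu]_x (f_ n x - f x) ^+ 2) =
      2^-1 * \int[mu]_x (f_ n x - f x) ^+ 2 by field; rewrite gt_eqF.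
  lra.
have h2 : k / 2 * G <= 2^-1 * e.
  rewrite (mulrC k) -mulrA ler_wpM2l ?invr_ge0// /k mulrAC ler_pdivrMr ?ltr_wpDl//.
  by rewrite ler_wpM2l ?(ltW e0)// lerDl.
lra.
Qed.

End square_integrable.

(** * Fubini's theorem for real-valued integrals *)

Section Rfubini.
Context {R : realType} d1 d2 (T1 : measurableType d1) (T2 : measurableType d2).
Variables (m1 : {sigma_finite_measure set T1 -> \bar R})
  (m2 : {sigma_finite_measure set T2 -> \bar R}).
Variable F : T1 * T2 -> R.
Hypothesis iF : (m1 \x m2)%E.-integrable setT (EFin \o F).

Lemma fine_integrable d (T : measurableType d) (mu : {measure set T -> \bar R})
    (f : T -> \bar R) : mu.-integrable setT f ->
  mu.-integrable setT (EFin \o fine \o f).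
Proof.
move=> fi; apply: (le_integrable _ _ _ fi) => //.
  by apply/measurable_EFinP; apply: measurableT_comp => //; exact: measurable_int fi.
by move=> x _ /=; case: (f x) => [r| |] //=; rewrite normr0 leey.
Qed.

Lemma integral_fine d (T : measurableType d) (mu : {measure set T -> \bar R})
    (f : T -> \bar R) : mu.-integrable setT f ->
  (\int[mu]_x (fine (f x))%:E = \int[mu]_x f x)%E.
Proof.
move=> fi; apply: ae_eq_integral => //.
- exact: (measurable_int _ (fine_integrable fi)).
- exact: measurable_int fi.
- apply: filterS (integrable_ae measurableT fi) => x /(_ I) fx _.
  by rewrite fineK.
Qed.

Lemma integrable_fubini_G' : m2.-integrable setT (fubini_G m1 (EFin \o F)).
Proof.
have mF := measurable_int _ iF.
have maF : measurable_fun setT (fun y => \int[m1]_x `|(F (x, y))%:E|)%E.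
  apply: (measurable_fun_fubini_tonelli_G (abse \o (EFin \o F))) => //=.
  exact: measurableT_comp.
apply: (le_integrable measurableT (measurable_fubini_G iF)); last first.
  apply/integrableP; split; first exact: maF.
  rewrite (eq_integral (fun y => \int[m1]_x `|(F (x, y))%:E|)%E).
    exact: (integrable21ltyP m1 m2 mF).1.
  by move=> y _; rewrite gee0_abs//; exact: integral_ge0.
move=> y _; rewrite [leRHS]gee0_abs ?integral_ge0//.
apply: le_abse_integral => //; exact: measurableT_comp.
Qed.

Lemma Rfubini1_integrable :
  m1.-integrable setT (EFin \o (fun x => \int[m2]_y F (x, y))).
Proof. exact: (fine_integrable (integrable_fubini_F iF)). Qed.

Lemma Rfubini2_integrable :
  m2.-integrable setT (EFin \o (fun y => \int[m1]_x F (x, y))).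
Proof. exact: (fine_integrable integrable_fubini_G'). Qed.

Lemma Rfubini1 : \int[(m1 \x m2)%E]_z F z = \int[m1]_x \int[m2]_y F (x, y).
Proof.
rewrite /Rintegral -integral12_prod_meas1//; congr fine.
by rewrite -(integral_fine (integrable_fubini_F iF)).
Qed.

Lemma Rfubini2 : \int[(m1 \x m2)%E]_z F z = \int[m2]_y \int[m1]_x F (x, y).
Proof.
rewrite /Rintegral -integral21_prod_meas1//; congr fine.
by rewrite -(integral_fine integrable_fubini_G').
Qed.

End Rfubini.

Lemma integral_distr {R : realType} d d' (T : measurableType d)
    (T' : measurableType d') (P : probability T R) (X : {mfun T >-> T'})
    (f : T' -> \bar R) : measurable_fun setT f ->
  (\int[distribution P X]_y f y = \int[P]_x (f \o X) x)%E.
Proof.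
move=> mf; rewrite integralE [RHS]integralE.
under [X in (_ = X - _)%E]eq_integral do rewrite funepos_comp/=.
under [X in (_ = _ - X)%E]eq_integral do rewrite funeneg_comp/=.
congr (_ - _)%E.
- have mp := measurable_funepos mf.
  by rewrite (ge0_integral_distribution X mp).
- have mn := measurable_funeneg mf.
  by rewrite (ge0_integral_distribution X mn).
Qed.

(** * Independence *)

Section independence.
Context {R : realType} d (Om : measurableType d) (P : probability Om R).
Implicit Types (G : set (set Om)) (A C D E N : set Om).

Lemma eq_prob_mod E E' N : measurable E -> measurable E' -> measurable N ->
  P N = 0%E -> E `\` N = E' `\` N -> P E = P E'.
Proof.
move=> mE mE' mN N0 EE.
have PD F : measurable F -> P F = P (F `\` N).
  move=> mF; rewrite (measureDI P mF mN) [X in (_ + X)%E](_ : _ = 0%E) ?adde0//.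
  by apply: subset_measure0 N0 => //; exact: measurableI.
by rewrite (PD E)// (PD E')// EE.
Qed.

(** Both sides are finite measures in A: this is Dynkin's pi-lambda theorem. *)
Lemma indep_gen G D : setI_closed G -> G setT -> G `<=` measurable ->
  measurable D -> (forall A, G A -> P (A `&` D) = (P A * P D)%E) ->
  forall A, <<s G >> A -> P (A `&` D) = (P A * P D)%E.
Proof.
move=> GI GT mG mD GD A GA.
have PD0 : 0 <= fine (P D) by exact: fine_ge0.
have -> : (P A * P D = mscale (NngNum PD0) P A)%E.
  by rewrite /mscale/= fineK ?fin_num_measure// muleC.
apply: (g_sigma_algebra_measure_unique G mG (fun=> setT) _ _ (mrestr P mD) _ GI) => //.
- by rewrite bigcup_const//; exists 0%N.
- move=> B GB; change (P (B `&` D) = ((fine (P D))%:E * P B)%E).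
  by rewrite fineK ?fin_num_measure// muleC; exact: GD.
- move=> _; rewrite /mrestr (le_lt_trans (probability_le1 P _)) ?ltry//.
  by apply: measurableI.
Qed.

(** The sets which are, up to a null event, of the form A `&` C with A in S1 and
   C in S2 are a pi-system that generates the join. *)
Lemma indep_join (S1 S2 : set (set Om)) D :
  setI_closed S1 -> S1 setT -> S1 `<=` measurable -> S1 set0 ->
  setI_closed S2 -> S2 setT -> S2 `<=` measurable ->
  measurable D ->
  (forall A C, S1 A -> S2 C -> P (A `&` C `&` D) = (P (A `&` C) * P D)%E) ->
  forall E,
    <<s S1 `|` S2 `|` [set N | measurable N /\ P N = 0%E] >> E ->
    P (E `&` D) = (P E * P D)%E.
Proof.
move=> I1 T1 m1 O1 I2 T2 m2 mD ACD.
pose G := [set E | measurable E /\ exists A C N,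
  [/\ S1 A, S2 C, measurable N, P N = 0%E & E `\` N = (A `&` C) `\` N]].
have subG : S1 `|` S2 `|` [set N | measurable N /\ P N = 0%E] `<=` G.
  move=> E [[S1E|S2E]|[mE E0]].
  - by split; [exact: m1|exists E, setT, set0; split => //; rewrite setIT].
  - by split; [exact: m2|exists setT, E, set0; split => //; rewrite setTI].
  - split => //; exists set0, setT, E; split => //.
    by rewrite set0I set0D setDv.
move=> E sE; apply: (@indep_gen G) => //.
- move=> E1 E2 [mE1 [A1 [C1 [N1 [SA1 SC1 mN1 N10 e1]]]]].
  move=> [mE2 [A2 [C2 [N2 [SA2 SC2 mN2 N20 e2]]]]].
  split; first exact: measurableI.
  exists (A1 `&` A2), (C1 `&` C2), (N1 `|` N2); split.
  + exact: I1.
  + exact: I2.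
  + exact: measurableU.
  + by rewrite measureU0.
  + apply/seteqP; split => x [] h1 h2.
      have n1 : ~ N1 x by move=> ?; apply: h2; left.
      have n2 : ~ N2 x by move=> ?; apply: h2; right.
      have [[? ?] _] : (A1 `&` C1 `\` N1) x by rewrite -e1; case: h1.
      have [[? ?] _] : (A2 `&` C2 `\` N2) x by rewrite -e2; case: h1.
      by [].
    have n1 : ~ N1 x by move=> ?; apply: h2; left.
    have n2 : ~ N2 x by move=> ?; apply: h2; right.
    case: h1 => -[? ?] [? ?].
    have [? _] : (E1 `\` N1) x by rewrite e1.
    have [? _] : (E2 `\` N2) x by rewrite e2.
    by [].
- by split => //; exists setT, setT, set0; split => //; rewrite setIT.
- by move=> F [].
- move=> F [mF [A [C [N [SA SC mN N0 e]]]]].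
  have mAC : measurable (A `&` C) by apply: measurableI; [exact: m1|exact: m2].
  rewrite (eq_prob_mod mF mAC mN N0 e) -ACD//.
  apply: (eq_prob_mod (measurableI _ _ mF mD) (measurableI _ _ mAC mD) mN N0).
  by rewrite (setIC F) (setIC (A `&` C)) -setIDA e setIDA.
- exact: (sub_smallest2r (smallest_sigma_algebra _ _) subG) sE.
Qed.

Lemma indep_join_sigma (X1 X2 : set (set Om)) D :
  <<s X1 >> `<=` measurable -> <<s X2 >> `<=` measurable -> measurable D ->
  (forall A C, <<s X1 >> A -> <<s X2 >> C ->
     P (A `&` C `&` D) = (P (A `&` C) * P D)%E) ->
  forall E,
    <<s <<s X1 >> `|` <<s X2 >> `|` [set N | measurable N /\ P N = 0%E] >> E ->
    P (E `&` D) = (P E * P D)%E.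
Proof.
move=> m1 m2 mD ACD E; apply: indep_join => //.
- by move=> A1 A2 h1 h2; exact: (@measurableI _ (g_sigma_algebraType X1)).
- exact: (@measurableT _ (g_sigma_algebraType X1)).
- exact: (@measurable0 _ (g_sigma_algebraType X1)).
- by move=> A1 A2 h1 h2; exact: (@measurableI _ (g_sigma_algebraType X2)).
- exact: (@measurableT _ (g_sigma_algebraType X2)).
Qed.

Lemma indep_disjoint I (F : I -> set Om) D : (forall i, measurable (F i)) ->
  (forall i j, F i = F j \/ F i `&` F j = set0) -> measurable D ->
  (forall i, P (F i `&` D) = (P (F i) * P D)%E) ->
  forall A, <<s [set E | E = setT \/ E = set0 \/ exists i, E = F i] >> A ->
    P (A `&` D) = (P A * P D)%E.
Proof.
move=> mF dF mD FD A; apply: indep_gen => //.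
- move=> E1 E2 [->|[->|[i ->]]]; first by rewrite setTI.
    by rewrite set0I; right; left.
  move=> [->|[->|[j ->]]]; first by rewrite setIT; right; right; exists i.
    by rewrite setI0; right; left.
  have [->|->] := dF i j; last by right; left.
  by rewrite setIid; right; right; exists j.
- by left.
- by move=> _ [->//|[->//|[i ->]]].
- move=> _ [->|[->|[i ->]]] //; last by rewrite set0I measure0 mul0e.
  by rewrite setTI probability_setT mul1e.
Qed.

(** The joint law of a variable generating G and of Delta is the product of their
   laws, so that Delta can be integrated out first. The identity map onto Om
   equipped with <<s G>> is such a variable. *)
Section decoupling.
Variables (G : set (set Om)) (Delta : Om -> R).
Hypotheses (mG : <<s G >> `<=` measurable) (mDelta : measurable_fun setT Delta).
Hypothesis indep : forall A (V : set (measurableTypeR R)), <<s G >> A ->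
  measurable V -> P (A `&` Delta @^-1` V) = (P A * P (Delta @^-1` V))%E.
Let OmG := g_sigma_algebraType G.

Let idG : Om -> OmG := idfun.
Let midG : measurable_fun setT idG.
Proof. by move=> _ A mA; rewrite setTI; exact: mG. Qed.
HB.instance Definition _ := isMeasurableFun.Build _ _ _ _ idG midG.
Let Delta' : Om -> measurableTypeR R := Delta.
Let mDelta' : measurable_fun setT Delta'. Proof. exact: mDelta. Qed.
HB.instance Definition _ := isMeasurableFun.Build _ _ _ _ Delta' mDelta'.
Let pr : Om -> OmG * measurableTypeR R := fun w => (idG w, Delta' w).
Let mpr : measurable_fun setT pr.
Proof. exact: measurable_fun_pair. Qed.
HB.instance Definition _ := isMeasurableFun.Build _ _ _ _ pr mpr.

Let joint (X : set (OmG * measurableTypeR R)) : measurable X ->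
  (distribution P idG \x distribution P Delta')%E X = distribution P pr X.
Proof.
apply: product_measure_unique => A B mA mB.
by rewrite /distribution /pushforward -indep.
Qed.

Lemma decouple (Psi : OmG * measurableTypeR R -> R) :
  measurable_fun setT Psi ->
  (\int[P]_w \int[P]_w' `|Psi (w, Delta w')|%:E < +oo)%E ->
  P.-integrable setT (EFin \o (fun w => Psi (w, Delta w))) /\
  \int[P]_w Psi (w, Delta w) = \int[P]_w \int[P]_w' Psi (w, Delta w').
Proof.
move=> mPsi Psioo.
have mPsi1 x : measurable_fun setT (fun y => Psi (x, y)).
  exact: measurableT_comp.
have inn (x : OmG) : (\int[distribution P Delta']_y `|Psi (x, y)|%:E =
    \int[P]_w' `|Psi (x, Delta w')|%:E)%E.
  rewrite ge0_integral_distribution//.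
  by apply/measurable_EFinP; exact: measurableT_comp.
have iPsi : (distribution P idG \x distribution P Delta')%E.-integrable setT
    (EFin \o Psi).
  apply/integrable12ltyP; first exact/measurable_EFinP.
  rewrite ge0_integral_distribution//; last 2 first.
  - apply: (measurable_fun_fubini_tonelli_F (fun z => `|Psi z|%:E)) => //.
    by apply/measurable_EFinP; exact: measurableT_comp.
  - by move=> x; exact: integral_ge0.
  by under eq_integral do rewrite /= inn.
have iPsi' : P.-integrable setT (EFin \o (fun w => Psi (w, Delta w))).
  apply/integrableP; split.
    by apply/measurable_EFinP; exact: (measurableT_comp mPsi mpr).
  rewrite /= -(@ge0_integral_distribution _ _ _ _ _ P pr (fun z => `|Psi z|%:E))//.
    rewrite (eq_measure_integral (distribution P idG \x distribution P Delta')%E).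
      by move/integrableP : iPsi => [].
    by move=> A mA _; exact/esym/joint.
  by apply/measurable_EFinP; exact: measurableT_comp.
split => //.
transitivity (\int[(distribution P idG \x distribution P Delta')%E]_z Psi z).
  rewrite /Rintegral; congr fine.
  rewrite (eq_measure_integral (distribution P pr)).
    by rewrite integral_distribution//; exact/measurable_EFinP.
  by move=> A mA _; exact: joint.
have iF := integrable_fubini_F iPsi.
rewrite /Rintegral -(integral12_prod_meas1 iPsi); congr fine.
rewrite -(integral_fine iF) integral_distr; last first.
  exact: measurable_int (fine_integrable iF).
apply: eq_integral => w _ /=; congr (fine _)%:E; rewrite /fubini_F.
by rewrite integral_distr//; exact/measurable_EFinP.
Qed.

Lemma decouple_dominated (Psi : OmG * measurableTypeR R -> R) (g : Om -> R) :
  measurable_fun setT Psi -> P.-integrable setT (EFin \o g) ->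
  (forall w w', `|Psi (w, Delta w')| <= g w') ->
  P.-integrable setT (EFin \o (fun w => Psi (w, Delta w))) /\
  \int[P]_w Psi (w, Delta w) = \int[P]_w \int[P]_w' Psi (w, Delta w').
Proof.
move=> mPsi ig Psig; apply: decouple => //.
have mPsi1 x : measurable_fun setT (fun y => Psi (x, y)).
  exact: measurableT_comp.
have minn : measurable_fun setT (fun x : OmG => \int[P]_w' `|Psi (x, Delta w')|%:E)%E.
  rewrite (_ : (fun _ => _) =
      (fun x => \int[distribution P Delta']_y `|Psi (x, y)|%:E)%E).
    apply: (measurable_fun_fubini_tonelli_F (fun z => `|Psi z|%:E)) => //.
    by apply/measurable_EFinP; exact: measurableT_comp.
  apply/funext => x; rewrite ge0_integral_distribution//.
  by apply/measurable_EFinP; exact: measurableT_comp.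
apply: (@le_lt_trans _ _ (\int[P]_w \int[P]_w' (g w')%:E)%E); last first.
  have -> : (\int[P]__ \int[P]_w' (g w')%:E = (\int[P]_w' (g w')%:E) * P setT)%E.
    by rewrite -[RHS]integral_cst.
  by rewrite probability_setT mule1; exact: integrable_lty.
apply: ge0_le_integral => //.
- by move=> w _; exact: integral_ge0.
- exact: (measurableT_comp minn midG).
- move=> w _; apply: ge0_le_integral => //.
  + apply/measurable_EFinP; apply: measurableT_comp => //.
    exact: (measurableT_comp (mPsi1 w) mDelta').
  + exact: measurable_int ig.
  + by move=> w' _; rewrite lee_fin.
Qed.

Lemma integrable_indepM (U : OmG -> R) (v : R -> R) :
  measurable_fun setT U -> P.-integrable setT (EFin \o U) ->
  measurable_fun setT (v : measurableTypeR R -> R) ->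
  P.-integrable setT (EFin \o (v \o Delta)) ->
  P.-integrable setT (EFin \o (fun w => U w * v (Delta w))) /\
  \int[P]_w (U w * v (Delta w)) = \int[P]_w U w * \int[P]_w v (Delta w).
Proof.
move=> mU iU mv iv; have /integrableP[mvD vD] := iv.
have [||-> ->] := @decouple (fun z => U z.1 * v z.2).
- by apply: measurable_funM; exact: measurableT_comp.
- have /integrableP[mU' U'] := iU.
  rewrite (eq_integral (fun w : Om => `|U w|%:E * \int[P]_w' `|v (Delta w')|%:E)%E).
    rewrite ge0_integralZr//.
    + by rewrite lte_mul_pinfty// ?integral_ge0// ge0_fin_numE ?integral_ge0.
    + by apply/measurable_EFinP/measurableT_comp => //; exact/measurable_EFinP.
    + by apply: integral_ge0.
  move=> w _; rewrite -ge0_integralZl//; last first.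
    by apply/measurable_EFinP/measurableT_comp => //; exact/measurable_EFinP.
  by apply: eq_integral => w' _; rewrite normrM EFinM.
- split => //; rewrite /=.
  under eq_Rintegral do rewrite RintegralZl//.
  by rewrite RintegralZr.
Qed.

End decoupling.
End independence.

(** * Gaussian integration by parts *)

Section gaussian.
Context {R : realType}.
Variable s : R.
Hypothesis s0 : 0 < s.
Local Notation mu := (@lebesgue_measure R).
Local Notation p := (normal_pdf 0 s).

Let sn0 : s != 0. Proof. by rewrite gt_eqF. Qed.

Let pE x : p x = normal_peak s * expR (- x ^+ 2 / (s ^+ 2 *+ 2)).
Proof. by rewrite normal_pdfE// /normal_fun subr0. Qed.

Lemma is_derive_normal_pdf (x : R) : is_derive x 1 p (- (x / s ^+ 2) * p x).
Proof.
have -> : p = normal_peak s \*: (expR \o ((- (s ^+ 2 *+ 2)^-1) \*: (id ^+ 2))).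
  apply/funext => y; rewrite pE /= /GRing.scale/= fctE; congr (_ * expR _).
  by rewrite mulrC mulrN mulNr.
have dg : is_derive x 1 ((- (s ^+ 2 *+ 2)^-1) \*: (id ^+ 2 : R -> R)) (- (x / s ^+ 2)).
  apply: is_derive_eq; rewrite /GRing.scale/= mulr1 expr1.
  by field.
have de := @is_derive1_comp R expR _ x _ _ (is_derive_expR _) dg.
have := is_deriveZ (normal_peak s) de.
by move/is_derive_eq; apply; rewrite /= /GRing.scale/=; ring.
Qed.

(** With z = x^2 / (8 s^2), the ratio of the densities of standard deviations s and
   2 s is proportional to exp (- 3 z), and z <= exp (3 z). *)
Lemma normal_moment2_le (x : R) : x ^+ 2 * p x <=
  8 * s ^+ 2 * (normal_peak s / normal_peak (s * 2)) * normal_pdf 0 (s * 2) x.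
Proof.
have s20 : s * 2 != 0 by rewrite mulf_neq0.
have q0 : normal_peak (s * 2) != 0 by rewrite gt_eqF// normal_peak_gt0.
rewrite pE normal_pdfE// /normal_fun subr0.
set e1 := expR _; set e2 := expR _.
have -> : 8 * s ^+ 2 * (normal_peak s / normal_peak (s * 2)) * (normal_peak
  (s * 2) * e2) =
   normal_peak s * (8 * s ^+ 2 * e2) by field.
rewrite mulrCA ler_wpM2l ?normal_peak_ge0//.
have e12 : e1 = e2 * expR (- (3 * (x ^+ 2 / (8 * s ^+ 2)))).
  by rewrite /e1 /e2 -expRD; congr expR; field.
rewrite e12 mulrCA [leRHS]mulrC ler_wpM2l ?expR_ge0//.
set z := x ^+ 2 / (8 * s ^+ 2).
have z0 : 0 <= z by rewrite divr_ge0 ?sqr_ge0// mulr_ge0// sqr_ge0.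
rewrite -ler_pdivlMr ?expR_gt0// -expRN opprK.
have -> : x ^+ 2 = 8 * s ^+ 2 * z by rewrite /z; field.
rewrite ler_wpM2l ?mulr_ge0 ?(ltW s0)//.
by apply: le_trans (expR_ge1Dx _); lra.
Qed.

Lemma integral_normal_prob_ge0 (f : R -> R) : measurable_fun setT f ->
  (forall x, 0 <= f x) ->
  (\int[normal_prob 0 s]_x (f x)%:E = \int[mu]_x (f x * p x)%:E)%E.
Proof.
move=> mf f0.
have dom := normal_prob_dominates (0 : R) s.
rewrite -(Radon_Nikodym_SigmaFinite.change_of_variables dom)//; last first.
  by apply/measurable_EFinP.
have mp : measurable_fun setT (fun x => (p x)%:E).
  by apply/measurable_EFinP; exact: measurable_normal_pdf.
have iRN := Radon_Nikodym_SigmaFinite.f_integrable dom.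
have RNp : ae_eq mu setT (Radon_Nikodym_SigmaFinite.f (normal_prob 0 s) mu)
    (fun x => (p x)%:E).
  apply: integral_ae_eq => // E _ mE.
  by rewrite -Radon_Nikodym_SigmaFinite.f_integral.
apply: ae_eq_integral => //.
- apply: emeasurable_funM; first exact/measurable_EFinP.
  exact: measurable_int iRN.
- by apply/measurable_EFinP; apply: measurable_funM => //; exact: measurable_normal_pdf.
- by apply: filterS RNp => x /(_ I) -> _; rewrite EFinM.
Qed.

Lemma integrable_normal_prob (f : R -> R) : measurable_fun setT f ->
  mu.-integrable setT (EFin \o (fun x => f x * p x)) ->
  (normal_prob 0 s).-integrable setT (EFin \o f) /\
  \int[normal_prob 0 s]_x f x = \int[mu]_x (f x * p x).
Proof.
move=> mf fi; have mp : measurable_fun setT p by exact: measurable_normal_pdf.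
have p0 x : 0 <= p x by exact: normal_pdf_ge0.
split.
  apply/integrableP; split; first exact/measurable_EFinP.
  rewrite /= integral_normal_prob_ge0//; last exact: measurableT_comp.
  case/integrableP : fi => _.
  by under eq_integral do rewrite /= normrM (ger0_norm (p0 _)).
rewrite /Rintegral integralE [in RHS]integralE; congr (fine (_ - _)).
- transitivity (\int[normal_prob 0 s]_x (Num.max (f x) 0)%:E)%E.
    by apply: eq_integral => x _; rewrite funeposE /= EFin_max.
  rewrite integral_normal_prob_ge0.
  + apply: eq_integral => x _; rewrite funeposE /= -EFin_max.
    by rewrite maxr_pMl// mul0r.
  + exact: measurable_maxr.
  + by move=> x; rewrite le_max lexx orbT.
- transitivity (\int[normal_prob 0 s]_x (Num.max (- f x) 0)%:E)%E.
    by apply: eq_integral => x _; rewrite funenegE /= EFin_max.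
  rewrite integral_normal_prob_ge0.
  + apply: eq_integral => x _; rewrite funenegE /= -EFin_max.
    by rewrite maxr_pMl// mul0r mulNr.
  + by apply: measurable_maxr => //; exact: measurableT_comp.
  + by move=> x; rewrite le_max lexx orbT.
Qed.

Lemma integrable_normal_moment2 :
  mu.-integrable setT (EFin \o (fun x => x ^+ 2 * p x)).
Proof.
have mp : measurable_fun setT p by exact: measurable_normal_pdf.
set K := 8 * s ^+ 2 * (normal_peak s / normal_peak (s * 2)).
apply: (@integrable_le _ _ _ mu _ (fun x => K * normal_pdf 0 (s * 2) x)).
- by apply: measurable_funM => //; exact: measurable_funX.
- by apply: integrableRZ; exact: integrable_normal_pdf.
- move=> x; rewrite ger0_norm ?normal_moment2_le//.
  by rewrite mulr_ge0 ?sqr_ge0// normal_pdf_ge0.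
Qed.

Lemma integrable_normal_affine (f : R -> R) (C : R) : measurable_fun setT f ->
  (forall x, `|f x| <= C * (1 + x ^+ 2)) ->
  mu.-integrable setT (EFin \o (fun x => f x * p x)).
Proof.
move=> mf fC; have mp : measurable_fun setT p by exact: measurable_normal_pdf.
apply: (@integrable_le _ _ _ mu _ (fun x => C * (p x + x ^+ 2 * p x))).
- exact: measurable_funM.
- apply: integrableRZ; apply: integrableRD; first exact: integrable_normal_pdf.
  exact: integrable_normal_moment2.
- move=> x; rewrite normrM (ger0_norm (normal_pdf_ge0 _ _ _)).
  have -> : C * (p x + x ^+ 2 * p x) = C * (1 + x ^+ 2) * p x by ring.
  by rewrite ler_wpM2r// normal_pdf_ge0.
Qed.

Lemma itv_cvg (f : R -> R) : mu.-integrable setT (EFin \o f) ->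
  (\int[mu]_(x in `[- n.+1%:R, n.+1%:R]) f x) @[n --> \oo] --> \int[mu]_x f x.
Proof.
move=> fi; have mf := measurable_int _ fi.
pose D n : set R := `[- n.+1%:R, n.+1%:R]%classic.
have [|||||_ _] := @dominated_convergence _ _ _ mu setT measurableT
  (fun n => EFin \o (f \_ (D n))) (EFin \o f) (fun x => `|f x|%:E).
- move=> n; apply/measurable_EFinP/measurable_restrict => //.
    exact: measurable_itv.
  by apply: measurable_funTS; exact/measurable_EFinP.
- exact: mf.
- apply: aeW => x _ /=; apply: cvg_near_cst.
  near=> n; rewrite patchE ifT// inE /D /= in_itv/= -ler_norml.
  near: n; apply: filterS (nbhs_infty_ger `|x|) => n /le_trans; apply.
  by rewrite ler_nat.
- exact: integrable_norm.
- apply: aeW => x n _ /=; rewrite lee_fin patchE; case: ifPn => // _.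
  by rewrite normr0.
move=> h; apply: fine_cvg; rewrite fineK; last exact: integrable_fin_num.
move: h; apply: cvg_trans; apply: near_eq_cvg; apply: nearW => n.
by rewrite [RHS]integral_mkcond; apply: eq_integral => x _; rewrite restrict_EFin.
Unshelve. all: by end_near. Qed.

Lemma normal_pdf_boundary (f : R -> R) (C : R) :
  (forall x, `|f x| <= C * (1 + `|x|)) ->
  (f n.+1%:R * p n.+1%:R) @[n --> \oo] --> (0 : R) /\
  (f (- n.+1%:R) * p (- n.+1%:R)) @[n --> \oo] --> (0 : R).
Proof.
move=> fC.
have C0 : 0 <= C.
  by have := le_trans (normr_ge0 _) (fC 0); rewrite normr0 addr0 mulr1.
set K := 8 * s ^+ 2 * (normal_peak s / normal_peak (s * 2)) * normal_peak (s * 2).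
pose M := C * 2 * K.
have bnd (x : R) (n : nat) : `|x| = n.+1%:R -> `|f x * p x| <= M * n.+1%:R^-1.
  move=> xn; have x1 : 1 <= `|x| by rewrite xn ler1n.
  have x0 : 0 < `|x| by lra.
  rewrite -xn ler_pdivlMr// normrM (ger0_norm (normal_pdf_ge0 _ _ _)).
  apply: (@le_trans _ _ (C * (1 + `|x|) * p x * `|x|)).
    by rewrite ler_wpM2r// ler_wpM2r// normal_pdf_ge0.
  apply: (@le_trans _ _ (C * 2 * (`|x| ^+ 2 * p x))).
    have -> : C * (1 + `|x|) * p x * `|x| = C * ((1 + `|x|) * `|x|) * p x by ring.
    rewrite [leRHS]mulrA ler_wpM2r ?normal_pdf_ge0// -[leRHS]mulrA ler_wpM2l//; nra.
  rewrite ler_wpM2l ?mulr_ge0// real_normK ?num_real//.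
  apply: (le_trans (normal_moment2_le x)); rewrite ler_wpM2l//.
    by rewrite !mulr_ge0 ?(ltW s0)// ?invr_ge0 ?normal_peak_ge0.
  by apply: normal_pdf_ub; rewrite mulf_neq0.
have M0 : M * n.+1%:R^-1 @[n --> \oo] --> (0 : R).
  rewrite -[X in _ --> X](mulr0 M); apply: cvgM; first exact: cvg_cst.
  exact: cvg_harmonic.
split.
- apply/cvgr0Pnorm_le => e e0; move/cvgr0Pnorm_le : M0 => /(_ e e0).
  apply: filterS => n; apply: le_trans; apply: le_trans (ler_norm _).
  by apply: bnd; rewrite ger0_norm.
- apply/cvgr0Pnorm_le => e e0; move/cvgr0Pnorm_le : M0 => /(_ e e0).
  apply: filterS => n; apply: le_trans; apply: le_trans (ler_norm _).
  by apply: bnd; rewrite normrN ger0_norm.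
Qed.

(** Since - s^2 p is a primitive of x p, this is an integration by parts on [- n, n];
   n goes to infinity, and the boundary terms vanish. *)
Lemma normal_ibp (psi dpsi : R -> R) (C : R) :
  (forall x : R, is_derive x 1 psi (dpsi x)) -> continuous dpsi ->
  (forall x, `|psi x| <= C * (1 + `|x|)) -> (forall x, `|dpsi x| <= C) ->
  \int[mu]_x (psi x * x * p x) = s ^+ 2 * \int[mu]_x (dpsi x * p x).
Proof.
move=> dpsiE cdpsi psiC dpsiC.
have cpsi : continuous psi.
  by move=> x; apply: differentiable_continuous; apply/derivable1_diffP; case: (dpsiE x).
have mpsi : measurable_fun setT psi by exact: continuous_measurable_fun.
have mdpsi : measurable_fun setT dpsi by exact: continuous_measurable_fun.
have C0 : 0 <= C by apply: le_trans (dpsiC 0).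
have cp : continuous p by exact: continuous_normal_pdf.
have i1 : mu.-integrable setT (EFin \o (fun x => psi x * x * p x)).
  apply: (@integrable_normal_affine (fun x => psi x * x) (2 * C)).
    by apply: measurable_funM.
  move=> x; rewrite normrM (le_trans (ler_wpM2r _ (psiC x)))//.
  rewrite -(real_normK (num_real x)) -!mulrA [leRHS]mulrCA ler_wpM2l//.
  have := normr_ge0 x; have := sqr_ge0 (`|x| - 1); nra.
have i2 : mu.-integrable setT (EFin \o (fun x => dpsi x * p x)).
  apply: (@integrable_normal_affine dpsi C) => // x.
  apply: (le_trans (dpsiC x)); have := sqr_ge0 x; nra.
have step (n : nat) : \int[mu]_(x in `[- n.+1%:R, n.+1%:R]) (psi x * x * p x) =
    - s ^+ 2 * (psi n.+1%:R * p n.+1%:R - psi (- n.+1%:R) * p (- n.+1%:R)) +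
    s ^+ 2 * \int[mu]_(x in `[- n.+1%:R, n.+1%:R]) (dpsi x * p x).
  have dG (x : R) : is_derive x 1 (fun x => - s ^+ 2 * p x) (x * p x).
    have := is_deriveZ (- s ^+ 2) (is_derive_normal_pdf x).
    by move/is_derive_eq; apply; rewrite /GRing.scale/=; field.
  under eq_Rintegral do rewrite -mulrA.
  rewrite (@Rintegration_by_parts _ psi (fun x => - s ^+ 2 * p x) dpsi
    (fun x => x * p x)).
  - under eq_Rintegral do rewrite mulrCA.
    rewrite RintegralZl//; first ring.
    exact: integrableS i2.
  - by rewrite (@lt_trans _ _ 0)// oppr_lt0.
  - exact: continuous_subspaceT.
  - split; first by move=> x _; case: (dpsiE x).
      by apply: cvg_at_right_filter; exact: cpsi.
    by apply: cvg_at_left_filter; exact: cpsi.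
  - by move=> x _; rewrite derive1E; case: (dpsiE x).
  - by apply: continuous_subspaceT => x; apply: cvgM; [exact: cvg_id|exact: cp].
  - have cG : continuous (fun x => - s ^+ 2 * p x).
      by move=> x; apply: cvgM; [exact: cvg_cst|exact: cp].
    split; first by move=> x _; case: (dG x).
      by apply: cvg_at_right_filter; exact: cG.
    by apply: cvg_at_left_filter; exact: cG.
  - by move=> x _; rewrite derive1E; case: (dG x).
have [b1 b2] := normal_pdf_boundary psiC.
apply: (cvgn_unique (itv_cvg i1)).
under eq_fun do rewrite step.
have -> : s ^+ 2 * \int[mu]_x (dpsi x * p x) =
    - s ^+ 2 * (0 - 0) + s ^+ 2 * \int[mu]_x (dpsi x * p x) by ring.
apply: cvgD; first by apply: cvgM; [exact: cvg_cst|exact: cvgB].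
by apply: cvgM; [exact: cvg_cst|exact: itv_cvg].
Qed.

End gaussian.

(** * The filtration and the increments of the Brownian motion *)

Lemma wrtP {R : realType} d (Om : measurableType d) (X : set (set Om)) (F : Om -> R) :
  wrt <<s X >> F <-> measurable_fun setT (F : g_sigma_algebraType X -> R).
Proof.
split=> [wF _ V mV|mF V mV]; first by rewrite setTI; exact: wF.
by rewrite -[_ @^-1` _]setTI; exact: mF.
Qed.

Section driving_noise_theory.
Context {R : realType} d (Om : measurableType d) (S : noise R Om).
Hypothesis HS : driving_noise S.
Local Notation T := (hor S).
Local Notation P := (prob S).
Local Notation B := (bm S).
Implicit Types (s t u v : R) (A C D E : set Om).

Let null : set (set Om) := [set A | measurable A /\ P A = 0%E].

Lemma T_gt0 : 0 < T. Proof. by case: HS. Qed.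

Lemma measurable_bm t : 0 <= t <= T -> measurable_fun setT (B t).
Proof. by case: HS => _ [+ _ _ _] _ _ _; exact. Qed.

Lemma sigma_bm_measurable t : t <= T -> sigma_bm S t `<=` measurable.
Proof.
move=> tT; apply: smallest_sub; first exact: sigma_algebra_measurable.
move=> _ [s [V [/andP[s0 st] mV ->]]]; rewrite -[_ @^-1` _]setTI.
by apply: measurable_bm => //; rewrite s0 (le_trans st).
Qed.

Lemma sigma_prm_measurable t : t <= T -> sigma_prm S t `<=` measurable.
Proof.
move=> tT; apply: smallest_sub; first exact: sigma_algebra_measurable.
move=> _ [C [V [mC Ct mV ->]]]; rewrite -[_ @^-1` _]setTI.
case: HS => _ _ _ [mN _ _] _; apply: mN => // z /Ct [/= + _].
by rewrite !in_itv/= => /andP[-> /le_trans ->].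
Qed.

Lemma sub_sigma (X Y : set (set Om)) : X `<=` <<s Y >> -> <<s X >> `<=` <<s Y >>.
Proof. by move=> XY; apply: smallest_sub => //; exact: smallest_sigma_algebra. Qed.

Lemma sigma_bm_le s t : s <= t -> sigma_bm S s `<=` sigma_bm S t.
Proof.
move=> st; apply: sub_sigma => _ [r [V [/andP[r0 rs] mV ->]]].
by apply: sub_sigma_algebra; exists r, V; rewrite r0 (le_trans rs).
Qed.

Lemma sigma_prm_le s t : s <= t -> sigma_prm S s `<=` sigma_prm S t.
Proof.
move=> st; apply: sub_sigma => _ [C [V [mC Cs mV ->]]].
apply: sub_sigma_algebra; exists C, V; split => // z /Cs [/= + _].
by rewrite !in_itv/= => /andP[-> /le_trans ->].
Qed.

Lemma filt_le s t : s <= t -> filt S s `<=` filt S t.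
Proof.
move=> st; apply: sub_sigma => A [[|]|] h; apply: sub_sigma_algebra.
- by left; left; exact: sigma_bm_le h.
- by left; right; exact: sigma_prm_le h.
- by right.
Qed.

Lemma filt_measurable t : t <= T -> filt S t `<=` measurable.
Proof.
move=> tT; apply: smallest_sub; first exact: sigma_algebra_measurable.
move=> A [[|]|[//]]; first exact: sigma_bm_measurable.
exact: sigma_prm_measurable.
Qed.

(** The past of B up to u, enlarged by all the jumps: it remains independent of the
   increments of B after u. *)
Definition enl (u : R) : set (set Om) := sigma_bm S u `|` sigma_prm S T `|` null.

Lemma enl_measurable u : u <= T -> <<s enl u >> `<=` measurable.
Proof.
move=> uT; apply: smallest_sub; first exact: sigma_algebra_measurable.
by move=> A [[|]|[//]]; [exact: sigma_bm_measurable|exact: sigma_prm_measurable].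
Qed.

Lemma enl_le s t : s <= t -> <<s enl s >> `<=` <<s enl t >>.
Proof.
move=> st; apply: sub_sigma => A [[h|h]|h]; apply: sub_sigma_algebra.
- by left; left; exact: sigma_bm_le h.
- by left; right.
- by right.
Qed.

Lemma filt_enl u : u <= T -> filt S u `<=` <<s enl u >>.
Proof.
move=> uT; apply: sub_sigma => A [[h|h]|h]; apply: sub_sigma_algebra.
- by left; left.
- by left; right; exact: sigma_prm_le h.
- by right.
Qed.

Definition inc s t (w : Om) : R := B t w - B s w.

Lemma sigma_bm_inc s t (V : set (measurableTypeR R)) : 0 <= s -> s <= t ->
  measurable V -> sigma_bm S t (inc s t @^-1` V).
Proof.
move=> s0 st mV.
set X := [set A | exists (s : R) (V : set (measurableTypeR R)),
        [/\ 0 <= s <= t, measurable V & A = B s @^-1` V] ].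
have mB r : 0 <= r <= t -> measurable_fun setT (B r : g_sigma_algebraType X -> R).
  by move=> rt; apply/wrtP => W mW; apply: sub_sigma_algebra; exists r, W.
suff : wrt <<s X >> (inc s t) by exact.
apply/wrtP; apply: measurable_funB; apply: mB; rewrite ?s0 ?st ?lexx//.
by rewrite (le_trans s0 st).
Qed.

Lemma measurable_inc s t : 0 <= s -> s <= t -> t <= T ->
  measurable_fun setT (inc s t).
Proof.
move=> s0 st tT; apply: measurable_funB; apply: measurable_bm.
  by rewrite tT (le_trans s0).
by rewrite s0 (le_trans st).
Qed.

Lemma inc_self_preimage s (V : set R) :
  inc s s @^-1` V = setT \/ inc s s @^-1` V = set0.
Proof.
have [V0|V0] := pselect (V 0); [left|right]; apply/seteqP; split => // w.
  by rewrite /inc /= subrr.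
by rewrite /inc /= subrr.
Qed.

Lemma indep_inc s t A (V : set (measurableTypeR R)) : 0 <= s -> s <= t ->
  t <= T -> <<s enl s >> A -> measurable V ->
  P (A `&` inc s t @^-1` V) = (P A * P (inc s t @^-1` V))%E.
Proof.
move=> s0; rewrite le_eqVlt => /predU1P[<- sT _ mV|st tT sA mV].
  case: (inc_self_preimage s V) => ->.
    by rewrite setIT probability_setT mule1.
  by rewrite setI0 measure0 mule0.
case: HS => _ [_ _ _ indB] _ _ indBN.
have sT : s <= T by rewrite (le_trans (ltW st)).
have mD : measurable (inc s t @^-1` V).
  by rewrite -[_ @^-1` _]setTI; apply: measurable_inc => //; exact: ltW.
apply: (indep_join_sigma (sigma_bm_measurable sT) (sigma_prm_measurable (lexx T))
  mD _ sA).
move=> A1 C hA hC; rewrite setIAC indBN//; last first.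
  apply: (@measurableI _ (g_sigma_algebraType _)).
    exact: (sigma_bm_le sT).
  by apply: (sigma_bm_le tT); exact: sigma_bm_inc s0 (ltW st) mV.
rewrite (indB s t)//; last by exists V.
by rewrite indBN//; [rewrite muleAC|exact: (sigma_bm_le sT)].
Qed.

(** The pi-system of the increments of B between the successive times of b :: l, for
   which independence is obtained by induction on l. *)
Fixpoint fut (b : R) (l : seq R) : set (set Om) :=
  if l is t :: l' then
    [set A | exists (V : set (measurableTypeR R)) E,
       [/\ measurable V, fut t l' E & A = inc b t @^-1` V `&` E]]
  else [set setT].

Lemma fut_setT b l : fut b l setT.
Proof.
elim: l b => [//|t l IH] b /=; exists setT, setT; split => //.
by rewrite setIT preimage_setT.
Qed.

Lemma fut_setI b l : setI_closed (fut b l).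
Proof.
elim: l b => [|t l IH] b A A' /=; first by move=> -> ->; rewrite setIT.
move=> [V [E [mV fE ->]]] [V' [E' [mV' fE' ->]]].
exists (V `&` V'), (E `&` E'); split.
- exact: measurableI.
- exact: IH.
- by rewrite preimage_setI setIACA.
Qed.

Lemma path_last_le (b : R) (l : seq R) : path <=%R b l -> b <= last b l.
Proof.
elim: l b => [//|t l IH] b /= /andP[bt tl].
exact: le_trans bt (IH _ tl).
Qed.

Lemma fut_measurable b l : 0 <= b -> path <=%R b l -> last b l <= T ->
  fut b l `<=` measurable.
Proof.
elim: l b => [|t l IH] b b0 /=; first by move=> _ _ _ ->.
move=> /andP[bt tl] lT A [V [E [mV fE ->]]].
have t0 : 0 <= t by rewrite (le_trans b0).
have tT : t <= T.
  exact: le_trans (path_last_le tl) lT.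
apply: measurableI; last exact: IH fE.
by rewrite -[_ @^-1` _]setTI; exact: measurable_inc.
Qed.

Lemma indep_fut b l A E : 0 <= b -> path <=%R b l -> last b l <= T ->
  <<s enl b >> A -> fut b l E -> P (A `&` E) = (P A * P E)%E.
Proof.
elim: l b A E => [|t l IH] b A E b0 /=.
  by move=> _ _ _ ->; rewrite setIT probability_setT mule1.
move=> /andP[bt tl] lT hA [V [E' [mV fE ->]]].
have t0 : 0 <= t by rewrite (le_trans b0).
have tT : t <= T by exact: le_trans (path_last_le tl) lT.
have hV : <<s enl t >> (inc b t @^-1` V).
  by apply: sub_sigma_algebra; left; left; exact: sigma_bm_inc.
rewrite setIA (IH t)//; last first.
  apply: (@measurableI _ (g_sigma_algebraType _)) => //.
  exact: (enl_le bt).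
by rewrite indep_inc// (IH t)// muleA.
Qed.

(** What an increment of B over ]a, b] is independent of: the enlarged past of a, and
   the increments over the intervals that follow b. *)
Definition away (a b : R) (l : seq R) : set (set Om) :=
  <<s enl a >> `|` fut b l `|` null.

Lemma away_measurable a b l : a <= T -> 0 <= b -> path <=%R b l ->
  last b l <= T -> <<s away a b l >> `<=` measurable.
Proof.
move=> aT b0 bl lT; apply: smallest_sub; first exact: sigma_algebra_measurable.
move=> A [[|]|[//]]; first exact: enl_measurable.
exact: fut_measurable.
Qed.

Lemma indep_away a b l A (V : set (measurableTypeR R)) : 0 <= a -> a <= b ->
  path <=%R b l -> last b l <= T ->
  <<s away a b l >> A -> measurable V ->
  P (A `&` inc a b @^-1` V) = (P A * P (inc a b @^-1` V))%E.
Proof.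
move=> a0 ab bl lT hA mV.
have b0 : 0 <= b by rewrite (le_trans a0).
have bT : b <= T by exact: le_trans (path_last_le bl) lT.
have aT : a <= T by exact: le_trans bT.
have hV : <<s enl b >> (inc a b @^-1` V).
  by apply: sub_sigma_algebra; left; left; exact: sigma_bm_inc.
apply: (indep_join _ _ _ _ _ _ _ _ _ hA).
- by move=> A1 A2 h1 h2; exact: (@measurableI _ (g_sigma_algebraType _)).
- exact: (@measurableT _ (g_sigma_algebraType _)).
- exact: enl_measurable.
- exact: (@measurable0 _ (g_sigma_algebraType _)).
- exact: fut_setI.
- exact: fut_setT.
- exact: fut_measurable.
- by rewrite -[_ @^-1` _]setTI; exact: measurable_inc.
move=> A1 C hA1 hC; rewrite setIAC (@indep_fut b l)//; last first.
  apply: (@measurableI _ (g_sigma_algebraType _)) => //.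
  exact: (enl_le ab).
rewrite indep_inc// (@indep_fut b l)//; last exact: (enl_le ab).
by rewrite muleAC.
Qed.

Lemma away_bm a b l t : 0 <= a -> a <= b -> path <=%R b l -> last b l <= T ->
  t \in b :: l -> wrt <<s away a b l >> (inc b t).
Proof.
move=> a0 ab bl lT tl.
suff : wrt <<s fut b l >> (inc b t).
  move=> h V mV; apply: (@sub_sigma (fut b l)) (h V mV).
  by move=> E fE; apply: sub_sigma_algebra; left; right.
have {a0 ab bl lT} : t \in b :: l by [].
elim: l b tl => [|u l IH] b /=.
  rewrite inE => /eqP -> _ V mV.
  case: (inc_self_preimage b V) => ->.
    exact: (@measurableT _ (g_sigma_algebraType _)).
  exact: (@measurable0 _ (g_sigma_algebraType _)).
rewrite inE => /predU1P[-> _ V mV|tl _].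
  case: (inc_self_preimage b V) => ->.
    exact: (@measurableT _ (g_sigma_algebraType _)).
  exact: (@measurable0 _ (g_sigma_algebraType _)).
apply/wrtP.
have -> : inc b t = (inc b u \+ inc u t).
  by apply/funext => w; rewrite /inc /=; ring.
apply: measurable_funD.
- apply/wrtP => V mV; apply: sub_sigma_algebra; exists V, setT; split => //.
    exact: fut_setT.
  by rewrite setIT.
- apply/wrtP => V mV.
  apply: (@sub_sigma (fut u l)) (IH u tl tl V mV) => E fE.
  apply: sub_sigma_algebra; exists setT, E; split => //.
  by rewrite preimage_setT setTI.
Qed.

Lemma inc_expectation s t (v : R -> R) : 0 <= s -> s < t -> t <= T ->
  measurable_fun setT v ->
  (@lebesgue_measure R).-integrable setT
    (EFin \o (fun x => v x * normal_pdf 0 (Num.sqrt (t - s)) x)) ->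
  P.-integrable setT (EFin \o (v \o inc s t)) /\
  \int[P]_w v (inc s t w) =
    \int[lebesgue_measure]_x (v x * normal_pdf 0 (Num.sqrt (t - s)) x).
Proof.
move=> s0 st tT mv iv.
have sd0 : 0 < Num.sqrt (t - s) by rewrite sqrtr_gt0 subr_gt0.
have mi : measurable_fun setT (inc s t : Om -> measurableTypeR R).
  by apply: measurable_inc => //; exact: ltW.
pose X : {mfun Om >-> measurableTypeR R} :=
  HB.pack (inc s t : Om -> measurableTypeR R) (isMeasurableFun.Build _ _ _ _ _ mi).
have law (A : set (measurableTypeR R)) : measurable A -> A `<=` setT ->
    normal_prob 0 (Num.sqrt (t - s)) A = distribution P X A.
  move=> mA _; rewrite /distribution /pushforward /=.
  by case: HS => _ [_ _ h _] _ _ _; rewrite -h.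
have [ivn <-] := integrable_normal_prob mv iv.
split.
  apply/integrableP; split.
    by apply/measurable_EFinP; apply: measurableT_comp.
  rewrite /= -(@ge0_integral_distribution _ _ _ _ _ P X (fun x => `|v x|%:E))//.
    rewrite -(eq_measure_integral _ law).
    by case/integrableP : ivn.
  by apply/measurable_EFinP; exact: measurableT_comp.
rewrite /Rintegral; congr fine.
rewrite (eq_measure_integral _ law) integral_distr//.
exact/measurable_EFinP.
Qed.

Lemma inc_moments s t : 0 <= s -> s <= t -> t <= T ->
  [/\ sqint P (inc s t), \int[P]_w inc s t w = 0
    & \int[P]_w (inc s t w) ^+ 2 = t - s].
Proof.
move=> s0; rewrite le_eqVlt => /predU1P[<- sT|st tT].
  have -> : inc s s = cst 0 by apply/funext => w; rewrite /inc subrr.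
  split; first exact: sqint0.
    by rewrite Rintegral_cst// mul0r.
  by rewrite subrr /= expr0n /= Rintegral_cst// mul0r.
have sd0 : 0 < Num.sqrt (t - s) by rewrite sqrtr_gt0 subr_gt0.
have sq : Num.sqrt (t - s) ^+ 2 = t - s by rewrite sqr_sqrtr// subr_ge0 ltW.
have id1 : forall x : R, `|x| <= 1 * (1 + `|x|) by move=> x; rewrite mul1r lerDr.
have sqi (x : R) : `|x ^+ 2| <= 1 * (1 + x ^+ 2).
  by rewrite mul1r ger0_norm ?sqr_ge0// lerDr.
have aff (x : R) : `|x| <= 1 * (1 + x ^+ 2).
  have := sqr_ge0 (`|x| - 1); rewrite sqrrB real_normK ?num_real// mul1r; nra.
have [i2 e2] := inc_expectation s0 st tT (measurable_funX 2 (@measurable_id _ _ setT))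
  (integrable_normal_affine sd0 (measurable_funX 2 (@measurable_id _ _ setT)) sqi).
have [i1 e1] := inc_expectation s0 st tT (@measurable_id _ _ setT)
  (integrable_normal_affine sd0 (@measurable_id _ _ setT) aff).
split.
- by apply/sqintP; split => //; apply: measurable_inc => //; exact: ltW.
- have c0 : continuous (cst 0 : R -> R) by move=> x; exact: cvg_cst.
  have b1 (x : R) : `|(cst 1 : R -> R) x| <= 1 * (1 + `|x|) by rewrite normr1 mul1r lerDl.
  have b0 (x : R) : `|(cst 0 : R -> R) x| <= 1 by rewrite normr0.
  have d1 (x : R) : is_derive x 1 (cst 1 : R -> R) 0 by exact: is_derive_cst.
  have := normal_ibp sd0 d1 c0 b1 b0.
  move=> h; rewrite [LHS]e1.
  transitivity (Num.sqrt (t - s) ^+ 2 *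
      \int[lebesgue_measure]_x (0 * normal_pdf 0 (Num.sqrt (t - s)) x)).
    by rewrite -h; apply: eq_Rintegral => x _; rewrite /= mul1r.
  under eq_Rintegral do rewrite mul0r.
  by rewrite Rintegral_cst// mul0r mulr0.
- have c1 : continuous (cst 1 : R -> R) by move=> x; exact: cvg_cst.
  have b1 (x : R) : `|(cst 1 : R -> R) x| <= 1 by rewrite normr1.
  have d1 (x : R) : is_derive x 1 (id : R -> R) 1 by exact: is_derive_id.
  have := normal_ibp sd0 d1 c1 id1 b1.
  move=> h; rewrite [LHS]e2.
  transitivity (Num.sqrt (t - s) ^+ 2 *
      \int[lebesgue_measure]_x (1 * normal_pdf 0 (Num.sqrt (t - s)) x)).
    by rewrite -h; apply: eq_Rintegral => x _; rewrite /= expr2.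
  under eq_Rintegral do rewrite mul1r.
  by rewrite /Rintegral integral_normal_pdf mulr1.
Qed.

(** The increment is independent of its enlarged past, centred, and of variance
   t - s. *)
Lemma past_inc s t (U : Om -> R) : 0 <= s -> s <= t -> t <= T ->
  wrt <<s enl s>> U -> P.-integrable setT (EFin \o U) ->
  [/\ P.-integrable setT (EFin \o (fun w => U w * inc s t w)),
      \int[P]_w (U w * inc s t w) = 0,
      P.-integrable setT (EFin \o (fun w => U w * (inc s t w) ^+ 2))
    & \int[P]_w (U w * (inc s t w) ^+ 2) = (t - s) * \int[P]_w U w].
Proof.
move=> s0 st tT /wrtP wU iU.
have [/sqintP[mi i2] e1 e2] := inc_moments s0 st tT.
have sT : s <= T by exact: le_trans tT.
have i1 : P.-integrable setT (EFin \o inc s t).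
  apply: (@integrable_le _ _ _ P _ (fun w => 1 + (inc s t w) ^+ 2)) => //.
    apply: integrableRD => //; exact: finite_measure_integrable_cst.
  move=> w; have := sqr_ge0 (`|inc s t w| - 1).
  rewrite sqrrB real_normK ?num_real//; nra.
have ind A (V : set (measurableTypeR R)) : <<s enl s >> A -> measurable V ->
    P (A `&` inc s t @^-1` V) = (P A * P (inc s t @^-1` V))%E.
  exact: indep_inc.
have me := enl_measurable sT.
have [j1 f1] := integrable_indepM me mi ind wU iU (@measurable_id _ _ setT) i1.
have [j2 f2] := integrable_indepM me mi ind wU iU
  (measurable_funX 2 (@measurable_id _ _ setT)) i2.
split => //; first by rewrite [LHS]f1 [X in _ * X]e1 mulr0.
by rewrite [LHS]f2 [X in _ * X]e2 mulrC.
Qed.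

Lemma inc_ibp s t (psi dpsi : R -> R) (M0 M1 : R) : 0 <= s -> s < t -> t <= T ->
  (forall x : R, is_derive x 1 psi (dpsi x)) -> continuous dpsi ->
  (forall x, `|psi x| <= M0) -> (forall x, `|dpsi x| <= M1) ->
  [/\ P.-integrable setT (EFin \o (fun w => psi (inc s t w) * inc s t w)),
      P.-integrable setT (EFin \o (fun w => dpsi (inc s t w)))
    & \int[P]_w (psi (inc s t w) * inc s t w) =
      (t - s) * \int[P]_w dpsi (inc s t w)].
Proof.
move=> s0 st tT dE cd b0 b1.
have sd0 : 0 < Num.sqrt (t - s) by rewrite sqrtr_gt0 subr_gt0.
have cpsi : continuous psi.
  by move=> x; apply: differentiable_continuous; apply/derivable1_diffP; case: (dE x).
have mpsi : measurable_fun setT psi by exact: continuous_measurable_fun.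
have mdpsi : measurable_fun setT dpsi by exact: continuous_measurable_fun.
have M0_ge0 : 0 <= M0 by apply: le_trans (b0 0).
have M1_ge0 : 0 <= M1 by apply: le_trans (b1 0).
have p1 (x : R) : `|psi x * x| <= M0 * (1 + x ^+ 2).
  rewrite normrM ler_pM//.
  have := sqr_ge0 (`|x| - 1); rewrite sqrrB real_normK ?num_real//; nra.
have p2 (x : R) : `|dpsi x| <= M1 * (1 + x ^+ 2).
  by rewrite (le_trans (b1 x))// ler_peMr// lerDl sqr_ge0.
have p3 (x : R) : `|psi x| <= (M0 + M1) * (1 + `|x|).
  rewrite (le_trans (b0 x))// (@le_trans _ _ (M0 + M1)) ?lerDl//.
  by rewrite ler_peMr ?addr_ge0// lerDl.
have p4 (x : R) : `|dpsi x| <= M0 + M1 by rewrite (le_trans (b1 x))// lerDr.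
have mpx := measurable_funM mpsi (@measurable_id _ _ setT).
have [j1 F1] := inc_expectation s0 st tT mpx (integrable_normal_affine sd0 mpx p1).
have [j2 F2] := inc_expectation s0 st tT mdpsi (integrable_normal_affine sd0 mdpsi p2).
split => //.
rewrite [LHS]F1 (normal_ibp sd0 dE cd p3 p4) sqr_sqrtr ?subr_ge0 ?(ltW st)//.
by rewrite -[in LHS]F2.
Qed.

End driving_noise_theory.

Section continuous_composition.
Context {R : realType} d (T : measurableType d) (n : nat).
Variables (phi : 'rV[R]_n -> R) (A : T -> 'rV[R]_n).
Hypothesis cphi : continuous phi.
Hypothesis mA : forall j, measurable_fun setT (fun x => A x 0 j).

(** The composition is the limit of the functions obtained by rounding every
   coordinate to a multiple of 1 / k, which take countably many values. *)
Lemma measurable_continuous_comp : measurable_fun setT (phi \o A).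
Proof.
pose fl (k : nat) x : {ffun 'I_n -> int} := [ffun j => Num.floor (k.+1%:R * A x 0 j)].
pose pt (k : nat) (c : {ffun 'I_n -> int}) : 'rV[R]_n :=
  \row_j (k.+1%:R^-1 * (c j)%:~R).
have mfl k c : measurable [set x | fl k x = c].
  have -> : [set x | fl k x = c] =
      \bigcap_(j in [set: 'I_n]) [set x | Num.floor (k.+1%:R * A x 0 j) = c j].
    apply/seteqP; split => x /=; first by move=> <- j _; rewrite ffunE.
    by move=> h; apply/ffunP => j; rewrite ffunE h.
  apply: fin_bigcap_measurable => // j _.
  have -> : [set x | Num.floor (k.+1%:R * A x 0 j) = c j] =
     (fun x => k.+1%:R * A x 0 j) @^-1` `[(c j)%:~R, (c j + 1)%:~R[.
    apply/seteqP; split => x /=; rewrite in_itv/=.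
      by move=> <-; exact: floor_itv.
    by move=> /floor_def.
  rewrite -[_ @^-1` _]setTI; apply: measurable_funM => //.
apply: (@measurable_fun_cvg _ _ _ _ (fun k x => phi (pt k (fl k x)))) => //.
- move=> k _ V mV; rewrite setTI.
  have -> : (fun x => phi (pt k (fl k x))) @^-1` V =
      \bigcup_i (if unpickle i is Some c then
          [set x | fl k x = c /\ V (phi (pt k c))] else set0).
    apply/seteqP; split => x /=.
      by move=> h; exists (pickle (fl k x)) => //; rewrite pickleK.
    by move=> [i _]; case: unpickle => // c [<-].
  apply: bigcup_measurable => i _; case: unpickle => // c.
  have [Vc|nVc] := pselect (V (phi (pt k c))).
    by rewrite (_ : [set x | _] = [set x | fl k x = c])//; apply/seteqP; split => // x [].
  by rewrite (_ : [set x | _] = set0)//; apply/seteqP; split => // x [].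
- move=> x _; apply: (@cvg_comp _ _ _ (fun k => pt k (fl k x)) phi _ (nbhs (A x))).
    apply/cvg_ballP => e e0.
    near=> k; rewrite /ball /= /mx_ball; split => // i j; rewrite !mxE (ord1 i) ffunE.
    rewrite /ball /=.
    have k0 : (0 : R) < k.+1%:R by [].
    have /andP[h1 h2] := floor_itv (k.+1%:R * A x 0 j).
    rewrite -(ltr_pM2l k0) -[X in X * `|_|](gtr0_norm k0) -normrM mulrBr mulVKf ?gt_eqF//.
    rewrite ger0_norm ?subr_ge0//.
    apply: (@lt_trans _ _ 1); first by rewrite ltrBlDl -[1]/(1%:~R) -intrD.
    rewrite mulrC -ltr_pdivrMr// mul1r.
    by near: k; exact: near_infty_natSinv_lt (PosNum e0).
  exact: cphi.
Unshelve. all: by end_near. Qed.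

End continuous_composition.

(** * Integration by parts for cylindrical functionals *)

Lemma subZ_coord {R : realType} n (A E : 'rV[R]_n) (x : R) j :
  (A - x *: E) 0 j = A 0 j - x * E 0 j.
Proof. by rewrite !mxE. Qed.

Lemma is_derive_line {R : realType} n (phi : 'rV[R]_n -> R) (xi e : 'rV[R]_n)
    (x : R) : derivable phi (xi + x *: e) e ->
  is_derive x 1 (fun y => phi (xi + y *: e)) ('D_e phi (xi + x *: e)).
Proof.
have eqf : (fun h : R => h^-1 *: ((phi \o shift (xi + x *: e)) (h *: e) -
      phi (xi + x *: e))) =
    (fun h : R => h^-1 *: (((fun y => phi (xi + y *: e)) \o shift x) (h *: 1) -
      phi (xi + x *: e))).
  apply/funext => h; congr (_ *: (phi _ - _)).
  by rewrite /= /shift /= [h *: 1]mulr1 scalerDl addrCA.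
by move=> dphi; split; rewrite /derivable /derive -eqf.
Qed.

Section gaussian_integration_by_parts.
Context {R : realType} d (Om : measurableType d) (S : noise R Om).
Hypothesis HS : driving_noise S.
Local Notation T := (hor S).
Local Notation P := (prob S).
Local Notation B := (bm S).

Section cylinder.
Variables (n m : nat) (ti : 'I_n -> R)
  (C : 'I_m -> set (measurableTypeR R * measurableTypeR R)%type).
Hypothesis tiT : forall j, 0 <= ti j <= T.
Hypothesis finC : forall j, finite_mass S (C j).
Let arg (w : Om) : 'rV[R]_(n + m) :=
  row_mx (\row_(j < n) B (ti j) w) (\row_(j < m) fine (prm S w (C j))).

(** The coordinates B t_j with t_j >= b contain the increment exactly once; once it is
   subtracted along e, only the increments over other intervals remain. *)
Lemma wrt_arg_away (a b : R) (l : seq R) (e : 'rV[R]_(n + m)) :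
  0 <= a -> a <= b -> path <=%R b l -> last b l <= T ->
  (forall j, (ti j <= a /\ e 0 (lshift m j) = 0) \/
             (ti j \in b :: l /\ e 0 (lshift m j) = 1)) ->
  (forall j, e 0 (rshift n j) = 0) ->
  forall j, wrt <<s away S a b l>> (fun w => (arg w - inc S a b w *: e) 0 j).
Proof.
move=> a0 ab bl lT tie eN j.
have b0 : 0 <= b by rewrite (le_trans a0).
have bT : b <= T by exact: le_trans (path_last_le bl) lT.
have enl_away : <<s enl S a >> `<=` <<s away S a b l >>.
  by move=> A hA; apply: sub_sigma_algebra; left; left.
have Bs s : 0 <= s <= a -> wrt <<s away S a b l>> (B s).
  move=> sa V mV; apply: enl_away; apply: sub_sigma_algebra; left; left.
  by apply: sub_sigma_algebra; exists s, V.
case: (fintype.split_ordP j) => k ->.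
  have [[ta e0]|[tb e1]] := tie k.
    have -> : (fun w => (arg w - inc S a b w *: e) 0 (lshift m k)) = B (ti k).
      by apply/funext => w; rewrite subZ_coord e0 mulr0 subr0 /arg row_mxEl !mxE.
    by apply: Bs; rewrite ta; case/andP: (tiT k) => ->.
  have -> : (fun w => (arg w - inc S a b w *: e) 0 (lshift m k)) =
      inc S b (ti k) \+ B a.
    by apply/funext => w; rewrite subZ_coord e1 mulr1 /arg row_mxEl !mxE /inc /=; ring.
  apply/wrtP; apply: measurable_funD; apply/wrtP.
    exact: away_bm.
  by apply: Bs; rewrite a0 lexx.
have -> : (fun w => (arg w - inc S a b w *: e) 0 (rshift n k)) =
    (fun w => fine (prm S w (C k))).
  by apply/funext => w; rewrite subZ_coord eN mulr0 subr0 /arg row_mxEr !mxE.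
move=> V mV; apply: enl_away; apply: sub_sigma_algebra; left; right.
apply: sub_sigma_algebra; exists (C k), (fine @^-1` V).
have [mC CT _] := finC k; split => //.
by rewrite -[_ @^-1` _]setTI; exact: fine_measurable.
Qed.

(** On an interval ]a, b] free of the times t_j, the functional depends on the
   increment of B over ]a, b] through phi (xi + x e), where xi and the
   coefficient c are independent of it: Gaussian integration by parts. *)
Lemma cylinder_ibp (phi : 'rV[R]_(n + m) -> R) (a b : R) (l : seq R)
    (e : 'rV[R]_(n + m)) (c : Om -> R) (M : R) :
  C1_bounded phi ->
  0 <= a -> a < b -> path <=%R b l -> last b l <= T ->
  (forall j, (ti j <= a /\ e 0 (lshift m j) = 0) \/
             (ti j \in b :: l /\ e 0 (lshift m j) = 1)) ->
  (forall j, e 0 (rshift n j) = 0) ->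
  wrt <<s enl S a>> c -> (forall w, `|c w| <= M) ->
  \int[P]_w (c w * phi (arg w) * inc S a b w) =
    (b - a) * \int[P]_w (c w * 'D_e phi (arg w)).
Proof.
move=> [[M0 phiM0] dphi cD] a0 ab bl lT tie eN wc cM.
have [cDe [M1 DM1]] := cD e.
have bT : b <= T by exact: le_trans (path_last_le bl) lT.
have aT : a <= T by exact: le_trans (ltW ab) bT.
have b0 : 0 <= b by rewrite (le_trans a0)// ltW.
have sd0 : 0 < Num.sqrt (b - a) by rewrite sqrtr_gt0 subr_gt0.
have cphi : continuous phi by move=> x; exact/differentiable_continuous/dphi.
pose G := away S a b l.
pose OmG := g_sigma_algebraType G.
pose xi (w : OmG) : 'rV[R]_(n + m) := arg w - inc S a b w *: e.
have mxi j : measurable_fun setT (fun w : OmG => xi w 0 j).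
  by apply/wrtP; apply: wrt_arg_away => //; exact: ltW.
have mc : measurable_fun setT (c : OmG -> R).
  apply/wrtP => V mV; apply: sub_sigma_algebra; left; left; exact: wc.
have argE w : arg w = xi w + inc S a b w *: e by rewrite /xi subrK.
have mcomp (f : 'rV[R]_(n + m) -> R) : continuous f ->
    measurable_fun setT (fun z : OmG * measurableTypeR R => f (xi z.1 + z.2 *: e)).
  move=> cf; pose A (z : OmG * measurableTypeR R) : 'rV[R]_(n + m) := xi z.1 + z.2 *: e.
  have h := @measurable_continuous_comp _ _ _ _ f A cf; apply: h => j.
  rewrite (_ : (fun _ => _) = (fun z :
    OmG * measurableTypeR R => xi z.1 0 j + z.2 * e 0 j)).
    apply: measurable_funD; first exact: (measurableT_comp (mxi j)).
    by apply: measurable_funM => //.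
  by apply/funext => z; rewrite /A !mxE.
pose Psi1 (z : OmG * measurableTypeR R) := c z.1 * phi (xi z.1 + z.2 *: e) * z.2.
pose Psi2 (z : OmG * measurableTypeR R) := c z.1 * 'D_e phi (xi z.1 + z.2 *: e).
have mc1 : measurable_fun setT (fun z : OmG * measurableTypeR R => c z.1).
  exact: measurableT_comp.
have mPsi1 : measurable_fun setT Psi1.
  apply: measurable_funM => //; apply: measurable_funM => //; exact: mcomp.
have mPsi2 : measurable_fun setT Psi2.
  by apply: measurable_funM => //; exact: (mcomp _ cDe).
have [/sqintP[minc i2] _ _] := inc_moments HS a0 (ltW ab) bT.
have mG : <<s G >> `<=` measurable by exact: away_measurable.
have ind A (V : set (measurableTypeR R)) : <<s G >> A -> measurable V ->
    P (A `&` inc S a b @^-1` V) = (P A * P (inc S a b @^-1` V))%E.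
  by apply: indep_away => //; exact: ltW.
have M_ge0 : 0 <= M by apply: le_trans (cM point).
have M0_ge0 : 0 <= M0 by apply: le_trans (phiM0 0).
pose g K (w : Om) := K * (1 + (inc S a b w) ^+ 2).
have ig K : P.-integrable setT (EFin \o g K).
  apply: integrableRZ; apply: integrableRD => //.
  exact: finite_measure_integrable_cst.
have sq1 x : 1 <= 1 + x ^+ 2 :> R by rewrite lerDl sqr_ge0.
have sq2 x : `|x| <= 1 + x ^+ 2 :> R.
  have := sqr_ge0 (`|x| - 1); rewrite sqrrB real_normK ?num_real//; nra.
have [|i1 E1] := decouple_dominated mG minc ind mPsi1 (ig (M * M0)).
  move=> w w'; rewrite /Psi1 /g !normrM /= ler_pM// ?mulr_ge0//.
  by rewrite ler_pM.
have bnd2 w w' : `|Psi2 (w, inc S a b w')| <= g (M * M1) w'.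
  rewrite /Psi2 /g normrM /= -[leLHS]mulr1 ler_pM// ?mulr_ge0//.
  by rewrite ler_pM.
have [i3 _] := decouple_dominated mG minc ind mPsi2 (ig (M * M1)) bnd2.
pose Psi3 z := (b - a) * Psi2 z.
have mPsi3 : measurable_fun setT Psi3 by exact: measurable_funM.
have [|_ E3] := decouple_dominated mG minc ind mPsi3 (integrableRZ (b - a) (ig (M * M1))).
  by move=> w w'; rewrite /Psi3 normrM ger0_norm ?subr_ge0 ?(ltW ab)// ler_wpM2l//
    subr_ge0 ltW.
transitivity (\int[P]_w Psi1 (w, inc S a b w)).
  by apply: eq_Rintegral => w _; rewrite [in LHS](argE w).
rewrite E1.
have e2 : \int[P]_w Psi2 (w, inc S a b w) = \int[P]_w (c w * 'D_e phi (arg w)).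
  apply: eq_Rintegral => w _; rewrite /Psi2; congr (c w * 'D_e phi _).
  exact/esym/argE.
rewrite -e2.
rewrite -[RHS](RintegralZl (b - a) measurableT i3).
transitivity (\int[P]_w \int[P]_w' Psi3 (w, inc S a b w')); last by rewrite -E3.
apply: eq_Rintegral => w _; rewrite /Psi1 /Psi3 /Psi2 /=.
pose psi (x : R) : R := phi (xi w + x *: e).
pose dpsi (x : R) : R := 'D_e phi (xi w + x *: e).
have dE (x : R) : is_derive x 1 psi (dpsi x).
  by apply: is_derive_line; exact/diff_derivable/dphi.
have cline : continuous (fun x : R => xi w + x *: e).
  by move=> x; apply: cvgD; [exact: cvg_cst|apply: cvgZ; [exact: cvg_id|exact: cvg_cst]].
have cdpsi : continuous dpsi.
  move=> x; apply: (@cvg_comp _ _ _ (fun y : R => xi w + y *: e) ('D_e phi : _ ->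
    R) _ _ _ (cline x)).
  exact: cDe.
have [j1 j2 F] := inc_ibp HS a0 ab bT dE cdpsi (fun x => phiM0 _) (fun x => DM1 _).
transitivity (\int[P]_w' (c w * (psi (inc S a b w') * inc S a b w'))).
  by apply: eq_Rintegral => w' _; rewrite /psi mulrA.
rewrite (RintegralZl (c w) measurableT j1) F mulrCA.
apply: esym; apply: (etrans (RintegralZl (b - a) measurableT (integrableRZ (c w) j2))).
by rewrite (RintegralZl (c w) measurableT j2).
Qed.

End cylinder.
End gaussian_integration_by_parts.

(** * The Poisson random measure *)

Section poisson.
Context {R : realType} d (Om : measurableType d) (S : noise R Om).
Hypothesis HS : driving_noise S.
Local Notation T := (hor S).
Local Notation P := (prob S).
Local Notation N := (prm S).
Local Notation mark := (measurableTypeR R * measurableTypeR R)%type.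
Implicit Types (A C D : set mark) (k : nat).

Let null : set (set Om) := [set E | measurable E /\ P E = 0%E].

Definition hits C k : set Om := [set w | N w C = k%:R%:E].

Lemma measurable_prm C : measurable C -> C `<=` `]0, T] `*` setT ->
  measurable_fun setT (fun w => N w C).
Proof. by case: HS => _ _ _ [h _ _] _; exact: h. Qed.

Lemma measurable_hits C k : finite_mass S C -> measurable (hits C k).
Proof.
move=> [mC CT _]; rewrite -[hits _ _]setTI.
exact: (measurable_prm mC CT measurableT (emeasurable_set1 _)).
Qed.

Lemma trivIset_hits C : trivIset setT (hits C).
Proof.
move=> i j _ _ [w [h1 h2]].
have /eqP : (i%:R : R)%:E = j%:R%:E by rewrite -h1 -h2.
by rewrite eqe eqr_nat => /eqP.
Qed.

Lemma hits_law C k : finite_mass S C ->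
  P (hits C k) = poisson_prob (fine (intensity S C)) 0%N [set k].
Proof. by case: HS => _ _ _ [_ h _] _; exact: h. Qed.

Lemma hits_bigcup C : finite_mass S C -> P (\bigcup_k hits C k) = 1%E.
Proof.
move=> fC; rewrite measure_bigcup//; last 2 first.
- by move=> k _; exact: measurable_hits.
- exact: trivIset_hits.
transitivity (poisson_prob (fine (intensity S C)) 0%N setT : \bar R).
  have e : [set: nat] = \bigcup_k [set k] by apply/seteqP; split => // k _; exists k.
  rewrite [in RHS]e measure_bigcup//; last by move=> i j _ _ [x [-> ->]].
  by apply: eq_eseriesr => k _; exact: hits_law.
exact: probability_setT.
Qed.

Lemma hits_ae C : finite_mass S C ->
  null (~` \bigcup_k hits C k).
Proof.
move=> fC; have mU : measurable (\bigcup_k hits C k).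
  by apply: bigcup_measurable => k _; exact: measurable_hits.
split; first exact: measurableC.
by rewrite probability_setC// hits_bigcup// subee.
Qed.

Lemma poisson_indep (X : finType) (F : X -> set mark) (kap : X -> nat) :
  (forall x, finite_mass S (F x)) ->
  (forall x y, x != y -> F x `&` F y = set0) ->
  P [set w | forall x, N w (F x) = (kap x)%:R%:E] =
  (\prod_x P (hits (F x) (kap x)))%E.
Proof.
move=> fF dF; case: HS => _ _ _ [_ _ h] _.
have := h #|X| (fun j => F (enum_val j)) (fun j => kap (enum_val j)).
have -> : (\prod_x P (hits (F x) (kap x)) =
    \prod_(j < #|X|) P (hits (F (enum_val j)) (kap (enum_val j))))%E.
  rewrite (reindex (@enum_val X predT))//=; exact: onW_bij (enum_val_bij X).
move=> <-//.
  congr (P _); apply/seteqP; split => w /= hw; first by move=> j; exact: hw.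
  by move=> x; have := hw (enum_rank x); rewrite enum_rankK.
apply/trivIsetP => i j _ _ ij; apply: dF.
by apply: contra_neq ij => /enum_val_inj.
Qed.

Definition early (l : R) D := finite_mass S D /\ D `<=` `]0, l] `*` setT.
Definition late (l : R) D := finite_mass S D /\ D `<=` `]l, T] `*` setT.

(* Finite families of counts are allowed in order to have a pi-system. *)
Definition counts (l : R) : set (set Om) := [set E | exists m
  (D : 'I_m -> set mark) (k : 'I_m -> nat),
  (forall j, early l (D j)) /\ E = [set w | forall j, N w (D j) = (k j)%:R%:E]].

Lemma counts_setT l : counts l setT.
Proof.
exists 0%N, (fun=> set0), (fun=> 0%N); split; first by case.
by apply/seteqP; split => // w _ [].
Qed.

Lemma measurable_counts l : counts l `<=` measurable.
Proof.
move=> _ [m [D [kk [eD ->]]]].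
have -> : [set w | forall j, N w (D j) = (kk j)%:R%:E] =
    \bigcap_(j in [set: 'I_m]) hits (D j) (kk j).
  by apply/seteqP; split => w /= h j => [_|]; exact: h.
by apply: fin_bigcap_measurable => // j _; apply: measurable_hits; case: (eD j).
Qed.

Lemma counts_setI l : setI_closed (counts l).
Proof.
move=> _ _ [m1 [D1 [k1 [e1 ->]]]] [m2 [D2 [k2 [e2 ->]]]].
exists (m1 + m2)%N, (fun j => match fintype.split j with inl a => D1 a | inr a => D2 a
  end),
  (fun j => match fintype.split j with inl a => k1 a | inr a => k2 a end).
split; first by move=> j; case: fintype.split.
apply/seteqP; split => w /=.
  by move=> [h1 h2] j; case: fintype.split.
move=> h; split => j.
  by have := h (unsplit (inl j)); rewrite unsplitK.
by have := h (unsplit (inr j)); rewrite unsplitK.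
Qed.

Lemma finite_mass_sub C D : finite_mass S D -> measurable C -> C `<=` D ->
  finite_mass S C.
Proof.
move=> [mD DT Doo] mC CD; split => //; first exact: subset_trans CD DT.
by apply: le_lt_trans Doo; apply: le_measure => //; rewrite inE.
Qed.

Section atoms.
Variables (l : R) (m : nat) (D : 'I_m -> set mark).
Hypothesis eD : forall j, early l (D j).

Local Notation fset0 := (finset.set0 : {set 'I_m}).

(** The atoms of the Boolean algebra generated by the D j: unlike the D j they are
   disjoint, so that their counts are independent. *)
Definition atom (I : {set 'I_m}) : set mark :=
  [set z | finset (fun j => `[< D j z >]) = I].

Lemma measurable_atom I : measurable (atom I).
Proof.
have -> : atom I = \bigcap_(j in [set: 'I_m]) (if j \in I then D j else ~` D j).
  apply/seteqP; split => z /=.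
    by move=> <- j _; rewrite inE; case: asboolP.
  move=> h; apply/setP => j; rewrite inE; have := h j Logic.I.
  by case: ifP => _ hj; case: asboolP.
apply: fin_bigcap_measurable => // j _; have [[mD _ _] _] := eD j.
by case: ifP => // _; exact: measurableC.
Qed.

Lemma atom_disjoint (I J : {set 'I_m}) : I != J -> atom I `&` atom J = set0.
Proof. by move=> IJ; apply/seteqP; split => // z [/= e1 e2]; move: IJ;
  rewrite -e1 -e2 eqxx. Qed.

Lemma atom_early (I : {set 'I_m}) : I != fset0 -> early l (atom I).
Proof.
move=> /set0Pn[j jI]; have [fD Dl] := eD j.
have sub : atom I `<=` D j.
  by move=> z /= e; move: jI; rewrite -e inE => /asboolP.
split; first exact: finite_mass_sub fD (measurable_atom I) sub.
exact: subset_trans sub Dl.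
Qed.

Lemma early_atoms j w : N w (D j) = (\sum_(I \in [set I : {set 'I_m} | j \in I]) N w
  (atom I))%E.
Proof.
rewrite -measure_fin_bigcup; first last.
- by move=> I _; exact: measurable_atom.
- by move=> I J _ _ [z [/= <- <-]].
- exact: finite_finset.
congr (N w _); apply/seteqP; split => z /=.
  by move=> Djz; exists (finset (fun i => `[< D i z >])) => //=; rewrite inE;
    exact/asboolP.
by move=> [I /= jI e]; move: jI; rewrite -e inE => /asboolP.
Qed.

Definition cells (kap : {ffun {set 'I_m} -> nat}) : set Om :=
  [set w | forall I : {set 'I_m}, I != fset0 -> N w (atom I) = (kap I)%:R%:E].

Lemma measurable_cells kap : measurable (cells kap).
Proof.
have -> : cells kap = \bigcap_(I in [set I : {set 'I_m} | I != fset0])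
    hits (atom I) (kap I).
  by apply/seteqP; split => w /= h I I0; exact: h.
apply: fin_bigcap_measurable => // I I0.
by apply: measurable_hits; have [] := atom_early I0.
Qed.

Lemma cells_late kap C k : late l C ->
  P (cells kap `&` hits C k) =
  ((\prod_(I : {set 'I_m} | I != fset0) P (hits (atom I) (kap I))) * P (hits C k))%E.
Proof.
move=> [fC Cl].
pose F (I : {set 'I_m}) := if I == fset0 then C else atom I.
pose kap' (I : {set 'I_m}) := if I == fset0 then k else kap I.
have disjC I : I != fset0 -> atom I `&` C = set0.
  move=> I0; apply/seteqP; split => // z [aI Cz].
  have [_ /(_ _ aI)[/= + _]] := atom_early I0; have [/= + _] := Cl _ Cz.
  by rewrite !in_itv/= => /andP[lz _] /andP[_ /(lt_le_trans lz)]; rewrite ltxx.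
have := @poisson_indep _ F kap' _ _.
have -> : [set w | forall x, N w (F x) = (kap' x)%:R%:E] = cells kap `&` hits C k.
  apply/seteqP; split => w /=.
    move=> h; split; first by move=> I I0; have := h I; rewrite /F /kap' (negbTE I0).
    by have := h fset0; rewrite /F /kap' eqxx.
  move=> [h1 h2] I; rewrite /F /kap'; case: ifPn => // I0; exact: h1.
move=> ->.
- rewrite (bigD1 fset0)//= /F /kap' eqxx muleC; congr (_ * _)%E.
  by apply: eq_bigr => I /negbTE ->.
- by move=> I; rewrite /F; case: ifPn => // I0; have [] := atom_early I0.
- move=> I J IJ; rewrite /F.
  have [I0|I0] := eqVneq I fset0; have [J0|J0] := eqVneq J fset0.
  + by move: IJ; rewrite I0 J0 eqxx.
  + by rewrite setIC disjC.
  + by rewrite disjC.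
  + exact: atom_disjoint.
Qed.

Lemma indep_cells kap C k : late l C ->
  P (cells kap `&` hits C k) = (P (cells kap) * P (hits C k))%E.
Proof.
move=> lC; rewrite cells_late//; congr (_ * _)%E.
have l0 : late l set0.
  split; last by [].
  split; [exact: measurable0|by []|by rewrite /intensity measure0].
have := @cells_late kap set0 0 l0.
have -> : hits set0 0 = setT.
  by apply/seteqP; split => // w _; rewrite /hits /= measure0.
by rewrite setIT probability_setT mule1.
Qed.

Let Y : set (set Om) := [set E | E = setT \/ E = set0 \/ exists kap, E = cells kap].

Lemma indep_atoms C k E : late l C -> <<s Y >> E ->
  P (E `&` hits C k) = (P E * P (hits C k))%E.
Proof.
move=> lC; apply: (@indep_disjoint _ _ _ P _ cells).
- exact: measurable_cells.
- move=> k1 k2; have [|ne12] := pselect (cells k1 = cells k2); first by left.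
  right; apply/seteqP; split => // w [h1 h2]; apply: ne12.
  have e I : I != fset0 -> (k1 I)%:R%:E = (k2 I)%:R%:E :> \bar R.
    by move=> I0; rewrite -(h1 I I0) (h2 I I0).
  by apply/seteqP; split => v /= hv I I0; rewrite hv// e.
- by apply: measurable_hits; case: lC.
- by move=> kap; exact: indep_cells.
Qed.

(** Outside of the null event that some count is not an integer, the event is a
   countable union of cells. *)
Lemma indep_counts0 (kk : 'I_m -> nat) C k : late l C ->
  P ([set w | forall j, N w (D j) = (kk j)%:R%:E] `&` hits C k) =
  (P [set w | forall j, N w (D j) = (kk j)%:R%:E] * P (hits C k))%E.
Proof.
move=> lC; set E := [set w | _].
pose K (kap : {ffun {set 'I_m} -> nat}) := forall j,
  (\sum_(I \in [set I : {set 'I_m} | j \in I]) ((kap I)%:R : R)%:E)%E = ((kk j)%:R :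
    R)%:E.
pose F n : set Om := if unpickle n is Some kap then
  (if `[< K kap >] then cells kap else set0) else set0.
have YF n : <<s Y >> (F n).
  apply: sub_sigma_algebra; rewrite /F; case: unpickle => [kap|]; last by right; left.
  by case: ifP => _; right; [right; exists kap|left].
pose E' := \bigcup_n F n.
have YE' : <<s Y >> E'.
  by apply: (@bigcupT_measurable _ (g_sigma_algebraType Y)) => n; exact: YF.
pose N0 := \bigcup_(I in [set I : {set 'I_m} | I != fset0])
  ~` (\bigcup_k hits (atom I) k).
have mN0 : measurable N0.
  apply: fin_bigcup_measurable; first exact: finite_finset.
  by move=> I I0; have [] := hits_ae (atom_early I0).1.
have PN0 : P N0 = 0%E.
  apply/negligibleP => //.
  pose G n : set Om := if @unpickle {set 'I_m} n is Some J then
    (if J != fset0 then ~` (\bigcup_k hits (atom J) k) else set0) else set0.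
  apply: (@negligibleS _ _ _ _ (\bigcup_n G n)).
    by move=> w [I /= I0 hw]; exists (pickle I) => //; rewrite /G pickleK I0.
  apply: negligible_bigcup => n; rewrite /G; case: unpickle => [I|]; last exact:
    negligible_set0.
  case: ifPn => I0; last exact: negligible_set0.
  have [mh ph] := hits_ae (atom_early I0).1.
  exact/negligibleP.
have EE' : E `\` N0 = E' `\` N0.
  apply/seteqP; split => w [hw nw]; split => //.
    have /choice[f fP] : forall I : {set 'I_m}, exists k, I != fset0 ->
        N w (atom I) = k%:R%:E.
      move=> I; have [->|I0] := eqVneq I fset0; first by exists 0%N.
      have [[q _ hq]|nq] := pselect ((\bigcup_k hits (atom I) k) w).
        by exists q => _.
      by exfalso; apply: nw; exists I.
    pose kap : {ffun {set 'I_m} -> nat} := [ffun I => f I].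
    exists (pickle kap) => //; rewrite /F pickleK ifT.
      by move=> I I0; rewrite ffunE; exact: fP.
    apply/asboolP => j; rewrite -hw early_atoms; apply: eq_fsbigr => I.
    rewrite inE /= => jI; rewrite ffunE fP//.
    by apply/set0Pn; exists j.
  case: hw => n _; rewrite /F; case: unpickle => // kap; case: ifP => // /asboolP Kk hw.
  move=> j; rewrite early_atoms -Kk; apply: eq_fsbigr => I.
  by rewrite inE /= => jI; apply: hw; apply/set0Pn; exists j.
have mE : measurable E by apply: (@measurable_counts l); exists m, D, kk.
have mE' : measurable E'.
  apply: bigcupT_measurable => n; rewrite /F; case: unpickle => // kap.
  by case: ifP => // _; exact: measurable_cells.
have mC : measurable (hits C k) by apply: measurable_hits; case: lC.
rewrite (eq_prob_mod mE mE' mN0 PN0 EE') -(indep_atoms k lC YE').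
apply: (eq_prob_mod (measurableI _ _ mE mC) (measurableI _ _ mE' mC) mN0 PN0).
by rewrite (setIC E) (setIC E') -!setIDA EE'.
Qed.

End atoms.

Lemma indep_early l C k E : late l C -> <<s counts l >> E ->
  P (E `&` hits C k) = (P E * P (hits C k))%E.
Proof.
move=> lC; apply: indep_gen.
- exact: counts_setI.
- exact: counts_setT.
- exact: measurable_counts.
- by apply: measurable_hits; case: lC.
- by move=> _ [m [D [kk [eD ->]]]]; exact: indep_counts0.
Qed.

(** A set of infinite intensity is a countable union of sets of finite
   intensity, so the counts of the latter generate all the counts. *)
Lemma sigma_prm_counts l : 0 <= l <= T ->
  sigma_prm S l `<=` <<s counts l `|` null >>.
Proof.
move=> /andP[l0 lT]; apply: sub_sigma => _ [C [V [mC Cl mV ->]]].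
set X := counts l `|` null.
have [F [TF tF Foo]] : exists F : nat -> set (measurableTypeR R),
    [/\ \bigcup_n F n = setT, trivIset setT F &
    forall n, measurable (F n) /\ (nu S (F n) < +oo)%E].
  have /sigma_finiteP[F [UF ndF Foo]] := sigma_finiteT (nu S).
  exists (seqDU F); split.
  - by rewrite -seqDU_bigcup_eq -UF.
  - exact: trivIset_seqDU.
  - move=> n; have mD : measurable (seqDU F n).
      apply: measurableD; first exact: (Foo n).1.
      by apply: bigsetU_measurable => i _; exact: (Foo i).1.
    split => //; apply: le_lt_trans (Foo n).2; apply: le_measure; rewrite ?inE//.
      exact: (Foo n).1.
    exact: subDsetl.
pose Cn n := C `&` (setT `*` F n).
have mCn n : measurable (Cn n).
  by apply: measurableI => //; apply: measurableX => //; case: (Foo n).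
have eCn n : early l (Cn n).
  split; last by move=> z [/Cl].
  apply: (@finite_mass_sub _ (`]0, T] `*` F n)) => //.
    split; [by apply: measurableX => //; case: (Foo n)|by move=> z []|].
    rewrite /intensity product_measure1E//; last by case: (Foo n).
    rewrite lte_mul_pinfty//.
    - change (lebesgue_measure `]0, T]%classic \is a fin_num).
      by rewrite lebesgue_measure_itv/= lte_fin (T_gt0 HS) sube0.
    - by case: (Foo n).
  move=> z [/Cl[/= + _] [_ Fz]] => hz; split => //=; move: hz.
  by rewrite !in_itv/= => /andP[-> /le_trans ->].
have mN n : measurable_fun setT ((fun w => N w (Cn n)) : g_sigma_algebraType X -> \bar R).
  move=> _ W mW; rewrite setTI.
  have -> : (fun w => N w (Cn n)) @^-1` W =
      (\bigcup_k (if `[< W k%:R%:E >] then hits (Cn n) k else set0)) `|`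
      ((fun w => N w (Cn n)) @^-1` W `&` ~` (\bigcup_k hits (Cn n) k)).
    apply/seteqP; split => w /=.
      move=> Ww; have [[k _ hk]|] := pselect ((\bigcup_k hits (Cn n) k) w).
        by left; exists k => //; rewrite asboolT// -hk.
      by right.
    move=> [[k _]|[//]]; case: asboolP => // Wk hw.
    by rewrite [N w _]hw.
  have [mNn PNn] := hits_ae (eCn n).1.
  apply: measurableU.
    apply: bigcupT_measurable => k; case: ifP => _; last exact: measurable0.
    apply: sub_sigma_algebra; left; exists 1%N, (fun=> Cn n), (fun=> k).
    split => //; apply/seteqP; split => w /=; first by move=> ? _.
    by apply; exact: ord0.
  apply: sub_sigma_algebra; right.
  have mW' : measurable ((fun w => N w (Cn n)) @^-1` W).
    rewrite -[_ @^-1` _]setTI; apply: measurable_prm => //.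
    by have [[]] := eCn n.
  split; first exact: measurableI.
  by apply: subset_measure0 PNn => //; exact: measurableI.
have mNC : measurable_fun setT ((fun w => N w C) : g_sigma_algebraType X -> \bar R).
  rewrite (_ : (fun w => N w C) = (fun w => \sum_(n <oo | n \in xpredT) N w (Cn n))%E).
    by apply: ge0_emeasurable_sum.
  apply/funext => w; have -> : C = \bigcup_n Cn n.
    by rewrite /Cn -setI_bigcupr -setX_bigcupr TF setXTT setIT.
  rewrite measure_bigcup//; last first.
    apply/trivIsetP => i j _ _ ij; apply/seteqP; split => //
      z [[_ [_ /= h1]] [_ [_ /= h2]]].
    have : (F i `&` F j) z.2 by [].
    by move/trivIsetP : tF => /(_ i j Logic.I Logic.I ij) ->.
  by apply: eq_eseriesl => n; rewrite in_setT.
by have := mNC measurableT V mV; rewrite setTI.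
Qed.

Lemma indep_sigma_prm l C k E : 0 <= l <= T -> late l C -> sigma_prm S l E ->
  P (E `&` hits C k) = (P E * P (hits C k))%E.
Proof.
move=> l0T lC hE; have lT : l <= T by case/andP: l0T.
have {}hE : <<s <<s counts l>> `|` [set setT] `|` null >> E.
  apply: (sub_sigma _ (sigma_prm_counts l0T hE)) => A [hA|hA].
    by apply: sub_sigma_algebra; left; left; exact: sub_sigma_algebra.
  by apply: sub_sigma_algebra; right.
apply: (indep_join _ _ _ _ _ _ _ _ _ hE).
- by move=> A1 A2 h1 h2; exact: (@measurableI _ (g_sigma_algebraType _)).
- exact: (@measurableT _ (g_sigma_algebraType _)).
- apply: smallest_sub; first exact: sigma_algebra_measurable.
  exact: measurable_counts.
- exact: (@measurable0 _ (g_sigma_algebraType _)).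
- by move=> A1 A2 -> ->; rewrite setIT.
- by [].
- by move=> A ->.
- by apply: measurable_hits; case: lC.
- by move=> A A' hA ->; rewrite setIT; exact: (indep_early k lC hA).
Qed.

Definition count C (w : Om) : R := fine (N w C).

Lemma measurable_count C : finite_mass S C -> measurable_fun setT (count C).
Proof.
move=> [mC CT _]; apply: measurableT_comp; last exact: measurable_prm.
exact: fine_measurable.
Qed.

Lemma sigma_prm_count C t (V : set (measurableTypeR R)) : measurable C ->
  C `<=` `]0, t] `*` setT -> measurable V -> sigma_prm S t (count C @^-1` V).
Proof.
move=> mC Ct mV; apply: sub_sigma_algebra; exists C, (fine @^-1` V); split => //.
by rewrite -[_ @^-1` _]setTI; exact: fine_measurable.
Qed.

(** What the jumps after time l are independent of *)
Definition pre (l : R) : set (set Om) := sigma_bm S T `|` sigma_prm S l `|` null.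

Lemma indep_late l C E (V : set (measurableTypeR R)) : 0 <= l <= T -> late l C ->
  <<s pre l>> E -> measurable V ->
  P (E `&` count C @^-1` V) = (P E * P (count C @^-1` V))%E.
Proof.
move=> l0T lC hE mV; have /andP[l0 lT] := l0T.
have [fC Cl] := lC; have [mC CT _] := fC.
have mD : measurable (count C @^-1` V).
  by rewrite -[_ @^-1` _]setTI; exact: measurable_count.
have indN (A : set Om) : sigma_prm S l A ->
    P (A `&` count C @^-1` V) = (P A * P (count C @^-1` V))%E.
  move=> hA; have mA := sigma_prm_measurable HS lT hA.
  pose Z : set (set Om) := [set E | E = setT \/ E = set0 \/ exists k, E = hits C k].
  pose F := \bigcup_k (if `[< V k%:R >] then hits C k else set0).
  have ZF : <<s Z >> F.
    apply: (@bigcupT_measurable _ (g_sigma_algebraType Z)) => k.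
    apply: sub_sigma_algebra; case: ifP => _; first by right; right; exists k.
    by right; left.
  have indF : P (F `&` A) = (P F * P A)%E.
    apply: (indep_disjoint _ _ mA _ ZF).
    - by move=> k; exact: measurable_hits.
    - move=> k1 k2; have [->|k12] := eqVneq k1 k2; [by left|right].
      have tH := @trivIset_hits C.
      by move/trivIsetP : tH => /(_ k1 k2 Logic.I Logic.I k12).
    - by move=> k; rewrite setIC (indep_sigma_prm k l0T lC hA) muleC.
  have mF : measurable F.
    by apply: bigcupT_measurable => k; case: ifP => // _; exact: measurable_hits.
  have [mN0 PN0] := hits_ae fC.
  have FD : count C @^-1` V `\` ~` (\bigcup_k hits C k) =
      F `\` ~` (\bigcup_k hits C k).
    apply/seteqP; split => w [hw /contrapT hN]; split; rewrite ?setCK//.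
      case: hN => k _ hk; exists k => //; rewrite asboolT//.
      by move: hw; rewrite /= /count hk.
    case: hw => k _; case: asboolP => // Vk hk.
    by rewrite /= /count hk.
  rewrite (eq_prob_mod mD mF mN0 PN0 FD) muleC -indF.
  rewrite setIC; apply: (eq_prob_mod (measurableI _ _ mD mA)
    (measurableI _ _ mF mA) mN0 PN0).
  by rewrite (setIC _ A) (setIC F) -!setIDA FD.
have indBN : independent_families S (sigma_bm S T) (sigma_prm S T) by case: HS.
apply: (indep_join_sigma (sigma_bm_measurable HS (lexx T))
  (sigma_prm_measurable HS lT) mD _ hE).
move=> A1 A2 h1 h2; rewrite -setIA indBN//; last first.
  apply: (@measurableI _ (g_sigma_algebraType _)).
    exact: (sigma_prm_le lT h2).
  exact: sigma_prm_count.
rewrite indN// indBN//; last exact: (sigma_prm_le lT h2).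
by rewrite muleA.
Qed.

Lemma count_expectation C (f : R -> R) : finite_mass S C ->
  measurable_fun setT f -> (forall x, 0 <= x -> 0 <= f x) ->
  (\int[P]_w (f (count C w))%:E = \sum_(k <oo) ((f k%:R)%:E * P (hits C k)))%E.
Proof.
move=> fC mf f0; have [mN0 PN0] := hits_ae fC.
have mH k : measurable (hits C k) by exact: measurable_hits.
have mfc : measurable_fun setT (EFin \o (f \o count C)).
  apply/measurable_EFinP; apply: measurableT_comp => //; exact: measurable_count.
have mU : measurable (\bigcup_k hits C k) by apply: bigcupT_measurable.
have c0 w : 0 <= count C w by rewrite /count fine_ge0.
transitivity (\int[P]_(w in \bigcup_k hits C k) (f (count C w))%:E)%E.
  rewrite -[in RHS](setTI (\bigcup_k hits C k)) -[X in setT `&` X]setCK -setDE.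
  rewrite -ge0_negligible_integral//.
  by move=> w _; rewrite lee_fin f0.
rewrite ge0_integral_bigcup//; last 3 first.
- exact: measurable_funTS.
- by move=> w _; rewrite lee_fin f0.
- exact: trivIset_hits.
apply: eq_eseriesr => k _.
rewrite (eq_integral (fun=> (f k%:R)%:E)); last first.
  by move=> w; rewrite inE /hits /= /count => ->.
by rewrite integral_cst.
Qed.

Lemma hits_pmf C k : finite_mass S C ->
  P (hits C k) = (if 0 < fine (intensity S C) then poisson_pmf (fine (intensity S C)) k
    else (k == 0%N)%:R)%:E.
Proof.
move=> fC; rewrite hits_law// /poisson_prob; case: ifPn => h.
  by rewrite esum_set1// lee_fin poisson_pmf_ge0.
rewrite diracE; suff -> : (0%N \in [set k]) = (k == 0%N) by [].
by apply/idP/eqP => [|->]; rewrite inE.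
Qed.

(** The relation k pmf(k) = lambda pmf(k - 1), from which the moments follow *)
Lemma hits_rec C k : finite_mass S C ->
  ((k.+1%:R)%:E * P (hits C k.+1) = (fine (intensity S C))%:E * P (hits C k))%E.
Proof.
move=> fC; rewrite !hits_pmf//; set lam := fine _; case: ifPn => h.
  rewrite -!EFinM /poisson_pmf h; congr (_%:E).
  have h1 : k.+1%:R != 0 :> R by rewrite pnatr_eq0.
  have h2 : k`!%:R != 0 :> R by rewrite pnatr_eq0 -lt0n fact_gt0.
  rewrite exprS factS natrM; move: h1 h2; set u := k.+1%:R; set v := k`!%:R => h1 h2.
  by clearbody u v; field; rewrite ?h1 ?h2.
have -> : lam = 0 by apply/eqP; rewrite eq_le leNgt h/= /lam fine_ge0.
by rewrite mul0e mule0.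
Qed.

Lemma sum_hits_rec C (f : R -> R) : finite_mass S C ->
  (forall x, 0 <= x -> 0 <= f x) ->
  (\sum_(k <oo) ((k%:R * f k%:R)%:E * P (hits C k)) =
   (fine (intensity S C))%:E * \sum_(k <oo) ((f (k.+1)%:R)%:E * P (hits C k)))%E.
Proof.
move=> fC f0; rewrite -nneseriesZl; last first.
  by move=> k _; rewrite mule_ge0// lee_fin f0.
rewrite nneseries_recl//; last by move=> k _; rewrite mule_ge0// lee_fin mulr_ge0// f0.
rewrite mul0r mul0e add0e -nneseries_addn; last first.
  by move=> k; rewrite mule_ge0// lee_fin mulr_ge0// f0.
apply: eq_eseriesr => k _; rewrite addn1 mulrC EFinM -muleA hits_rec//.
by rewrite muleCA.
Qed.

Lemma sum_hits C : finite_mass S C -> (\sum_(k <oo) P (hits C k) = 1)%E.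
Proof.
move=> fC; rewrite -(hits_bigcup fC) measure_bigcup//.
- by apply: eq_eseriesl => n; rewrite in_setT.
- by move=> k _; exact: measurable_hits.
- exact: trivIset_hits.
Qed.

Lemma count_moments C : finite_mass S C ->
  sqint P (count C) /\ \int[P]_w count C w = fine (intensity S C).
Proof.
move=> fC; have mc := measurable_count fC.
have e1 : (\int[P]_w (count C w)%:E = (fine (intensity S C))%:E)%E.
  rewrite (count_expectation (f := id))//.
  have := @sum_hits_rec C (cst 1) fC (fun _ _ => ler01).
  under eq_eseriesr do rewrite mulr1.
  move=> ->; under eq_eseriesr do rewrite mul1e.
  by rewrite sum_hits// mule1.
split; last by rewrite /Rintegral e1.
split => //.
rewrite (count_expectation (f := fun x => x ^+ 2))//; last first.
  by move=> x _; exact: sqr_ge0.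
under eq_eseriesr do rewrite expr2.
rewrite (@sum_hits_rec C id)//.
under eq_eseriesr => k _ do rewrite -natr1 EFinD ge0_muleDl ?lee_fin//.
rewrite nneseriesD//; first last.
- by move=> k _ _; rewrite mule_ge0.
- by move=> k _ _; rewrite mule_ge0// lee_fin.
under [X in (_ * (_ + X))%E]eq_eseriesr do rewrite mul1e.
rewrite sum_hits//.
have := @sum_hits_rec C (cst 1) fC (fun _ _ => ler01).
under eq_eseriesr do rewrite mulr1.
move=> ->; under eq_eseriesr do rewrite mul1e.
by rewrite sum_hits// mule1 -EFinD -EFinM ltry.
Qed.

End poisson.

(** * Stochastic integrals *)

Lemma Rintegral_prob_cst {R : realType} d (Om : measurableType d)
  (Pr : probability Om R) (k : R) : \int[Pr]_w k = k.
Proof.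
by rewrite /Rintegral; have := expectation_cst Pr k; rewrite unlock => ->.
Qed.

Section stochastic_integrals.
Context {R : realType} d (Om : measurableType d) (S : noise R Om).
Hypothesis HS : driving_noise S.
Local Notation T := (hor S).
Local Notation P := (prob S).
Local Notation B := (bm S).
Local Notation mark := (measurableTypeR R * measurableTypeR R)%type.
Local Notation timeT := (measurableTypeR R).

Definition dtP : {measure set (timeT * Om)%type -> \bar R} :=
  (@lebesgue_measure R \x P)%E.

(** Extended by 0 outside [0, T], processes are functions on the product space R x Om;
   this makes the theory of integration on a product available. *)
Definition ext (a : R -> Om -> R) : timeT * Om -> R :=
  (fun z => a z.1 z.2) \_ (time_space S).

Lemma measurable_time_space : measurable (time_space S).
Proof. by apply: measurableX. Qed.

Lemma measurable_ext a : jointly_measurable S a -> measurable_fun setT (ext a).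
Proof.
move=> ma; apply/measurable_restrict => //; first exact: measurable_time_space.
by rewrite setTI.
Qed.

Lemma extE a t w : 0 <= t <= T -> ext a (t, w) = a t w.
Proof. by move=> tT; rewrite /ext patchE ifT// inE; split => //=; rewrite in_itv. Qed.

Lemma ext_out a t w : ~~ (0 <= t <= T) -> ext a (t, w) = 0.
Proof.
move=> tT; rewrite /ext patchE ifF//; apply/negP; rewrite inE => -[/= + _].
by rewrite in_itv/=; exact/negP.
Qed.

Lemma sqnormE a : jointly_measurable S a ->
  sqnorm S a = (\int[dtP]_z ((ext a z) ^+ 2)%:E)%E.
Proof.
move=> ma; rewrite /dtP (fubini_tonelli2 (fun z => ((ext a z) ^+ 2)%:E)).
- rewrite /sqnorm /leb; apply: eq_integral => w _.
  rewrite /fubini_G [LHS]integral_mkcond; apply: eq_integral => t _.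
  rewrite patchE; case: ifPn => tT.
    by rewrite extE//; move: tT; rewrite inE /= in_itv.
  rewrite ext_out ?expr0n//; apply: contra tT => tT.
  by rewrite inE /= in_itv.
- by apply/measurable_EFinP; apply: measurable_funX; exact: measurable_ext.
- by move=> z; rewrite lee_fin sqr_ge0.
Qed.

Lemma L2_ext a : L2_process S a -> sqint dtP (ext a).
Proof. by move=> [ma aoo]; split; [exact: measurable_ext|rewrite -sqnormE]. Qed.

Lemma extB a a' : ext (fun t w => a t w - a' t w) = ext a \- ext a'.
Proof.
by apply/funext => z; rewrite /ext /= !patchE; case: ifP => //; rewrite subrr.
Qed.

Lemma jointly_measurableB a a' : jointly_measurable S a -> jointly_measurable S a' ->
  jointly_measurable S (fun t w => a t w - a' t w).
Proof. by move=> ma ma'; exact: measurable_funB. Qed.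

Lemma sqint_integrable (U : Om -> R) : sqint P U -> P.-integrable setT (EFin \o U).
Proof.
move=> /sqintP[mU iU]; apply: (@integrable_le _ _ _ P _ (fun w => 1 + (U w) ^+ 2)) => //.
  by apply: integrableRD => //; exact: finite_measure_integrable_cst.
by move=> w; have := sqr_ge0 (`|U w| - 1); rewrite sqrrB real_normK ?num_real//; nra.
Qed.

Lemma sqint_bounded (U : Om -> R) (M : R) : measurable_fun setT U ->
  (forall w, `|U w| <= M) -> sqint P U.
Proof.
move=> mU UM; have s1 : sqint P (cst 1).
  apply/sqintP; split => //; rewrite (_ : (fun _ => _) = EFin \o cst 1).
    exact: finite_measure_integrable_cst.
  by apply/funext => w; rewrite /= expr1n.
have := sqintM_bounded s1 mU UM; congr sqint.
by apply/funext => w; rewrite /= mulr1.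
Qed.

(** The elementary integrand c 1_]u, v], used as a test function *)
Definition stepf (u v : R) (c : Om -> R) (z : timeT * Om) : R :=
  c z.2 * \1_(`]u, v]) z.1.

Record ok_step (u v : R) (c : Om -> R) : Prop := OkStep {
  ok_ge0 : 0 <= u ; ok_le : u <= v ; ok_leT : v <= T ;
  ok_wrt : wrt (filt S u) c ;
  ok_bnd : exists M : R, forall w, `|c w| <= M }.

Lemma step_okP e : step_ok S e <-> ok_step (lo e) (hi e) (coef e).
Proof. by split=> -[]. Qed.

Section step.
Variables (u v : R) (c : Om -> R).
Hypothesis uvc : ok_step u v c.

Lemma ok_uT : u <= T. Proof. by case: uvc => _ uv vT _ _; exact: le_trans vT. Qed.

Lemma ok_wrt_enl : wrt <<s enl S u>> c.
Proof. by move=> V mV; apply: (filt_enl ok_uT); exact: (ok_wrt uvc). Qed.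

Lemma ok_measurable : measurable_fun setT c.
Proof.
move=> _ V mV; rewrite setTI; apply: (filt_measurable HS ok_uT).
exact: (ok_wrt uvc).
Qed.

Lemma ok_sqint : sqint P c.
Proof. by have [M cM] := ok_bnd uvc; exact: sqint_bounded ok_measurable cM. Qed.

Lemma ok_sqint_inc : sqint P (fun w => c w * inc S u v w).
Proof.
have [M cM] := ok_bnd uvc; case: uvc => u0 uv vT _ _.
have [si _ _] := inc_moments HS u0 uv vT.
exact: sqintM_bounded si ok_measurable cM.
Qed.

Lemma ok_sub u' v' : u <= u' -> u' <= v' -> v' <= v -> ok_step u' v' c.
Proof.
move=> uu uv vv; case: uvc => u0 _ vT wc bc; split => //.
- exact: le_trans uu.
- exact: le_trans vT.
- by move=> V mV; apply: (filt_le uu); exact: wc.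
Qed.

Lemma stepf_sqint : sqint dtP (stepf u v c).
Proof.
have [M cM] := ok_bnd uvc.
have M0 : 0 <= M by apply: le_trans (cM point).
have mf : measurable_fun setT (stepf u v c).
  apply: measurable_funM; first exact: measurableT_comp ok_measurable _.
  exact: (measurableT_comp (measurable_indic (measurable_itv `]u, v]))).
split => //.
rewrite /dtP (fubini_tonelli1 (fun z => ((stepf u v c z) ^+ 2)%:E)); last 2 first.
- by apply/measurable_EFinP; apply: measurable_funX.
- by move=> z; rewrite lee_fin sqr_ge0.
apply: (@le_lt_trans _ _ (\int[lebesgue_measure]_t
    (M ^+ 2 * \1_(`]u, v] : set R) t)%:E)%E).
  apply: ge0_le_integral => //.
  - by move=> t _; apply: integral_ge0 => w _; rewrite lee_fin sqr_ge0.
  - apply: (measurable_fun_fubini_tonelli_F (fun z => ((stepf u v c z) ^+ 2)%:E)).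
      by apply/measurable_EFinP; apply: measurable_funX.
    by move=> z; rewrite lee_fin sqr_ge0.
  - by apply/measurable_EFinP; apply: measurable_funM.
  - move=> t _; rewrite /fubini_F.
    apply: (@le_trans _ _ (\int[P]_w (M ^+ 2 * \1_(`]u, v] : set R) t)%:E)%E).
      apply: ge0_le_integral => //.
      + by move=> w _; rewrite lee_fin sqr_ge0.
      + apply/measurable_EFinP; apply: measurable_funX; apply: measurable_funM.
          exact: ok_measurable.
        by rewrite (_ : (fun _ => _) = cst (\1_(`]u, v]) t)).
      + move=> w _; rewrite lee_fin /stepf /= exprMn indicE.
        case: (_ \in _); last by rewrite expr0n/= !mulr0.
        rewrite expr1n !mulr1 -(real_normK (num_real (c w))) ler_sqr ?nnegrE//.
    by have := expectation_cst P (M ^+ 2 * \1_(`]u, v]) t); rewrite unlock => ->.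
under eq_integral do rewrite EFinM.
rewrite ge0_integralZl//; last 2 first.
- exact/measurable_EFinP.
- by rewrite lee_fin sqr_ge0.
rewrite integral_indic//= setIT lebesgue_measure_itv/=.
by case: ifP => _; rewrite -?EFinB -?EFinM ?mule0 ltry.
Qed.

End step.

Lemma ext_simple_val s : simple S s ->
  ext (simple_val s) = (fun z => \sum_(e <- s) stepf (lo e) (hi e) (coef e) z).
Proof.
elim: s => [|e s IH] ss.
  by apply/funext => z; rewrite /ext patchE /simple_val !big_nil; case: ifP.
have /step_okP[l0 lh hT _ _] : step_ok S e by exact: (ss 0%N).
have {}IH := IH (fun n => ss n.+1).
apply/funext => z; rewrite big_cons -[X in _ = _ + X](congr1 (fun f => f z) IH).
rewrite /ext !patchE /simple_val big_cons /stepf; case: ifPn => // nz.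
rewrite addr0 indicE; case: (boolP (_ \in _)); last by rewrite mulr0.
rewrite inE /= in_itv/= => /andP[lz zh]; move/negP: nz; case.
rewrite inE; split => //=; rewrite in_itv/= (ltW (le_lt_trans l0 lz)).
exact: le_trans hT.
Qed.

Lemma simple_int_inc e w : step_ok S e ->
  coef e w * (B (Num.min (hi e) T) w - B (Num.min (lo e) T) w) =
  coef e w * inc S (lo e) (hi e) w.
Proof.
by move=> [l0 lh hT _ _]; rewrite !min_l// (le_trans lh).
Qed.

Lemma past_orth u v (U : Om -> R) c : ok_step u v c -> wrt <<s enl S u>> U ->
  sqint P U -> \int[P]_w (U w * (c w * inc S u v w)) = 0.
Proof.
move=> uvc wU sU; have [M cM] := ok_bnd uvc; case: (uvc) => u0 uv vT _ _.
have mc := ok_measurable uvc.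
have sUc : sqint P (fun w => c w * U w) by exact: sqintM_bounded sU mc cM.
have wUc : wrt <<s enl S u>> (fun w => c w * U w).
  by apply/wrtP; apply: measurable_funM; apply/wrtP => //; exact: (ok_wrt_enl uvc).
have [_ e _ _] := past_inc HS u0 uv vT wUc (sqint_integrable sUc).
by rewrite -[RHS]e; apply: eq_Rintegral => w _; ring.
Qed.

Lemma wrt_enl_inc s t u : 0 <= s -> s <= t -> t <= u -> wrt <<s enl S u>> (inc S s t).
Proof.
move=> s0 st tu V mV; apply: sub_sigma_algebra; left; left.
by apply: (sigma_bm_le tu); exact: sigma_bm_inc.
Qed.

Lemma wrt_enl_le s t (U : Om -> R) : s <= t -> wrt <<s enl S s>> U -> wrt <<s enl S t>> U.
Proof. by move=> st wU V mV; apply: (enl_le st); exact: wU. Qed.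

Lemma wrt_enlM u (U V : Om -> R) : wrt <<s enl S u>> U -> wrt <<s enl S u>> V ->
  wrt <<s enl S u>> (fun w => U w * V w).
Proof. by move=> wU wV; apply/wrtP; apply: measurable_funM; apply/wrtP. Qed.

(** The part of ]u, v] that precedes u' contributes nothing, because the increment over
   ]u', v'] is orthogonal to its past; on the common part of the two intervals the
   conditional expectation of the squared increment is the length. *)
Lemma ito_isometry_le u v c u' v' c' : ok_step u v c -> ok_step u' v' c' -> u <= u' ->
  \int[P]_w (c w * inc S u v w * (c' w * inc S u' v' w)) =
  Num.max 0 (Num.min v v' - u') * \int[P]_w (c w * c' w).
Proof.
move=> uvc uvc' uu'.
have [M cM] := ok_bnd uvc; have [M' cM'] := ok_bnd uvc'.
have [u0 uv vT _ _] := uvc; have [u'0 uv' vT' _ _] := uvc'.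
have mc := ok_measurable uvc; have mc' := ok_measurable uvc'.
have wc : wrt <<s enl S u'>> c by apply: (wrt_enl_le uu'); exact: (ok_wrt_enl uvc).
have wc' : wrt <<s enl S u'>> c' by exact: (ok_wrt_enl uvc').
have [vu'|u'v] := leP v u'.
  rewrite max_l ?mul0r; last by rewrite subr_le0 (le_trans _ vu')// ge_min lexx.
  apply: past_orth => //; last exact: ok_sqint_inc.
  by apply: wrt_enlM => //; exact: wrt_enl_inc.
have s1 : sqint P (fun w => c w * inc S u u' w).
  by apply: ok_sqint_inc; apply: (ok_sub uvc) => //; exact: ltW.
have ok2 : ok_step u' v c by apply: (ok_sub uvc) => //; exact: ltW.
have s2 : sqint P (fun w => c w * inc S u' v w) by exact: ok_sqint_inc.
have s' : sqint P (fun w => c' w * inc S u' v' w) by exact: ok_sqint_inc.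
transitivity (\int[P]_w (c w * inc S u u' w * (c' w * inc S u' v' w)) +
    \int[P]_w (c w * inc S u' v w * (c' w * inc S u' v' w))).
  rewrite -RintegralD//.
  - by apply: eq_Rintegral => w _; rewrite /inc; ring.
  - exact: sqint_mulr_integrable.
  - exact: sqint_mulr_integrable.
rewrite past_orth ?add0r//; last by apply: wrt_enlM => //; exact: wrt_enl_inc.
set h := Num.min v v'; set H := Num.max v v'.
have u'h : u' <= h by rewrite le_min (ltW u'v).
have hH : h <= H by rewrite /h /H ge_min le_max lexx.
have HT : H <= T by rewrite ge_max vT.
have hT : h <= T by exact: le_trans HT.
rewrite max_r ?subr_ge0//.
pose cc w := c w * c' w.
have mcc : measurable_fun setT cc by exact: measurable_funM.
have wcc : wrt <<s enl S u'>> cc by exact: wrt_enlM.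
have ccM w : `|cc w| <= M * M' by rewrite normrM ler_pM.
have scc : sqint P cc by exact: sqint_bounded mcc ccM.
have [sih _ _] := inc_moments HS u'0 u'h hT.
have [siH _ _] := inc_moments HS (le_trans u'0 u'h) hH HT.
have [_ _ i2 e2] := past_inc HS u'0 u'h hT wcc (sqint_integrable scc).
transitivity (\int[P]_w (cc w * inc S u' h w ^+ 2) +
   \int[P]_w ((cc w * inc S u' h w) * inc S h H w)).
  rewrite -RintegralD//.
  - apply: eq_Rintegral => w _; rewrite /h /H /inc /cc.
    by case: (leP v v') => _; ring.
  - apply: sqint_mulr_integrable => //.
    exact: sqintM_bounded sih mcc ccM.
rewrite e2; have [||_ -> _ _] := past_inc HS (le_trans u'0 u'h) hH HT
  (U := fun w => cc w * inc S u' h w).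
- apply: wrt_enlM; first exact: wrt_enl_le wcc.
  exact: wrt_enl_inc.
- by apply: sqint_integrable; exact: sqintM_bounded sih mcc ccM.
by rewrite addr0.
Qed.

Lemma stepf_ip u v c u' v' c' : ok_step u v c -> ok_step u' v' c' ->
  \int[dtP]_z (stepf u v c z * stepf u' v' c' z) =
  Num.max 0 (Num.min v v' - Num.max u u') * \int[P]_w (c w * c' w).
Proof.
move=> uvc uvc'; have i12 := sqint_mulr_integrable (stepf_sqint uvc) (stepf_sqint uvc').
rewrite /dtP Rfubini1//.
have icc := sqint_mulr_integrable (ok_sqint uvc) (ok_sqint uvc').
transitivity (\int[lebesgue_measure]_t
    (\1_(`]Num.max u u', Num.min v v'] : set R) t * \int[P]_w (c w * c' w))).
  apply: eq_Rintegral => t _; rewrite /stepf /= -RintegralZl//.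
  apply: eq_Rintegral => w _.
  have -> : \1_(`]Num.max u u', Num.min v v'] : set R) t =
     \1_(`]u, v] : set R) t * \1_(`]u', v'] : set R) t :> R.
    have -> : `]Num.max u u', Num.min v v']%classic = `]u, v]%classic `&` `]u',
      v']%classic.
      apply/seteqP; split => x /=; rewrite !in_itv/= gt_max le_min.
        by move=> /andP[/andP[-> ->] /andP[-> ->]].
      by move=> [/andP[-> ->] /andP[-> ->]].
    by rewrite indicI.
  ring.
rewrite RintegralZr//; last by apply: integrable_indic_itv.
congr (_ * _); rewrite /Rintegral integral_indic//= setIT lebesgue_measure_itv/= lte_fin.
have [h|h] := ltP (Num.max u u') (Num.min v v').
  by rewrite /= [RHS]max_r// subr_ge0 ltW.
by rewrite /= [RHS]max_l// subr_le0.
Qed.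

Lemma ito_isometry u v c u' v' c' : ok_step u v c -> ok_step u' v' c' ->
  \int[P]_w (c w * inc S u v w * (c' w * inc S u' v' w)) =
  \int[dtP]_z (stepf u v c z * stepf u' v' c' z).
Proof.
move=> uvc uvc'; rewrite stepf_ip//; have [uu'|/ltW uu'] := leP u u'.
  exact: ito_isometry_le.
under eq_Rintegral do rewrite mulrC.
under [in RHS]eq_Rintegral do rewrite mulrC.
by rewrite minC; exact: ito_isometry_le.
Qed.

Lemma simple_cons e s : simple S (e :: s) ->
  ok_step (lo e) (hi e) (coef e) /\ simple S s.
Proof.
by move=> ss; split; [apply/step_okP; exact: (ss 0%N)|move=> n; exact: (ss n.+1)].
Qed.

Lemma simple_val_sqint s : simple S s -> sqint dtP (ext (simple_val s)).
Proof.
move=> ss; rewrite ext_simple_val//; elim: s ss => [|e s IH] ss.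
  by under eq_fun do rewrite big_nil; exact: sqint0.
have [oe ss'] := simple_cons ss.
under eq_fun do rewrite big_cons.
exact: sqintD (stepf_sqint oe) (IH ss').
Qed.

Lemma simple_val_jm s : simple S s -> jointly_measurable S (simple_val s).
Proof.
elim: s => [|e s IH] ss.
  by rewrite /jointly_measurable /simple_val; under eq_fun do rewrite big_nil; exact:
    measurable_cst.
have [oe ss'] := simple_cons ss.
rewrite /jointly_measurable /simple_val; under eq_fun do rewrite big_cons.
apply: measurable_funD; last exact: IH.
apply: measurable_funTS.
apply: measurable_funM; first exact: measurableT_comp (ok_measurable oe) _.
exact: (measurableT_comp (measurable_indic (measurable_itv `]lo e, hi e]))).
Qed.

Lemma simple_intE s : simple S s ->
  simple_int S s T = (fun w => \sum_(e <- s) coef e w * inc S (lo e) (hi e) w).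
Proof.
elim: s => [|e s IH] ss; apply/funext => w; first by rewrite /simple_int !big_nil.
have [oe ss'] := simple_cons ss.
rewrite /simple_int !big_cons simple_int_inc; last exact/step_okP.
by congr (_ + _); have := congr1 (fun f => f w) (IH ss').
Qed.

Lemma simple_int_sqint s : simple S s -> sqint P (simple_int S s T).
Proof.
move=> ss; rewrite simple_intE//; elim: s ss => [|e s IH] ss.
  by under eq_fun do rewrite big_nil; exact: sqint0.
have [oe ss'] := simple_cons ss.
under eq_fun do rewrite big_cons.
exact: sqintD (ok_sqint_inc oe) (IH ss').
Qed.

Lemma simple_ip s u v c : simple S s -> ok_step u v c ->
  \int[P]_w (simple_int S s T w * (c w * inc S u v w)) =
  \int[dtP]_z (ext (simple_val s) z * stepf u v c z).
Proof.
move=> ss uvc; rewrite ext_simple_val// simple_intE//; elim: s ss => [|e s IH] ss.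
  under eq_Rintegral do rewrite big_nil mul0r.
  under [in RHS]eq_Rintegral do rewrite big_nil mul0r.
  by rewrite /Rintegral !integral0.
have [oe ss'] := simple_cons ss.
under eq_Rintegral do rewrite big_cons mulrDl.
under [in RHS]eq_Rintegral do rewrite big_cons mulrDl.
have i1 := sqint_mulr_integrable (ok_sqint_inc oe) (ok_sqint_inc uvc).
have i2 := sqint_mulr_integrable (stepf_sqint oe) (stepf_sqint uvc).
have := simple_int_sqint ss'; rewrite simple_intE// => s3.
have i3 := sqint_mulr_integrable s3 (ok_sqint_inc uvc).
have := simple_val_sqint ss'; rewrite ext_simple_val// => s4.
have i4 := sqint_mulr_integrable s4 (stepf_sqint uvc).
by rewrite RintegralD// [in RHS]RintegralD// ito_isometry// IH.
Qed.

Lemma cvg_sqint (d' : measure_display) (X : measurableType d')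
    (mu : {measure set X -> \bar R}) (f_ : nat -> X -> R) (f : X -> R) :
  (forall n, sqint mu (f_ n)) -> measurable_fun setT f ->
  (\int[mu]_x ((f_ n x - f x) ^+ 2)%:E)%E @[n --> \oo] --> 0%E -> sqint mu f.
Proof.
move=> sf mf /fine_cvgP[fin /cvgrPdist_lt /(_ 1 ltr01) h].
have [n [/= finn _]] := filter_ex (filterI fin h).
have -> : f = f_ n \- (f_ n \- f) by apply/funext => x /=; rewrite subKr.
apply: sqintB => //; split; first by apply: measurable_funB => //; case: (sf n).
by rewrite -ge0_fin_numE//; apply: integral_ge0 => x _; rewrite lee_fin sqr_ge0.
Qed.

Lemma sqnorm_cvg (a_ : nat -> R -> Om -> R) (a : R -> Om -> R) :
  (forall n, jointly_measurable S (a_ n)) -> jointly_measurable S a ->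
  sqnorm S (fun t w => a_ n t w - a t w) @[n --> \oo] --> 0%E ->
  (\int[dtP]_z ((ext (a_ n) z - ext a z) ^+ 2)%:E)%E @[n --> \oo] --> 0%E.
Proof.
move=> ma_ ma; apply: cvg_trans; apply: near_eq_cvg; apply: nearW => n.
by rewrite sqnormE; [rewrite extB|exact: jointly_measurableB].
Qed.

Lemma ito_ip a I u v c : ito_integral S a I -> ok_step u v c ->
  sqint P (I T) /\
  \int[P]_w (I T w * (c w * inc S u v w)) =
  \int[dtP]_z (ext a z * stepf u v c z).
Proof.
move=> [L2a mI _ [s [ss sa sI]]] uvc.
have T0 : 0 <= T <= T by rewrite (ltW (T_gt0 HS)) lexx.
have mIT := mI T T0.
have sIT := cvg_sqint (fun n => simple_int_sqint (ss n)) mIT (sI T T0).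
split => //.
have [ma _] := L2a.
have sa' := sqnorm_cvg (fun n => simple_val_jm (ss n)) ma sa.
have [_ c1] := ip_cvg (fun n => (simple_int_sqint (ss n)).1) sIT
  (ok_sqint_inc uvc) (sI T T0).
have [_ c2] := ip_cvg (fun n => (simple_val_sqint (ss n)).1) (L2_ext L2a)
  (stepf_sqint uvc) sa'.
apply: (cvgn_unique c1); under eq_fun do rewrite simple_ip//.
exact: c2.
Qed.

Definition orth (D : timeT * Om -> R) := forall u v c, ok_step u v c ->
  \int[dtP]_z (stepf u v c z * D z) = 0.

(** The integrand of an Ito integral is by definition a limit of elementary ones. *)
Lemma ito_orth a I D : ito_integral S a I -> sqint dtP D -> orth D ->
  \int[dtP]_z (ext a z * D z) = 0.
Proof.
move=> [L2a mI _ [s [ss sa sI]]] sD oD; have [ma _] := L2a.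
have sa' := sqnorm_cvg (fun n => simple_val_jm (ss n)) ma sa.
have [_ c1] := ip_cvg (fun n => (simple_val_sqint (ss n)).1) (L2_ext L2a) sD sa'.
apply: (cvgn_unique c1).
suff h n : \int[dtP]_z (ext (simple_val (s n)) z * D z) = 0.
  by under eq_fun do rewrite h; exact: cvg_cst.
rewrite ext_simple_val//; elim: (s n) (ss n) => [|e l IH] sl.
  under eq_Rintegral do rewrite big_nil mul0r.
  by rewrite /Rintegral integral0.
have [oe sl'] := simple_cons sl.
under eq_Rintegral do rewrite big_cons mulrDl.
have := simple_val_sqint sl'; rewrite ext_simple_val// => s4.
rewrite RintegralD//; first by rewrite oD// IH// addr0.
- exact: sqint_mulr_integrable (stepf_sqint oe) sD.
- exact: sqint_mulr_integrable.
Qed.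

Lemma compensated_moments C : finite_mass S C ->
  sqint P (compensated S C) /\ \int[P]_w compensated S C w = 0.
Proof.
move=> fC; have [sc ec] := count_moments HS fC.
have s1 : sqint P (cst (fine (intensity S C))).
  by apply: (@sqint_bounded _ `|fine (intensity S C)|).
split; first exact: sqintB.
rewrite /compensated RintegralB//.
- by rewrite [X in X - _]ec Rintegral_prob_cst// subrr.
- exact: sqint_integrable.
- exact: sqint_integrable.
Qed.

(** If the jumps are counted from a time after u, their compensated number is
   independent of the other factors and centred; otherwise all the factors but the
   increment of B are in the enlarged past of u. *)
Lemma jump_step_orth (e : @jump_step R d Om) u v c :
  step_ok S e.1 -> measurable e.2 -> (nu S e.2 < +oo)%E -> ok_step u v c ->
  let C := `]lo e.1, hi e.1] `*` e.2 in
  sqint P (fun w => coef e.1 w * compensated S C w) /\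
  \int[P]_w (coef e.1 w * compensated S C w * (c w * inc S u v w)) = 0.
Proof.
move=> /step_okP oe mA Aoo uvc C.
have [M cM] := ok_bnd uvc; have [M' cM'] := ok_bnd oe.
have [u0 uv vT _ _] := uvc; have [l0 lh hT wce _] := oe.
have mc := ok_measurable uvc; have mce := ok_measurable oe.
have mC : measurable C by apply: measurableX.
have lC : late S (lo e.1) C.
  split; last by move=> z [/= + _]; rewrite !in_itv/= => /andP[-> /le_trans ->].
  split => //; first by move=> z [/= + _];
    rewrite !in_itv/= => /andP[/(le_lt_trans l0) -> /le_trans ->].
  rewrite /intensity product_measure1E// lte_mul_pinfty//.
  change (lebesgue_measure `]lo e.1, hi e.1]%classic \is a fin_num).
  by rewrite lebesgue_measure_itv/=; case: ifP => // _; rewrite -EFinB.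
have [fC _] := lC.
have [sN eN] := compensated_moments fC.
have s1 : sqint P (fun w => coef e.1 w * compensated S C w).
  exact: sqintM_bounded sN mce cM'.
split => //.
have [ul|lu] := leP u (lo e.1); last first.
  apply: past_orth => //; apply: wrt_enlM.
    by apply: (wrt_enl_le (ltW lu)); exact: (ok_wrt_enl oe).
  apply/wrtP; apply: measurable_funB => //; apply/wrtP => V mV.
  apply: sub_sigma_algebra; left; right; apply: sigma_prm_count => //.
  by have [_ CT _] := fC.
have lT : 0 <= lo e.1 <= T by rewrite l0 (le_trans lh).
have wpre (W : Om -> R) : wrt (filt S (lo e.1)) W -> wrt <<s pre S (lo e.1)>> W.
  move=> wW V mV; apply: (sub_sigma _ (wW V mV)) => A [[h|h]|h]; apply: sub_sigma_algebra.
  - by left; left; apply: (sigma_bm_le _ h); case/andP: lT.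
  - by left; right.
  - by right.
have mpre : <<s pre S (lo e.1)>> `<=` measurable.
  apply: smallest_sub; first exact: sigma_algebra_measurable.
  move=> A [[|]|[//]]; first exact: sigma_bm_measurable.
  by apply: sigma_prm_measurable => //; case/andP: lT.
pose U w := coef e.1 w * (c w * inc S u v w).
have sU : sqint P U.
  exact: sqintM_bounded (ok_sqint_inc uvc) mce cM'.
have wU : wrt <<s pre S (lo e.1)>> U.
  apply/wrtP; apply: measurable_funM; first by apply/wrtP; exact: wpre.
  apply: measurable_funM; apply/wrtP.
    by apply: wpre => V mV; apply: (filt_le ul); exact: (ok_wrt uvc).
  move=> V mV; apply: sub_sigma_algebra; left; left.
  by apply: (sigma_bm_le vT); exact: sigma_bm_inc.
have mcount := measurable_count HS fC.
have iN : P.-integrable setT (EFin \o ((fun x => x - fine (intensity S C)) \o count S C)).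
  exact: sqint_integrable sN.
have [_ E] := integrable_indepM mpre mcount (fun A V hA mV => indep_late HS lT lC hA mV)
  ((wrtP _ _).1 wU) (sqint_integrable sU)
  (measurable_funB (@measurable_id _ _ setT) (measurable_cst _)) iN.
transitivity (\int[P]_w (U w * (count S C w - fine (intensity S C)))).
  by apply: eq_Rintegral => w _; rewrite /U /compensated /count; ring.
by rewrite [LHS]E [X in _ * X]eN mulr0.
Qed.

Lemma jump_ip a J u v c : jump_integral S a J -> ok_step u v c ->
  sqint P (J T) /\ \int[P]_w (J T w * (c w * inc S u v w)) = 0.
Proof.
move=> [_ mJ _ [s [ss _ sJ]]] uvc.
have T0 : 0 <= T <= T by rewrite (ltW (T_gt0 HS)) lexx.
have mJT := mJ T T0.
have h n : sqint P (jump_simple_int S (s n) T) /\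
    \int[P]_w (jump_simple_int S (s n) T w * (c w * inc S u v w)) = 0.
  elim: (s n) (ss n) => [|e l IH] sl.
    rewrite /jump_simple_int; split; first by under eq_fun do rewrite big_nil; exact:
      sqint0.
    by under eq_Rintegral do rewrite big_nil mul0r; rewrite /Rintegral integral0.
  have [ok mA Aoo] := sl 0%N isT.
  have [s1 e1] := IH (fun n => sl n.+1).
  have [s2 e2] := jump_step_orth ok mA Aoo uvc.
  have E w : jump_simple_int S (e :: l) T w =
      coef e.1 w * compensated S (`]lo e.1, hi e.1] `*` e.2) w +
      jump_simple_int S l T w.
    rewrite /jump_simple_int big_cons; case: (ok) => _ lh hT _ _.
    by rewrite !min_l// (le_trans lh).
  split; first by rewrite (funext E); exact: sqintD.
  under eq_Rintegral do rewrite E mulrDl.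
  rewrite RintegralD//; first by rewrite e1 e2 addr0.
  - exact: sqint_mulr_integrable s2 (ok_sqint_inc uvc).
  - exact: sqint_mulr_integrable s1 (ok_sqint_inc uvc).
have sJT := cvg_sqint (fun n => (h n).1) mJT (sJ T T0).
split => //.
have [_ c1] := ip_cvg (fun n => (h n).1.1) sJT (ok_sqint_inc uvc) (sJ T T0).
apply: (cvgn_unique c1); under eq_fun do rewrite (h _).2.
exact: cvg_cst.
Qed.

End stochastic_integrals.

(** * Integration over time *)

Section sigma_finite_product.
Context {R : realType} d1 d2 (T1 : measurableType d1) (T2 : measurableType d2).
Variables (m1 : {sigma_finite_measure set T1 -> \bar R})
  (m2 : {sigma_finite_measure set T2 -> \bar R}).

(** An alias of the product measure to which the structure of sigma-finite measure can
   be attached, for the sake of further products. *)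
Definition sfprod : set (T1 * T2) -> \bar R := (m1 \x m2)%E.

HB.instance Definition _ := Measure.copy sfprod (m1 \x m2)%E.

Let sfprod_sigma_finite : sigma_finite setT sfprod.
Proof.
have /sigma_finiteP[F [TF ndF Foo]] := sigma_finiteT m1.
have /sigma_finiteP[G [TG ndG Goo]] := sigma_finiteT m2.
exists (fun n => F n `*` G n).
  rewrite -setXTT TF TG; apply/seteqP; split => -[x y] /=.
    move=> [[n _ Fnx] [k _ Gky]]; exists (maxn n k) => //; split => /=.
      by move: Fnx; apply/subsetPset/ndF/leq_maxl.
    by move: Gky; apply/subsetPset/ndG/leq_maxr.
  by move=> [n _ [/= ? ?]]; split; exists n.
move=> k; have [? ?] := Foo k; have [? ?] := Goo k.
split; first exact: measurableX.
by rewrite /sfprod product_measure1E// lte_mul_pinfty// ge0_fin_numE.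
Qed.

HB.instance Definition _ := Measure_isSigmaFinite.Build _ _ _ sfprod
  sfprod_sigma_finite.

End sigma_finite_product.

Lemma ae_eq_Rintegral {R : realType} d (X : measurableType d)
    (mu : {measure set X -> \bar R}) (f g : X -> R) :
  measurable_fun setT f -> measurable_fun setT g ->
  {ae mu, forall x, f x = g x} -> \int[mu]_x f x = \int[mu]_x g x.
Proof.
move=> mf mg fg; rewrite /Rintegral; congr fine; apply: ae_eq_integral => //.
- exact/measurable_EFinP.
- exact/measurable_EFinP.
- by apply: filterS fg => x fgx _ /=; rewrite fgx.
Qed.

Section time_integral.
Context {R : realType} d (X : measurableType d)
  (mu : {sigma_finite_measure set X -> \bar R}) (T : R).
Local Notation timeT := (measurableTypeR R).
Local Notation leb := (@lebesgue_measure R).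
Variable F : timeT * X -> R.
Hypotheses (T0 : 0 < T) (sF : sqint (leb \x mu)%E F).
Hypothesis F0 : forall s x, ~~ (0 <= s <= T) -> F (s, x) = 0.

Lemma sqint_itv a b : sqint leb (\1_(`[a, b] : set R) : timeT -> R).
Proof.
split; first by [].
under eq_integral => s _ do rewrite indicE -natrX -mulnn mulnb andbb -indicE.
rewrite integral_indic//= setIT lebesgue_measure_itv/=.
by case: ifP => _; rewrite -?EFinB ltry.
Qed.

Let F1 s x : F (s, x) = F (s, x) * \1_(`[0, T] : set R) s.
Proof.
rewrite indicE; case: (boolP (0 <= s <= T)) => sT; last by rewrite F0// mul0r.
by rewrite mem_set ?mulr1//= in_itv.
Qed.

Lemma measurable_time_integral :
  measurable_fun setT (fun x => \int[leb]_s F (s, x)).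
Proof.
have [/measurable_EFinP mF _] := sF.
apply: measurableT_comp => //.
rewrite (_ : (fun _ => _) = (fun x => (\int[leb]_s (EFin \o F)^\+ (s, x) -
    \int[leb]_s (EFin \o F)^\- (s, x))%E)).
  apply: emeasurable_funB.
    apply: (measurable_fun_fubini_tonelli_G ((EFin \o F)^\+)%E) => //.
    exact: measurable_funepos.
  apply: (measurable_fun_fubini_tonelli_G ((EFin \o F)^\-)%E) => //.
  exact: measurable_funeneg.
apply/funext => x; rewrite [LHS]integralE.
by congr (_ - _)%E; apply: eq_integral => s _; rewrite ?funeposE ?funenegE.
Qed.

(** Cauchy-Schwarz on [0, T], from the integral of (F - c)^2, where c is the mean of F *)
Lemma time_integral_sqr_le x :
  (((\int[leb]_s F (s, x)) ^+ 2)%:E <= T%:E * \int[leb]_s ((F (s, x)) ^+ 2)%:E)%E.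
Proof.
have [mF _] := sF.
have mFx : measurable_fun setT (fun s => F (s, x)) by exact: measurableT_comp mF _.
have [] := ltP (\int[leb]_s ((F (s, x)) ^+ 2)%:E)%E +oo%E; last first.
  by rewrite leye_eq => /eqP ->; rewrite gt0_muley ?lte_fin// leey.
move=> Fxoo; have sFx : sqint leb (fun s => F (s, x)) by [].
have s1 := sqint_itv 0 T.
set I := \int[leb]_s F (s, x).
have e1 : \int[leb]_s (F (s, x) * \1_(`[0, T] : set R) s) = I.
  by apply: eq_Rintegral => s _; rewrite -F1.
have e2 : \int[leb]_s (\1_(`[0, T] : set R) s * \1_(`[0, T] : set R) s) = T.
  under eq_Rintegral => s _ do rewrite indicE -natrM mulnb andbb -indicE.
  rewrite /Rintegral integral_indic//= setIT lebesgue_measure_itv/= lte_fin T0.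
  by rewrite -EFinB subr0.
pose c := I / T.
have i1 := sqint_mulr_integrable sFx sFx.
have i2 := sqint_mulr_integrable sFx s1.
have i3 := sqint_mulr_integrable s1 s1.
have : 0 <= \int[leb]_s (F (s, x) * F (s, x) - 2 * c * (F (s, x) * \1_(`[0, T] : set R) s)
   + c ^+ 2 * (\1_(`[0, T] : set R) s * \1_(`[0, T] : set R) s)).
  apply: Rintegral_ge0 => s _.
  rewrite [leRHS](_ : _ = (F (s, x) - c * \1_(`[0, T] : set R) s) ^+ 2) ?sqr_ge0//.
  by ring.
rewrite RintegralD//; last 2 first.
- by apply: integrableRB => //; exact: integrableRZ.
- exact: integrableRZ.
rewrite RintegralB//; last exact: integrableRZ.
rewrite !RintegralZl// e1 e2 => h.
have -> : (\int[leb]_s ((F (s, x)) ^+ 2)%:E)%E = (\int[leb]_s (F (s, x) * F (s, x)))%:E.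
  rewrite /Rintegral fineK.
    by apply: eq_integral => s _; rewrite expr2.
  exact: integrable_fin_num.
rewrite -EFinM lee_fin -subr_ge0.
have -> : T * \int[leb]_s (F (s, x) * F (s, x)) - I ^+ 2 =
  T * (\int[leb]_s (F (s, x) * F (s, x)) - 2 * c * I + c ^+ 2 * T).
  by rewrite /c; field; rewrite gt_eqF.
by rewrite mulr_ge0// ltW.
Qed.

Lemma time_integral_sqint : sqint mu (fun x => \int[leb]_s F (s, x)).
Proof.
have [mF Foo] := sF.
have mF2 : measurable_fun setT (fun z => ((F z) ^+ 2)%:E).
  by apply/measurable_EFinP; apply: measurable_funX.
have F20 z : (0 <= ((F z) ^+ 2)%:E)%E by rewrite lee_fin sqr_ge0.
split; first exact: measurable_time_integral.
apply: (@le_lt_trans _ _ (\int[mu]_x (T%:E * \int[leb]_s ((F (s, x)) ^+ 2)%:E))%E).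
  apply: ge0_le_integral => //.
  - by move=> x _; rewrite lee_fin sqr_ge0.
  - by apply/measurable_EFinP/measurable_funX; exact: measurable_time_integral.
  - apply: measurable_funeM.
    exact: (measurable_fun_fubini_tonelli_G (fun z => ((F z) ^+ 2)%:E)).
  - by move=> x _; exact: time_integral_sqr_le.
rewrite ge0_integralZl//; last 3 first.
- exact: (measurable_fun_fubini_tonelli_G (fun z => ((F z) ^+ 2)%:E)).
- by move=> x _; exact: integral_ge0.
- by rewrite lee_fin ltW.
rewrite -[X in (_ * X)%E](fubini_tonelli2 (fun z => ((F z) ^+ 2)%:E))//.
by rewrite lte_mul_pinfty// ?lee_fin 1?ltW.
Qed.

Lemma sqint_time_prod (g : X -> R) : sqint mu g ->
  sqint (leb \x mu)%E (fun z => \1_(`[0, T] : set R) z.1 * g z.2).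
Proof.
move=> [mg goo].
have mh : measurable_fun setT (fun z : timeT * X => \1_(`[0, T] : set R) z.1 * g z.2).
  apply: measurable_funM; last exact: measurableT_comp.
  exact: (measurableT_comp (measurable_indic (measurable_itv `[0, T]))).
split => //.
rewrite (fubini_tonelli2 (fun z : timeT * X => ((\1_(`[0, T] :
  set R) z.1 * g z.2) ^+ 2)%:E))//; last 2 first.
- by apply/measurable_EFinP/measurable_funX.
- by move=> z; rewrite lee_fin sqr_ge0.
rewrite /fubini_G (eq_integral (fun x => T%:E * ((g x) ^+ 2)%:E)%E).
  rewrite ge0_integralZl//; last 3 first.
  - by apply/measurable_EFinP/measurable_funX.
  - by move=> x _; rewrite lee_fin sqr_ge0.
  - by rewrite lee_fin ltW.
  by rewrite lte_mul_pinfty// ?lee_fin 1?ltW.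
move=> x _ /=.
under eq_integral => s _ do rewrite exprMn indicE -natrX -mulnn mulnb andbb -indicE EFinM.
rewrite ge0_integralZr//; last 2 first.
- by apply/measurable_EFinP.
- by rewrite lee_fin sqr_ge0.
rewrite integral_indic//= setIT lebesgue_measure_itv/= lte_fin T0.
by rewrite -EFinB subr0.
Qed.

Lemma ae_sqint_section : {ae mu, forall x, sqint leb (fun s => F (s, x))}.
Proof.
have [mF Foo] := sF.
have mF2 : measurable_fun setT (fun z => ((F z) ^+ 2)%:E).
  by apply/measurable_EFinP; apply: measurable_funX.
have F20 z : (0 <= ((F z) ^+ 2)%:E)%E by rewrite lee_fin sqr_ge0.
have ifin : mu.-integrable setT (fun x => \int[leb]_s ((F (s, x)) ^+ 2)%:E)%E.
  apply/integrableP; split.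
    exact: (measurable_fun_fubini_tonelli_G (fun z => ((F z) ^+ 2)%:E)).
  rewrite (eq_integral (fun x => \int[leb]_s ((F (s, x)) ^+ 2)%:E)%E).
    by rewrite -(fubini_tonelli2 (fun z => ((F z) ^+ 2)%:E)).
  by move=> x _; rewrite gee0_abs// integral_ge0.
apply: filterS (integrable_ae measurableT ifin) => x /(_ I) xfin; split.
  exact: measurableT_comp mF _.
by rewrite -ge0_fin_numE// integral_ge0.
Qed.

Lemma integrable_time_mul (g : X -> R) : sqint mu g ->
  (leb \x mu)%E.-integrable setT (EFin \o (fun z => F z * g z.2)).
Proof.
move=> sg; have i := sqint_mulr_integrable sF (sqint_time_prod sg).
by apply: eq_integrable i => // -[s x] _ /=; rewrite mulrA -F1.
Qed.

Lemma time_integral_prod (g : X -> R) : sqint mu g ->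
  \int[mu]_x (\int[leb]_s F (s, x) * g x) = \int[(leb \x mu)%E]_z (F z * g z.2).
Proof.
move=> sg; have i := integrable_time_mul sg; rewrite (Rfubini2 i).
have /integrableP[/measurable_EFinP mi2 _] := Rfubini2_integrable i.
apply: ae_eq_Rintegral => //.
  by apply: measurable_funM; [exact: measurable_time_integral|have [] := sg].
apply: filterS ae_sqint_section => x sx.
rewrite /= [RHS]RintegralZr//.
by apply: eq_integrable (sqint_mulr_integrable sx (sqint_itv 0 T)) => // s _ /=;
  rewrite -F1.
Qed.

Lemma time_integral_ip (g : X -> R) : sqint mu g ->
  \int[mu]_x (\int[leb]_s F (s, x) * g x) = \int[leb]_s \int[mu]_x (F (s, x) * g x).
Proof.
by move=> sg; rewrite time_integral_prod// (Rfubini1 (integrable_time_mul sg)).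
Qed.

End time_integral.

Section translation.
Context {R : realType} (a : R).
Local Notation timeT := (measurableTypeR R).
Local Notation leb := (@lebesgue_measure R).

Let sh : timeT -> timeT := fun x => (x : R) + a.
Let msh : measurable_fun setT sh.
Proof. by apply: measurable_funD => //; exact: measurable_id. Qed.
HB.instance Definition _ := isMeasurableFun.Build _ _ _ _ sh msh.

Lemma lebesgue_shift A : measurable A -> leb (sh @^-1` A) = leb A.
Proof.
move=> mA; apply/esym.
have h X : ocitv X -> @lebesgue_measure R X = pushforward leb sh X.
  move=> [[x y] _ <-] /=; rewrite /pushforward.
  rewrite (_ : sh @^-1` _ = `]x - a, y - a]%classic); last first.
    by apply/seteqP; split => z /=; rewrite !in_itv/= ltrBlDr lerBrDr.
  rewrite !lebesgue_measure_itv/= !lte_fin ltrD2r; case: ifP => // _.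
  by rewrite -!EFinB; congr EFin; ring.
exact: (lebesgue_measure_unique h mA).
Qed.

Lemma ge0_integral_shift (f : R -> \bar R) :
  measurable_fun setT (f : timeT -> \bar R) -> (forall x, 0 <= f x)%E ->
  (\int[leb]_x f (x + a)%R = \int[leb]_x f x)%E.
Proof.
move=> mf f0; have := ge0_integral_pushforward msh leb measurableT mf (fun y _ => f0 y).
rewrite preimage_setT => <-; apply: eq_measure_integral => A mA _.
exact: lebesgue_shift.
Qed.

Lemma Rintegral_shift (f : R -> R) :
  measurable_fun setT (f : timeT -> R) ->
  \int[leb]_x f (x + a) = \int[leb]_x f x.
Proof.
move=> /measurable_EFinP mf; rewrite /Rintegral; congr fine.
rewrite [LHS]integralE [RHS]integralE; congr (_ - _)%E.
- have e := ge0_integral_shift (measurable_funepos mf) (fun x => funepos_ge0 _ x).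
  by etransitivity; [|etransitivity; [exact: e|]]; apply: eq_integral => x _;
    rewrite !funeposE.
- have e := ge0_integral_shift (measurable_funeneg mf) (fun x => funeneg_ge0 _ x).
  by etransitivity; [|etransitivity; [exact: e|]]; apply: eq_integral => x _;
    rewrite !funenegE.
Qed.

Lemma ae_shift (Q : R -> Prop) : {ae leb, forall s, Q s} ->
  {ae leb, forall s, Q (s + a)}.
Proof.
move=> [N [mN N0 QN]]; exists (sh @^-1` N); split.
- by rewrite -[_ @^-1` _]setTI; exact: msh.
- by rewrite -N0; exact: lebesgue_shift.
- by move=> s /= nQ; apply: QN.
Qed.

End translation.

(** * Conditional expectations of square integrable variables *)

Section conditional_expectation.
Context {R : realType} d (Om : measurableType d) (S : noise R Om).
Local Notation P := (prob S).
Variable G : set (set Om).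
Hypothesis mG : G `<=` measurable.
Local Notation timeT := (measurableTypeR R).
Local Notation leb := (@lebesgue_measure R).

Lemma wrt_measurable (U : Om -> R) : wrt G U -> measurable_fun setT U.
Proof. by move=> wU _ V mV; rewrite setTI; apply: mG; exact: wU. Qed.

Lemma layer_cake (x : R) : 0 <= x ->
  (\int[leb]_t (\1_(`[0, x[ : set R) t)%:E)%E = x%:E.
Proof.
move=> x0; rewrite integral_indic//= setIT lebesgue_measure_itv/= lte_fin.
move: x0; rewrite le_eqVlt => /predU1P[<-|->]; first by rewrite ltxx.
by rewrite -EFinB subr0.
Qed.

(** U is the integral over t >= 0 of the indicators of the events U > t, so that the
   expectation of Z U is an integral of expectations of Z on events of G. *)
Lemma orth_events_ge0 (Z U : Om -> R) : P.-integrable setT (EFin \o Z) ->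
  (forall A, G A -> \int[P]_w (Z w * \1_A w) = 0) ->
  wrt G U -> (forall w, 0 <= U w) ->
  P.-integrable setT (EFin \o (fun w => Z w * U w)) ->
  \int[P]_w (Z w * U w) = 0.
Proof.
move=> iZ oZ wU U0 iZU; have mU := wrt_measurable wU.
have /integrableP[/measurable_EFinP mZ _] := iZ.
pose D : set (Om * timeT) := [set z | (0 <= z.2) && (z.2 < U z.1)].
have mD : measurable D.
  rewrite -[D]setTI.
  apply: (measurable_and (f := fun z : Om * timeT => 0 <= z.2)
    (g := fun z : Om * timeT => z.2 < U z.1)) => //.
  - apply: measurable_fun_ler; first exact: measurable_cst.
    exact: measurable_snd.
  - apply: measurable_fun_ltr; first exact: measurable_snd.
    exact: measurableT_comp.
have DE w t : \1_D (w, t) = \1_(`[0, U w[ : set R) t :> R.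
  by rewrite !indicE; congr (_%:R); apply/idP/idP; rewrite !inE /= in_itv.
pose F (z : Om * timeT) := Z z.1 * \1_D z.
have mF : measurable_fun setT F.
  by apply: measurable_funM => //; exact: measurableT_comp.
have iF : (P \x leb)%E.-integrable setT (EFin \o F).
  apply/integrable12ltyP; first exact/measurable_EFinP.
  rewrite (eq_integral (fun w => `|(Z w * U w)%:E|)%E).
    by have /integrableP[] := iZU.
  move=> w _ /=; rewrite (eq_integral (fun t : timeT => `|Z w|%:E * (\1_(`[0, U w[ :
    set R) t)%:E)%E).
    by rewrite ge0_integralZl// ?layer_cake// /= ?normrM ?(ger0_norm (U0 w))//;
      exact/measurable_EFinP.
  by move=> t _; rewrite /F /= DE normrM (ger0_norm (x := \1__ _))// EFinM.
have := Rfubini1 iF; rewrite Rfubini2//.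
have -> : \int[leb]_t \int[P]_w F (w, t) = 0.
  rewrite /Rintegral integral0_eq// => t _; congr EFin.
  have [t0|t0] := leP 0 t; last first.
    rewrite integral0_eq// => w _; rewrite /F /= indicE memNset ?mulr0//.
    by rewrite /D /= => /andP[]; rewrite leNgt t0.
  rewrite -[RHS](oZ (U @^-1` `]t, +oo[)); last first.
    by apply: wU; exact: measurable_itv.
  apply: eq_Rintegral => w _; rewrite /F /=; congr (_ * _); rewrite !indicE.
  suff -> : ((w, t) \in D) = (w \in U @^-1` `]t, +oo[) by [].
  by apply/idP/idP; rewrite !inE /D /= in_itv/= andbT ?t0.
move=> ->; apply: eq_Rintegral => w _; rewrite /F /=.
under eq_Rintegral do rewrite DE.
rewrite RintegralZl//; first by rewrite /Rintegral layer_cake.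
by apply: integrable_indic_itv.
Qed.

Lemma wrt_comp (f : R -> R) (U : Om -> R) :
  measurable_fun setT (f : measurableTypeR R -> R) -> wrt G U -> wrt G (f \o U).
Proof.
move=> mf wU V mV; rewrite comp_preimage; apply: wU.
by rewrite -[_ @^-1` _]setTI; exact: mf.
Qed.

Lemma orth_events (Z U : Om -> R) : P.-integrable setT (EFin \o Z) ->
  (forall A, G A -> \int[P]_w (Z w * \1_A w) = 0) ->
  wrt G U -> P.-integrable setT (EFin \o (fun w => Z w * U w)) ->
  \int[P]_w (Z w * U w) = 0.
Proof.
move=> iZ oZ wU iZU; have mU := wrt_measurable wU.
have /integrableP[/measurable_EFinP mZ _] := iZ.
pose p x : R := Num.max x 0; pose n x : R := Num.max (- x) 0.
have mp : measurable_fun setT (p : measurableTypeR R -> R).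
  by apply: measurable_maxr => //; exact: measurable_id.
have mn : measurable_fun setT (n : measurableTypeR R -> R).
  by apply: measurable_maxr => //; apply: measurable_funN; exact: measurable_id.
have i (f : R -> R) : measurable_fun setT (f : measurableTypeR R -> R) ->
    (forall x, `|f x| <= `|x|) -> P.-integrable setT (EFin \o (fun w => Z w * f (U w))).
  move=> mf fx; apply: (@integrable_le _ _ _ P _ (fun w => `|Z w * U w|)).
  - by apply: measurable_funM => //; exact: measurableT_comp.
  - by have := integrable_norm iZU.
  - by move=> w; rewrite !normrM ler_wpM2l.
have pn x : x = p x - n x by rewrite /p /n; case: (leP x 0); case: (leP (- x) 0); lra.
have px x : `|p x| <= `|x| by rewrite /p ger0_norm ?le_max ?lexx ?orbT//
  ge_max ler_norm normr_ge0.
have nx x : `|n x| <= `|x|.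
  by rewrite /n ger0_norm ?le_max ?lexx ?orbT// ge_max normr_ge0 -normrN ler_norm.
transitivity (\int[P]_w (Z w * p (U w)) - \int[P]_w (Z w * n (U w))).
  rewrite -RintegralB; [|by []|exact: i|exact: i].
  by apply: eq_Rintegral => w _; rewrite {1}(pn (U w)) mulrBr.
rewrite (@orth_events_ge0 Z (p \o U))//.
- rewrite (@orth_events_ge0 Z (n \o U)) ?subrr//.
  + exact: wrt_comp.
  + by move=> w; rewrite /n /= le_max lexx orbT.
  + exact: i.
- exact: wrt_comp.
- by move=> w; rewrite /p /= le_max lexx orbT.
- exact: i.
Qed.

Lemma cond_exp_mul (X Y U : Om -> R) : cond_exp S G X Y -> wrt G U ->
  P.-integrable setT (EFin \o (fun w => X w * U w)) ->
  P.-integrable setT (EFin \o (fun w => Y w * U w)) ->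
  \int[P]_w (Y w * U w) = \int[P]_w (X w * U w).
Proof.
move=> [iX iY wY XY] wU iXU iYU.
apply/eqP; rewrite -subr_eq0 -RintegralB//.
under eq_Rintegral do rewrite -mulrBl.
apply/eqP; apply: (orth_events (Z := Y \- X)) => //.
- exact: integrableRB.
- move=> A GA; have mA := mG GA.
  under eq_Rintegral do rewrite /= mulrBl.
  have i1 (f : Om -> R) : P.-integrable setT (EFin \o f) ->
      P.-integrable setT (EFin \o (fun w => f w * \1_A w)).
    move=> fi; have /integrableP[/measurable_EFinP mf _] := fi.
    apply: (@integrable_le _ _ _ P _ (fun w => `|f w|)).
    - by apply: measurable_funM.
    - by have := integrable_norm fi.
    - by move=> w; rewrite normrM indicE ler_piMr// normr_nat (ler_nat _ _ 1) leq_b1.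
  have e1 (f : Om -> R) : (\int[P]_(w in A) (f w)%:E = \int[P]_w (f w * \1_A w)%:E)%E.
    rewrite integral_mkcond; apply: eq_integral => w _.
    by rewrite patchE indicE; case: ifP => _; rewrite ?mulr1 ?mulr0.
  rewrite RintegralB//; [|exact: i1|exact: i1].
  by rewrite /Rintegral -!e1 XY// subrr.
- by apply: eq_integrable (integrableRB iYU iXU) => // w _ /=; rewrite mulrBl.
Qed.

Definition clip (K y : R) : R := Num.max (- K) (Num.min K y).

Lemma clip_bounded K y : 0 <= K -> `|clip K y| <= K.
Proof.
move=> K0; rewrite /clip ler_norml; case: (leP K y) => ?.
  by case: (leP (- K) K) => ?; apply/andP; split; lra.
by case: (leP (- K) y) => ?; apply/andP; split; lra.
Qed.

Lemma clip_id K y : `|y| <= K -> clip K y = y.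
Proof.
rewrite /clip ler_norml => /andP[? ?]; case: (leP K y) => ?.
  by case: (leP (- K) K) => ?; lra.
by case: (leP (- K) y) => ?; lra.
Qed.

Lemma normr_clip K y : 0 <= K -> `|clip K y| = Num.min K `|y|.
Proof.
move=> K0; have [yK|/ltW Ky] := leP `|y| K; first by rewrite clip_id.
move: Ky; rewrite /clip ler_normr => /orP[] h.
  by rewrite min_l// max_r ?ger0_norm//; lra.
by rewrite max_l ?normrN ?ger0_norm// ge_min; apply/orP; right; lra.
Qed.

(** The variational inequality of the projection onto the convex set [- K, K] *)
Lemma clip_projection K y q : `|q| <= K -> 0 <= (y - clip K y) * (clip K y - q).
Proof.
rewrite /clip ler_norml => /andP[? ?]; case: (leP K y) => ?.
  by case: (leP (- K) K) => ?; nra.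
by case: (leP (- K) y) => ?; nra.
Qed.

Lemma measurable_clip K : measurable_fun setT (clip K : measurableTypeR R -> R).
Proof.
apply: measurable_maxr; first exact: measurable_cst.
by apply: measurable_minr; [exact: measurable_cst|exact: measurable_id].
Qed.

(** Testing with the truncation U_n of Y gives
   E[U_n^2] <= E[Y U_n] = E[X U_n] <= (E[X^2] + E[U_n^2]) / 2. *)
Lemma cond_exp_sqint (X Y : Om -> R) : cond_exp S G X Y -> sqint P X ->
  sqint P Y /\ \int[P]_w (Y w) ^+ 2 <= \int[P]_w (X w) ^+ 2.
Proof.
move=> XY sX; have [_ iY wY _] := XY.
have mY := wrt_measurable wY; have [mX Xoo] := sX.
have /sqintP[_ X2i] := sX.
pose U n w := clip n%:R (Y w).
have mU n : measurable_fun setT (U n).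
  exact: (measurableT_comp (measurable_clip n%:R) mY).
have UM n w : `|U n w| <= n%:R by exact: clip_bounded.
have sU n : sqint P (U n).
  exact: (@sqint_bounded _ _ _ S _ _ (mU n) (UM n)).
have wU n : wrt G (U n) by apply: (wrt_comp (measurable_clip n%:R)).
have UY n w : U n w ^+ 2 <= Y w * U n w.
  have := @clip_projection n%:R (Y w) 0; rewrite normr0 ler0n subr0 => /(_ isT).
  by rewrite mulrBl subr_ge0.
have iYU n : P.-integrable setT (EFin \o (fun w => Y w * U n w)).
  apply: (@integrable_le _ _ _ P _ (fun w => n%:R * `|Y w|)).
  - exact: measurable_funM.
  - by apply: integrableRZ; have := integrable_norm iY.
  - by move=> w; rewrite normrM mulrC ler_wpM2r.
have iXU n := sqint_mulr_integrable sX (sU n).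
have le n : (\int[P]_w ((U n w) ^+ 2)%:E <= \int[P]_w ((X w) ^+ 2)%:E)%E.
  have /sqintP[_ U2i] := sU n.
  have h : \int[P]_w (U n w) ^+ 2 <= \int[P]_w (X w * U n w).
    by rewrite -(cond_exp_mul XY (wU n) (iXU n) (iYU n)); apply: le_Rintegral.
  have h2 : \int[P]_w (X w * U n w) <=
      2^-1 * \int[P]_w (X w) ^+ 2 + 2^-1 * \int[P]_w (U n w) ^+ 2.
    rewrite -!RintegralZl// -RintegralD//; [|exact: integrableRZ|exact: integrableRZ].
    apply: le_Rintegral => //; first by apply: integrableRD; exact: integrableRZ.
    by move=> w _; have := sqr_ge0 (X w - U n w); rewrite sqrrB; lra.
  rewrite -(fineK (integrable_fin_num measurableT U2i)).
  rewrite -(fineK (integrable_fin_num measurableT X2i)) lee_fin.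
  by move: h h2; rewrite /Rintegral; lra.
have nd w : nondecreasing_seq (fun n => ((U n w) ^+ 2)%:E).
  move=> n m nm; rewrite lee_fin -2!(real_normK (num_real (U _ w))).
  rewrite ler_sqr ?nnegrE// /U !normr_clip// le_min ge_min ler_nat nm /=.
  by rewrite ge_min lexx orbT.
have lim : (\int[P]_w ((Y w) ^+ 2)%:E <= \int[P]_w ((X w) ^+ 2)%:E)%E.
  have -> : (\int[P]_w ((Y w) ^+ 2)%:E =
      \int[P]_w (limn (fun n => ((U n w) ^+ 2)%:E)))%E.
    apply: eq_integral => w _; apply/esym/cvg_lim => //.
    apply: cvg_near_cst; exists (Num.truncn `|Y w|).+1 => // n /= hn.
    by rewrite /U clip_id// ltW// (lt_le_trans (truncnS_gt _))// ler_nat.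
  have mU2 n : measurable_fun setT (fun w => ((U n w) ^+ 2)%:E).
    by apply/measurable_EFinP/measurable_funX.
  have U20 n w : setT w -> (0 <= ((U n w) ^+ 2)%:E)%E by rewrite lee_fin sqr_ge0.
  rewrite (monotone_convergence P measurableT mU2 U20 (fun w _ => nd w)).
  apply: lime_le; last by apply: nearW => n; exact: le.
  exact: (cvgP _ (cvg_monotone_convergence measurableT mU2 U20 (fun w _ => nd w))).
have sY : sqint P Y by split => //; exact: le_lt_trans Xoo.
split => //; rewrite -lee_fin /Rintegral !fineK//.
  by apply: integrable_fin_num => //; have /sqintP[] := sX.
by apply: integrable_fin_num => //; have /sqintP[] := sY.
Qed.

End conditional_expectation.

(** * The Malliavin derivative *)

Lemma ae_le_Rintegral {R : realType} d (X : measurableType d)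
    (mu : {measure set X -> \bar R}) (f g : X -> R) :
  mu.-integrable setT (EFin \o f) -> mu.-integrable setT (EFin \o g) ->
  {ae mu, forall x, f x <= g x} -> \int[mu]_x f x <= \int[mu]_x g x.
Proof.
move=> fi gi fg; rewrite -subr_ge0 -RintegralB//.
have /integrableP[/measurable_EFinP md _] := integrableRB gi fi.
rewrite (ae_eq_Rintegral (g := (fun x => Num.max (g x - f x) 0)))//.
- by apply: Rintegral_ge0 => x _; rewrite le_max lexx orbT.
- by apply: measurable_maxr.
- by apply: filterS fg => x fgx; rewrite max_l// subr_ge0.
Qed.

Lemma ae_pick {R : realType} (Q : R -> Prop) (x y : R) : x < y ->
  {ae (@lebesgue_measure R), forall t, Q t} -> exists2 r, x < r < y & Q r.
Proof.
move=> xy [N [mN N0 QN]]; apply: contrapT => nQ.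
have sub : `]x, y[%classic `<=` N.
  move=> r /=; rewrite in_itv/= => xry; apply: QN => Qr.
  by apply: nQ; exists r.
have e : lebesgue_measure `]x, y[%classic = (y - x)%:E.
  by rewrite lebesgue_measure_itv/= lte_fin xy EFinB.
have := le_measure (@lebesgue_measure R) (mem_set (measurable_itv `]x, y[))
  (mem_set mN) sub.
rewrite [leRHS]N0 [leLHS]e lee_fin subr_le0.
by rewrite leNgt xy.
Qed.

Lemma ae_lebW {R : realType} (Q1 Q2 : R -> Prop) : (forall t, Q1 t -> Q2 t) ->
  {ae (@lebesgue_measure R), forall t, Q1 t} ->
  {ae (@lebesgue_measure R), forall t, Q2 t}.
Proof.
by move=> h; apply: filterS => //; exact: (ae_filter_ringOfSetsType
  (@lebesgue_measure R)).
Qed.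

Lemma ae_lebW3 {R : realType} (Q1 Q2 Q3 Q : R -> Prop) :
  (forall t, Q1 t -> Q2 t -> Q3 t -> Q t) ->
  {ae (@lebesgue_measure R), forall t, Q1 t} ->
  {ae (@lebesgue_measure R), forall t, Q2 t} ->
  {ae (@lebesgue_measure R), forall t, Q3 t} ->
  {ae (@lebesgue_measure R), forall t, Q t}.
Proof.
by move=> h; apply: filterS3 => //; exact: (ae_filter_ringOfSetsType
  (@lebesgue_measure R)).
Qed.

(* The final estimate of free_orth: the three terms come from the two ends of the
   interval and from its middle. *)
Lemma gap_bound {R : realType} (e h k x y p q j1 j2 j3 z1 z2 z3 : R) :
  0 < e -> 0 <= h -> h <= e ^+ 2 -> 0 <= x -> x <= h -> 0 <= y -> y <= h ->
  0 <= p -> q <= k ->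
  j1 <= x * k / (2 * e) + e / 2 * z1 -> j2 <= h / e * (q - p) + e / 2 * z2 ->
  j3 <= y * k / (2 * e) + e / 2 * z3 -> 0 <= k ->
  0 <= z1 -> 0 <= z2 -> 0 <= z3 -> j1 + j2 + j3 <= e * (2 * k + (z1 + z2 + z3)).
Proof.
move=> e0 h0 he x0 xh y0 yh p0 qk l1 l2 l3 k0 z10 z20 z30.
have small u : u <= h -> u / e <= e.
  by move=> uh; rewrite ler_pdivrMr// -expr2 (le_trans uh).
have b u : u <= h -> u * k / (2 * e) <= e / 2 * k.
  move=> uh; rewrite [leLHS](_ : _ = u / e * (k / 2)); last by field; rewrite gt_eqF.
  by rewrite [leRHS](_ : _ = e * (k / 2)); [apply: ler_wpM2r; [lra|exact: small]|ring].
have b2 : h / e * (q - p) <= e * k.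
  apply: le_trans (_ : h / e * k <= _).
    by apply: ler_wpM2l; [rewrite divr_ge0// ltW|lra].
  by apply: ler_wpM2r => //; exact: small.
have c z : 0 <= z -> e / 2 * z <= e * z.
  by move=> z0; apply: ler_wpM2r => //; lra.
have := b _ xh; have := b _ yh; have := c _ z10; have := c _ z20; have := c _ z30.
have ek : e / 2 * k = e * k / 2 by ring.
rewrite !mulrDr ek; move: b2; rewrite mulrCA -/(2 * (e * k)).
move: l1 l2 l3.
move: (x * k / (2 * e)) (y * k / (2 * e)) (h / e * (q - p)) (e / 2 * z1) (e / 2 * z2)
  (e / 2 * z3) (e * k) (e * z1) (e * z2) (e * z3).
by clear => *; lra.
Qed.

Section cylindrical_functionals.
Context {R : realType} d (Om : measurableType d) (S : noise R Om).
Hypothesis HS : driving_noise S.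
Local Notation T := (hor S).
Local Notation P := (prob S).
Local Notation B := (bm S).
Local Notation timeT := (measurableTypeR R).
Local Notation leb := (@lebesgue_measure R).

Lemma almost_all_timesP Q : almost_all_times S Q ->
  {ae leb, forall t, 0 <= t <= T -> Q t}.
Proof. by []. Qed.

Lemma dtP_tonelli (f : timeT * Om -> R) : measurable_fun setT f ->
  (\int[dtP S]_z ((f z) ^+ 2)%:E = \int[leb]_t \int[P]_w ((f (t, w)) ^+ 2)%:E)%E.
Proof.
move=> mf; apply: (fubini_tonelli1 (fun z => ((f z) ^+ 2)%:E)).
  by apply/measurable_EFinP/measurable_funX.
by move=> z; rewrite lee_fin sqr_ge0.
Qed.

Lemma dtP_fubini f : (dtP S).-integrable setT (EFin \o f) ->
  leb.-integrable setT (EFin \o (fun t => \int[P]_w f (t, w))) /\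
  \int[dtP S]_z f z = \int[leb]_t \int[P]_w f (t, w).
Proof. by move=> fi; split; [exact: Rfubini1_integrable|exact: Rfubini1]. Qed.

Lemma Rintegral_step a b k : a <= b ->
  \int[leb]_t (k * \1_(`]a, b] : set R) t) = (b - a) * k.
Proof.
move=> ab; rewrite RintegralZl//; last exact: integrable_indic_itv.
rewrite mulrC /Rintegral integral_indic//= setIT lebesgue_measure_itv/= lte_fin.
move: ab; rewrite le_eqVlt => /predU1P[<-|->].
  by rewrite ltxx subrr.
by rewrite -EFinB.
Qed.

Lemma integrable_step a b k :
  leb.-integrable setT (EFin \o (fun t => k * \1_(`]a, b] : set R) t)).
Proof. by apply: integrableRZ; exact: integrable_indic_itv. Qed.

Lemma dtP_eq_step f a b k : a <= b -> (dtP S).-integrable setT (EFin \o f) ->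
  {ae leb, forall t, \int[P]_w f (t, w) = k * \1_(`]a, b] : set R) t} ->
  \int[dtP S]_z f z = (b - a) * k.
Proof.
move=> ab /dtP_fubini[fi ->] e; rewrite -(Rintegral_step k ab).
apply: ae_eq_Rintegral => //.
  by have /integrableP[/measurable_EFinP] := fi.
by have /integrableP[/measurable_EFinP] := integrable_step a b k.
Qed.

Lemma dtP_le_step f a b k : a <= b -> (dtP S).-integrable setT (EFin \o f) ->
  {ae leb, forall t, \int[P]_w f (t, w) <= k * \1_(`]a, b] : set R) t} ->
  \int[dtP S]_z f z <= (b - a) * k.
Proof.
move=> ab /dtP_fubini[fi ->] e; rewrite -(Rintegral_step k ab).
by apply: ae_le_Rintegral => //; exact: integrable_step.
Qed.

Local Notation ind s t z := (\1_(`]s, t] : set R) (fst z)).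

Lemma in_itv_oc (s t x : R) : (x \in `]s, t]%classic) = (s < x) && (x <= t).
Proof. by apply/idP/idP; rewrite inE /= in_itv. Qed.

Lemma ind_split s r t (x : R) : s <= r -> r <= t ->
  \1_(`]s, t] : set R) x = \1_(`]s, r] : set R) x + \1_(`]r, t] : set R) x :> R.
Proof.
move=> sr rt; rewrite !indicE !in_itv_oc; have [xr|rx] := leP x r.
  by rewrite (le_trans xr rt) !andbT addr0.
by rewrite (le_lt_trans sr rx) add0r.
Qed.

Lemma sqint_time_ind s t (f : timeT * Om -> R) : sqint (dtP S) f ->
  sqint (dtP S) (fun z => ind s t z * f z).
Proof.
move=> sf; apply: (sqintM_bounded (M := 1) sf).
  exact: (measurableT_comp (measurable_indic (measurable_itv `]s, t]))).
by move=> z; rewrite indicE normr_nat (ler_nat _ _ 1) leq_b1.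
Qed.

Section cylinder.
Variables (n m : nat) (ti : 'I_n -> R)
  (C : 'I_m -> set (measurableTypeR R * measurableTypeR R)%type)
  (phi : 'rV[R]_(n + m) -> R).
Hypothesis tiT : forall j, 0 <= ti j <= T.
Hypothesis finC : forall j, finite_mass S (C j).
Hypothesis C1phi : C1_bounded phi.
Let arg (w : Om) : 'rV[R]_(n + m) :=
  row_mx (\row_(j < n) B (ti j) w) (\row_(j < m) fine (prm S w (C j))).
Let dir t : 'rV[R]_(n + m) := row_mx (\row_(j < n) \1_(`[0, ti j]) t) 0.
Let F w := phi (arg w).
Let D t w := 'D_(dir t) phi (arg w).

Lemma arg_measurable j : measurable_fun setT (fun w => arg w 0 j).
Proof.
case: (fintype.split_ordP j) => k ->.
  rewrite (_ : (fun _ => _) = B (ti k)); first exact: (measurable_bm HS).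
  by apply/funext => w; rewrite row_mxEl !mxE.
rewrite (_ : (fun _ => _) = count S (C k)); first exact: (measurable_count HS).
by apply/funext => w; rewrite row_mxEr !mxE.
Qed.

Lemma cyl_measurable : measurable_fun setT F.
Proof.
have [_ dphi _] := C1phi.
apply: (measurable_continuous_comp _ arg_measurable) => x.
exact/differentiable_continuous/dphi.
Qed.

Lemma cyl_sqint : sqint P F.
Proof.
have [[M phiM] _ _] := C1phi.
by apply: (@sqint_bounded _ _ _ S _ M cyl_measurable) => w; exact: phiM.
Qed.

Lemma cyl_dir_sqint e : exists K, [/\ 0 <= K, forall x, `|'D_e phi x| <= K &
  measurable_fun setT (fun w => 'D_e phi (arg w))].
Proof.
have [_ _ cD] := C1phi; have [cDe [K DK]] := cD e.
exists K; split => //; first exact: le_trans (DK 0).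
exact: (measurable_continuous_comp cDe arg_measurable).
Qed.

(** On such an interval D_t F is a bounded variable Q that does not depend on t. *)
Definition free (a b : R) := forall j, ti j <= a \/ b <= ti j.

Definition dirb (b : R) : 'rV[R]_(n + m) :=
  row_mx (\row_(j < n) ((b <= ti j)%R)%:R) 0.

Lemma free_dir a b t : 0 <= a -> free a b -> a < t -> t <= b -> dir t = dirb b.
Proof.
move=> a0 fab at_ tb; congr row_mx; apply/rowP => j; rewrite !mxE indicE.
congr ((nat_of_bool _)%:R); apply/idP/idP; rewrite inE /= in_itv/=.
  move=> /andP[_ tt]; have [ta|//] := fab j.
  by have := le_lt_trans (le_trans tt ta) at_; rewrite ltxx.
by move=> btj; rewrite (ltW (le_lt_trans a0 at_)) (le_trans tb).
Qed.

Lemma free_ibp a b c (M : R) : 0 <= a -> a < b -> b <= T -> free a b ->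
  wrt <<s enl S a>> c -> (forall w, `|c w| <= M) ->
  \int[P]_w (F w * (c w * inc S a b w)) =
    (b - a) * \int[P]_w (c w * 'D_(dirb b) phi (arg w)).
Proof.
move=> a0 ab bT fab wc cM.
pose l := sort <=%R [seq ti j | j <- enum 'I_n & b <= ti j].
have lb x : x \in l -> b <= x /\ x <= T.
  rewrite mem_sort => /mapP[j]; rewrite mem_filter => /andP[bj _] ->.
  by split => //; have /andP[] := tiT j.
have bl : path <=%R b l.
  rewrite path_min_sorted; first exact: (sort_sorted (@le_total _ R)).
  by apply/allP => x /lb[].
have lT : last b l <= T.
  have : last b l \in b :: l by exact: mem_last.
  by rewrite inE => /predU1P[->//|/lb[]].
rewrite -(cylinder_ibp HS tiT finC C1phi a0 ab bl lT (e := dirb b) (c := c) _ _ wc cM).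
- by apply: eq_Rintegral => w _; rewrite /F; ring.
- move=> j; rewrite /dirb row_mxEl mxE; have [ja|bj] := fab j.
    by left; split => //; rewrite leNgt (le_lt_trans ja ab).
  right; split; last by rewrite bj.
  rewrite inE mem_sort; apply/orP; right; apply/mapP; exists j => //.
  by rewrite mem_filter bj mem_enum.
- by move=> j; rewrite /dirb row_mxEr mxE.
Qed.

Variable M : R -> Om -> R.
Hypothesis sM : sqint (dtP S) (ext S M).
Let good t := cond_exp S (filt S t) (D t) (M t).
Hypothesis goodM : almost_all_times S good.

Section free_interval.
Variables a b : R.
Hypotheses (a0 : 0 <= a) (ab : a < b) (bT : b <= T) (fab : free a b).
Let Q w := 'D_(dirb b) phi (arg w).

Let inT t : a < t -> t <= b -> 0 <= t <= T.
Proof.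
by move=> at_ tb; rewrite (ltW (le_lt_trans a0 at_)) (le_trans tb).
Qed.

Let gQ t : a < t -> t <= b -> good t -> cond_exp S (filt S t) Q (M t).
Proof. by move=> at_ tb; rewrite /good /D (free_dir a0 fab at_ tb). Qed.

Let mfilt t : t <= b -> filt S t `<=` measurable.
Proof. by move=> tb; apply: (filt_measurable HS); exact: le_trans bT. Qed.

Let sQ : sqint P Q.
Proof.
have [K [_ QK mQ]] := cyl_dir_sqint (dirb b).
by apply: (@sqint_bounded _ _ _ S _ K mQ) => w; exact: QK.
Qed.

Lemma free_cond_mul t U : a < t -> t <= b -> good t -> wrt (filt S t) U ->
  sqint P U -> \int[P]_w (M t w * U w) = \int[P]_w (Q w * U w).
Proof.
move=> at_ tb /(gQ at_ tb) gt wU sU.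
have [sMt _] := cond_exp_sqint (mfilt tb) gt sQ.
apply: (cond_exp_mul (mfilt tb) gt wU).
  exact: (sqint_mulr_integrable sQ sU).
exact: (sqint_mulr_integrable sMt sU).
Qed.

(** For almost every t in ]a, b], the variable c is F_t-measurable, so that
   E[c M_t] = E[c Q]. *)
Lemma free_duality c : ok_step S a b c ->
  \int[P]_w (F w * (c w * inc S a b w)) = \int[dtP S]_z (ext S M z * stepf a b c z).
Proof.
move=> abc; have [k ck] := ok_bnd abc.
rewrite (free_ibp a0 ab bT fab (ok_wrt_enl abc) ck).
have sc := ok_sqint HS abc.
apply/esym/(dtP_eq_step (ltW ab)).
  exact: (sqint_mulr_integrable sM (stepf_sqint HS abc)).
apply: ae_lebW (almost_all_timesP goodM) => t gt; rewrite indicE.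
have [tab|tab] := boolP (t \in `]a, b]%classic); last first.
  rewrite mulr0 /Rintegral integral0_eq// => w _; congr EFin.
  by rewrite /stepf /= indicE (negbTE tab) mulr0 mulr0.
move: (tab); rewrite inE /= in_itv/= mulr1 => /andP[at_ tb].
have tT := inT at_ tb.
have wc : wrt (filt S t) c.
  by move=> V mV; apply: (filt_le (ltW at_)); exact: (ok_wrt abc).
transitivity (\int[P]_w (M t w * c w)).
  by apply: eq_Rintegral => w _; rewrite extE// /stepf /= indicE tab mulr1.
rewrite (free_cond_mul at_ tb (gt tT) wc sc).
by apply: eq_Rintegral => w _; rewrite mulrC.
Qed.

Let psi t := \int[P]_w (M t w) ^+ 2.

Lemma free_norm K t : (forall x, `|'D_(dirb b) phi x| <= K) -> a < t -> t <= b ->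
  good t -> sqint P (M t) /\ psi t <= K ^+ 2.
Proof.
move=> QK at_ tb gt; have K0 : 0 <= K by exact: le_trans (QK 0).
have [sMt le] := cond_exp_sqint (mfilt tb) (gQ at_ tb gt) sQ.
split => //; apply: (le_trans le).
rewrite -(Rintegral_prob_cst P (K ^+ 2)); apply: le_Rintegral => //.
- by have /sqintP[] := sQ.
- exact: finite_measure_integrable_cst.
- move=> w _; rewrite -(real_normK (num_real (Q w))) ler_sqr ?nnegrE//.
  exact: QK.
Qed.

(** (M_t) is a martingale, the conditional expectations of Q; this is its orthogonality
   of increments. The truncation c of M_s, which is an admissible coefficient, equals
   M_s almost surely: c is a projection and |Q| <= K, so that
   E(M_s - c)^2 = E[(M_s - c)(Q - c)] <= 0. *)
Lemma free_increment K s t : (forall x, `|'D_(dirb b) phi x| <= K) ->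
  a < s -> s <= t -> t <= b -> good s -> good t ->
  \int[P]_w (M t w - clip K (M s w)) ^+ 2 = psi t - psi s.
Proof.
move=> QK as_ st tb gs gt; have K0 : 0 <= K by exact: le_trans (QK 0).
have at_ := lt_le_trans as_ st; have sb := le_trans st tb.
have [sMs _] := free_norm QK as_ sb gs; have [sMt _] := free_norm QK at_ tb gt.
have [_ _ wMs _] := gs.
pose c w := clip K (M s w).
have mc : measurable_fun setT c.
  by apply: (measurableT_comp (measurable_clip K)); case: sMs.
have sc : sqint P c.
  by apply: (@sqint_bounded _ _ _ S _ K mc) => w; exact: clip_bounded.
have wc : wrt (filt S s) c by exact: (wrt_comp (measurable_clip K) wMs).
have wct : wrt (filt S t) c by move=> V mV; apply: (filt_le st); exact: wc.
pose U w := M s w - clip K (M s w).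
have sU : sqint P U by exact: (sqintB sMs sc).
have wU : wrt (filt S s) U.
  apply: (@wrt_comp _ _ _ _ (fun x => x - clip K x)) wMs.
  by apply: measurable_funB; [exact: measurable_id|exact: measurable_clip].
have e1 := free_cond_mul as_ sb gs wU sU.
have e2 := free_cond_mul as_ sb gs wc sc.
have e3 := free_cond_mul at_ tb gt wct sc.
have i (f g : Om -> R) : sqint P f -> sqint P g ->
    P.-integrable setT (EFin \o (fun w => f w * g w)).
  exact: sqint_mulr_integrable.
have le0 : \int[P]_w (U w * U w) <= 0.
  have -> : \int[P]_w (U w * U w) = \int[P]_w (Q w * U w) - \int[P]_w (c w * U w).
    rewrite -e1 -RintegralB; [|by []|exact: i|exact: i].
    by apply: eq_Rintegral => w _; rewrite /U /c; ring.
  rewrite -opprB oppr_le0 -RintegralB; [|by []|exact: i|exact: i].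
  apply: Rintegral_ge0 => w _.
  have := @clip_projection _ K (M s w) (Q w) (QK _); rewrite /U /c; nra.
have ge0 : 0 <= \int[P]_w (U w * U w).
  by apply: Rintegral_ge0 => w _; rewrite -expr2 sqr_ge0.
have sq (N : Om -> R) : sqint P N -> \int[P]_w (N w - c w) ^+ 2 =
    \int[P]_w (N w * N w) - 2 * \int[P]_w (N w * c w) + \int[P]_w (c w * c w).
  move=> sN.
  rewrite -RintegralZl; [|by []|exact: i].
  rewrite -RintegralB; [|by []|exact: i|by apply: integrableRZ; exact: i].
  rewrite -RintegralD; [|by []| |exact: i].
    by apply: eq_Rintegral => w _; ring.
  by apply: integrableRB; [exact: i|apply: integrableRZ; exact: i].
have := sq _ sMs; have := sq _ sMt.
have -> : \int[P]_w (M s w - c w) ^+ 2 = 0.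
  apply/eqP; rewrite eq_le; apply/andP; split.
    by rewrite (le_trans _ le0)//; apply: le_refl_eq; apply: eq_Rintegral => w _;
      rewrite /U expr2.
  by apply: Rintegral_ge0 => w _; exact: sqr_ge0.
rewrite /psi e2 e3 => ->.
under [X in _ = X - _]eq_Rintegral do rewrite expr2.
under [X in _ = _ - X]eq_Rintegral do rewrite expr2.
lra.
Qed.

Section orthogonality.
Variable Z : timeT * Om -> R.
Hypotheses (sZ : sqint (dtP S) Z) (oZ : orth S Z).

Definition ip_on s t := \int[dtP S]_z (ind s t z * ext S M z * Z z).
Definition sq_on s t := \int[dtP S]_z (ind s t z * Z z ^+ 2).

Lemma ip_on_integrable s t :
  (dtP S).-integrable setT (EFin \o (fun z => ind s t z * ext S M z * Z z)).
Proof. exact: (sqint_mulr_integrable (sqint_time_ind s t sM) sZ). Qed.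

Lemma sq_on_integrable s t :
  (dtP S).-integrable setT (EFin \o (fun z => ind s t z * Z z ^+ 2)).
Proof.
have := sqint_mulr_integrable (sqint_time_ind s t sZ) sZ.
by apply: eq_integrable => // z _ /=; rewrite expr2 mulrA.
Qed.

Lemma ip_on_split s r t : s <= r -> r <= t -> ip_on s t = ip_on s r + ip_on r t.
Proof.
move=> sr rt; rewrite /ip_on -RintegralD; [|by []|exact: ip_on_integrable|exact:
  ip_on_integrable].
by apply: eq_Rintegral => z _; rewrite (ind_split _ sr rt); ring.
Qed.

Lemma sq_on_split s r t : s <= r -> r <= t -> sq_on s t = sq_on s r + sq_on r t.
Proof.
move=> sr rt; rewrite /sq_on -RintegralD; [|by []|exact: sq_on_integrable|exact:
  sq_on_integrable].
by apply: eq_Rintegral => z _; rewrite (ind_split _ sr rt); ring.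
Qed.

(** Z is orthogonal to c 1_]s, t], so that M may be replaced by M - c; then Young's
   inequality applies. *)
Lemma ip_on_le s t c k e : 0 < e -> ok_step S s t c ->
  {ae leb, forall r, s < r -> r <= t -> \int[P]_w (M r w - c w) ^+ 2 <= k} ->
  `|ip_on s t| <= (t - s) * k / (2 * e) + e / 2 * sq_on s t.
Proof.
move=> e0 stc ck; have [s0 st tT _ _] := stc.
pose f z := ind s t z * ext S M z - stepf s t c z.
have sf : sqint (dtP S) f.
  exact: (sqintB (sqint_time_ind s t sM) (stepf_sqint HS stc)).
have fE z : f z = ind s t z * (ext S M z - c z.2) by rewrite /f /stepf; ring.
have /sqintP[_ if2] := sf.
have f2le : \int[dtP S]_z (f z) ^+ 2 <= (t - s) * k.
  apply: (dtP_le_step st) => //; apply: ae_lebW ck => r rk.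
  rewrite indicE; have [rst|rst] := boolP (r \in `]s, t]%classic); last first.
    rewrite mulr0 le_eqVlt; apply/orP; left; apply/eqP.
    rewrite /Rintegral integral0_eq// => w _; congr EFin.
    by rewrite fE /= indicE (negbTE rst) mul0r expr0n.
  move: (rst); rewrite inE /= in_itv/= mulr1 => /andP[sr rt].
  apply: le_trans (rk sr rt); rewrite le_eqVlt; apply/orP; left; apply/eqP.
  apply: eq_Rintegral => w _; rewrite fE /= indicE rst mul1r extE//.
  by rewrite (ltW (le_lt_trans s0 sr)) (le_trans rt).
have -> : ip_on s t = \int[dtP S]_z (f z * Z z).
  rewrite -[RHS]addr0 -(oZ stc) -RintegralD.
  - by apply: eq_Rintegral => z _; rewrite /f; ring.
  - by [].
  - exact: (sqint_mulr_integrable sf sZ).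
  - exact: (sqint_mulr_integrable (stepf_sqint HS stc) sZ).
have ifZ := sqint_mulr_integrable sf sZ.
apply: (le_trans (le_normr_Rintegral _ ifZ)) => //.
have -> : (t - s) * k / (2 * e) + e / 2 * sq_on s t =
  (2 * e)^-1 * ((t - s) * k) + e / 2 * sq_on s t by ring.
apply: (@le_trans _ _ (\int[dtP S]_z ((2 * e)^-1 * (f z) ^+ 2 + e / 2 *
  (ind s t z * Z z ^+ 2)))).
  apply: le_Rintegral => //.
  - by have := integrable_norm ifZ.
  - by apply: integrableRD; apply: integrableRZ => //; exact: sq_on_integrable.
  - move=> z _; rewrite fE indicE; case: (_ \in _); last first.
      by rewrite !mul0r normr0 expr0n/= !mulr0 addr0.
    by rewrite !mul1r; exact: young.
rewrite RintegralD; [|by []|by apply: integrableRZ|by apply: integrableRZ; exact: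
  sq_on_integrable].
rewrite !RintegralZl//; last exact: sq_on_integrable.
by rewrite lerD2r ler_pM2l// invr_gt0 mulr_gt0.
Qed.

Let aeM : {ae leb, forall r, a < r -> r <= b -> good r}.
Proof.
by apply: ae_lebW (almost_all_timesP goodM) => r gr ar rb; apply/gr/inT.
Qed.

Section gap.
Variable K : R.
Hypothesis QK : forall x, `|'D_(dirb b) phi x| <= K.

Lemma ip_on_good s t e : 0 < e -> a < s -> s < t -> t <= b -> good s -> good t ->
  `|ip_on s t| <= (t - s) * (psi t - psi s) / (2 * e) + e / 2 * sq_on s t.
Proof.
move=> e0 as_ st tb gs gt; have sb := ltW (lt_le_trans st tb).
have K0 : 0 <= K by exact: le_trans (QK 0).
have [_ _ wMs _] := gs.
apply: (ip_on_le e0 (c := fun w => clip K (M s w))).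
  split.
  - by rewrite (ltW (le_lt_trans a0 as_)).
  - exact: ltW.
  - exact: le_trans bT.
  - exact: (wrt_comp (measurable_clip K) wMs).
  - by exists K => w; exact: clip_bounded.
apply: ae_lebW aeM => r gr sr rt.
have ar := lt_trans as_ sr; have rb := le_trans rt tb.
rewrite (free_increment QK as_ (ltW sr) rb gs (gr ar rb)) lerD2r -subr_ge0.
rewrite -(free_increment QK ar rt tb (gr ar rb) gt).
by apply: Rintegral_ge0 => w _; exact: sqr_ge0.
Qed.

Lemma ip_on_crude s t e : 0 < e -> a <= s -> s <= t -> t <= b ->
  `|ip_on s t| <= (t - s) * K ^+ 2 / (2 * e) + e / 2 * sq_on s t.
Proof.
move=> e0 as_ st tb; apply: (ip_on_le e0 (c := cst 0)).
  split => //; [exact: le_trans as_|exact: le_trans bT| |].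
    by apply/wrtP; exact: measurable_cst.
  by exists 0 => w; rewrite normr0.
apply: ae_lebW aeM => r gr sr rt.
have ar := le_lt_trans as_ sr; have rb := le_trans rt tb.
have [_] := free_norm QK ar rb (gr ar rb); apply: le_trans.
by rewrite le_eqVlt; apply/orP; left; apply/eqP; apply: eq_Rintegral => w _;
  rewrite subr0.
Qed.

Lemma sq_on_ge0 s t : 0 <= sq_on s t.
Proof. by apply: Rintegral_ge0 => z _; rewrite mulr_ge0 ?sqr_ge0. Qed.

Lemma psi_le s t : a < s -> s <= t -> t <= b -> good s -> good t -> psi s <= psi t.
Proof.
move=> as_ st tb gs gt; rewrite -subr_ge0 -(free_increment QK as_ st tb gs gt).
by apply: Rintegral_ge0 => w _; exact: sqr_ge0.
Qed.

(** The interval is cut at times at which M is a version of the conditional expectation,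
   into pieces of length at most 2 h; the increments of psi over them telescope. *)
Lemma ip_on_chain h e k s t : 0 < e -> 0 < h -> a < s -> s < t -> t <= b ->
  good s -> good t -> t - s <= k%:R * h ->
  `|ip_on s t| <= h / e * (psi t - psi s) + e / 2 * sq_on s t.
Proof.
move=> e0 h0; elim: k s => [|k IH] s as_ st tb gs gt; first by rewrite mul0r; lra.
move=> tsk; have psi0 : 0 <= psi t - psi s by rewrite subr_ge0 psi_le// ltW.
have short r : a < s -> s < r -> r <= b -> good r -> r - s <= 2 * h ->
    `|ip_on s r| <= h / e * (psi r - psi s) + e / 2 * sq_on s r.
  move=> _ sr rb gr rs; apply: (le_trans (ip_on_good e0 as_ sr rb gs gr)).
  rewrite lerD2r [leLHS](_ : _ = (r - s) / (2 * e) * (psi r - psi s)); last by ring.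
  apply: ler_wpM2r; first by rewrite subr_ge0 psi_le// ltW.
  rewrite ler_pdivrMr ?mulr_gt0//.
  by have -> : h / e * (2 * e) = 2 * h by field; rewrite gt_eqF.
have [ts|ts] := leP (t - s) (2 * h); first exact: short.
have [|r /andP[sr rs] gr] := ae_pick (x := s + h) (y := s + 2 * h) _ aeM; first by lra.
have as' : s < r by lra.
have rt : r < t by lra.
have ar : a < r by lra.
have rb : r <= b by lra.
have {}gr := gr ar rb.
have h1 : `|ip_on s r| <= h / e * (psi r - psi s) + e / 2 * sq_on s r by apply:
  short => //; lra.
have h2 : `|ip_on r t| <= h / e * (psi t - psi r) + e / 2 * sq_on r t.
  by apply: IH => //; move: tsk; rewrite -natr1; lra.
rewrite (ip_on_split (ltW as') (ltW rt)) (sq_on_split (ltW as') (ltW rt)).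
apply: (le_trans (ler_normD _ _)); apply: (le_trans (lerD h1 h2)).
by rewrite le_eqVlt; apply/orP; left; apply/eqP; ring.
Qed.

End gap.

(** M is a limit of elementary processes: with steps of length at most 2 e^2, the bounds
   of the preceding lemmas are of order e. *)
Lemma free_orth : ip_on a b = 0.
Proof.
have [K [K0 QK _]] := cyl_dir_sqint (dirb b).
pose N := sq_on a b.
have N0 : 0 <= N by exact: sq_on_ge0.
suff le e : 0 < e -> `|ip_on a b| <= e * (2 * K ^+ 2 + N).
  apply/eqP; rewrite -normr_le0 leNgt; apply/negP => j0.
  have c0 : 0 < 2 * K ^+ 2 + N + 1 by rewrite ltr_wpDl// addr_ge0// mulr_ge0// sqr_ge0.
  have := le (`|ip_on a b| / 2 / (2 * K ^+ 2 + N + 1)).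
  rewrite !divr_gt0// => /(_ isT); apply/negP; rewrite -ltNge.
  rewrite mulrAC ltr_pdivrMr// -/N.
  have : 0 <= `|ip_on a b| * (2 * K ^+ 2 + N) by rewrite mulr_ge0// addr_ge0//
    mulr_ge0// sqr_ge0.
  by move: c0 j0; move: (2 * K ^+ 2 + N) => c; lra.
move=> e0.
pose h := Num.min (e ^+ 2) ((b - a) / 3).
have h0 : 0 < h by rewrite lt_min exprn_gt0// divr_gt0// subr_gt0.
have he : h <= e ^+ 2 by rewrite ge_min lexx.
have hab : 3 * h <= b - a by rewrite -ler_pdivlMl// mulrC ge_min lexx orbT.
have [|s /andP[as_ sh] gs] := ae_pick (x := a) (y := a + h) _ aeM; first by lra.
have [|t /andP[bt tb] gt] := ae_pick (x := b - h) (y := b) _ aeM; first by lra.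
have st : s < t by lra.
have sb : s <= b by lra.
have {}gs := gs as_ sb.
have {}gt := gt (lt_trans as_ st) (ltW tb).
have h1 := ip_on_crude QK e0 (lexx a) (ltW as_) sb.
have h3 := ip_on_crude QK e0 (ltW (lt_trans as_ st)) (ltW tb) (lexx b).
have h2 : `|ip_on s t| <= h / e * (psi t - psi s) + e / 2 * sq_on s t.
  apply: (ip_on_chain (k := (Num.truncn ((t - s) / h)).+1) QK e0 h0) => //;
    first exact: ltW.
  by rewrite -ler_pdivrMr// ltW// truncnS_gt.
have ps : 0 <= psi s by apply: Rintegral_ge0 => w _; exact: sqr_ge0.
have [_ pt] := free_norm QK (lt_trans as_ st) (ltW tb) gt.
have j : `|ip_on a b| <= `|ip_on a s| + `|ip_on s t| + `|ip_on t b|.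
  rewrite (ip_on_split (ltW as_) sb) (ip_on_split (ltW st) (ltW tb)) addrA.
  by apply: (le_trans (ler_normD _ _)); rewrite lerD2r ler_normD.
have nn : N = sq_on a s + sq_on s t + sq_on t b.
  by rewrite /N (sq_on_split (ltW as_) sb) (sq_on_split (ltW st) (ltW tb)) addrA.
apply: (le_trans j); rewrite nn.
apply: (gap_bound e0 (ltW h0) he _ _ _ _ ps pt h1 h2 h3) => //; try exact: sq_on_ge0.
- by rewrite subr_ge0 ltW.
- by rewrite lerBlDl ltW.
- by rewrite subr_ge0 ltW.
- by rewrite lerBlDr -lerBlDl ltW.
- exact: sqr_ge0.
Qed.

End orthogonality.
End free_interval.

(** By induction on the number of times t_j inside ]a, b[ *)
Lemma free_ind (Pp : R -> R -> Prop) :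
  (forall a b, 0 <= a -> a < b -> b <= T -> free a b -> Pp a b) ->
  (forall a r b, 0 <= a -> a < r -> r < b -> b <= T -> Pp a r -> Pp r b -> Pp a b) ->
  forall a b, 0 <= a -> a < b -> b <= T -> Pp a b.
Proof.
move=> Pfree Psplit.
suff h N a b : (#|[pred j | (a < ti j < b)%R]| < N)%N -> 0 <= a -> a < b -> b <= T ->
  Pp a b.
  by move=> a b; exact: (h _.+1).
elim: N a b => // N IH a b; rewrite ltnS => cN a0 ab bT.
have [fab|nfab] := pselect (free a b); first exact: Pfree.
have [j /andP[aj jb]] : exists j, a < ti j < b.
  apply: contrapT => nj; apply: nfab => j; have [ja|aj] := leP (ti j) a; first by left.
  by right; rewrite leNgt; apply/negP => jb; apply: nj; exists j; rewrite aj.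
have card_lt x y : (forall k, x < ti k < y -> a < ti k < b) -> ~~ (x < ti j < y) ->
    (#|[pred k | (x < ti k < y)%R]| < N)%N.
  move=> xyab nj; apply: leq_trans cN; apply: proper_card; apply/properP; split.
    by apply/fintype.subsetP => k; rewrite !inE; exact: xyab.
  by exists j; rewrite !inE ?aj ?jb.
apply: (Psplit a (ti j) b) => //.
- apply: IH => //; last by rewrite (le_trans (ltW jb)).
  by apply: card_lt => [k /andP[-> /lt_trans->//]|]; rewrite ltxx andbF.
- apply: IH => //; last by rewrite (le_trans a0)// ltW.
  by apply: card_lt => [k /andP[/(lt_trans aj) -> ->//]|]; rewrite ltxx.
Qed.

Lemma cyl_duality a b c : ok_step S a b c ->
  \int[P]_w (F w * (c w * inc S a b w)) = \int[dtP S]_z (ext S M z * stepf a b c z).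
Proof.
move=> abc; have [a0 + bT _ _] := abc; rewrite le_eqVlt => /predU1P[eab|ab].
  rewrite -eab /Rintegral !integral0_eq// => [z _|w _]; congr EFin.
    by rewrite /stepf indicE in_itv_oc leNgt andbN !mulr0.
  by rewrite /inc subrr !mulr0.
move: a b a0 ab bT c abc; apply: free_ind =>
  [a b a0 ab bT fab|a r b a0 ar rb bT IH1 IH2] c abc.
  exact: free_duality.
have o1 : ok_step S a r c by apply: (ok_sub abc) => //; exact: ltW.
have o2 : ok_step S r b c by apply: (ok_sub abc) => //; exact: ltW.
transitivity (\int[P]_w (F w * (c w * inc S a r w)) + \int[P]_w (F w *
  (c w * inc S r b w))).
  rewrite -RintegralD//.
  - by apply: eq_Rintegral => w _; rewrite /inc; ring.
  - exact: (sqint_mulr_integrable cyl_sqint (ok_sqint_inc HS o1)).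
  - exact: (sqint_mulr_integrable cyl_sqint (ok_sqint_inc HS o2)).
rewrite IH1// IH2// -RintegralD//.
- apply: eq_Rintegral => z _; rewrite -mulrDr; congr (_ * _).
  by rewrite /stepf (ind_split _ (ltW ar) (ltW rb)) mulrDr.
- exact: (sqint_mulr_integrable sM (stepf_sqint HS o1)).
- exact: (sqint_mulr_integrable sM (stepf_sqint HS o2)).
Qed.

Lemma cyl_orth Z a b : sqint (dtP S) Z -> orth S Z -> 0 <= a -> a < b -> b <= T ->
  \int[dtP S]_z (ind a b z * ext S M z * Z z) = 0.
Proof.
move=> sZ oZ; move: a b; apply: free_ind => [a b a0 ab bT fab|a r b a0 ar rb bT e1 e2].
  exact: (free_orth a0 ab bT fab sZ oZ).
have := ip_on_split sZ (ltW ar) (ltW rb); rewrite /ip_on => ->.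
by rewrite e1 e2 addr0.
Qed.

End cylinder.

Lemma cvg_eq_near (a_ b_ : nat -> R) (a b : R) : (\forall n \near \oo, a_ n = b_ n) ->
  a_ n @[n --> \oo] --> a -> b_ n @[n --> \oo] --> b -> a = b.
Proof.
move=> ab_ aa bb; apply: (cvgn_unique aa); apply: cvg_trans bb.
by apply: near_eq_cvg; apply: filterS ab_.
Qed.

Lemma ext_jointly_measurable (a : R -> Om -> R) :
  measurable_fun setT (ext S a) -> jointly_measurable S a.
Proof.
exact: (measurable_restrictT _ (measurable_time_space S)).2.
Qed.

(** Both sides are continuous in (A, G), so that the duality formula passes from
   cylindrical functionals to their limits. *)
Lemma malliavin_duality (A : Om -> R) (G : R -> Om -> R) u v c :
  cond_malliavin S A G -> ok_step S u v c -> sqint P A /\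
  \int[P]_w (A w * (c w * inc S u v w)) = \int[dtP S]_z (ext S G z * stepf u v c z).
Proof.
move=> [Fn [Dn [Mn [LG cyl MnP [mA FA] MG]]]] uvc.
have sF n : sqint P (Fn n).
  have [n' [m [ti [C [phi [tiT finC C1 -> _]]]]]] := cyl n.
  exact: (cyl_sqint tiT finC C1).
have sA : sqint P A by exact: (cvg_sqint sF mA FA).
split => //.
have [mG _] := LG.
have MG' := sqnorm_cvg (fun n => (MnP n).1) mG MG.
have mM n : measurable_fun setT (ext S (Mn n)) by apply: measurable_ext; case: (MnP n).
have [_ c1] := ip_cvg (fun n => (sF n).1) sA (ok_sqint_inc HS uvc) FA.
have [near_sq c2] := ip_cvg mM (L2_ext LG) (stepf_sqint HS uvc) MG'.
apply: (cvg_eq_near _ c1 c2); apply: filterS near_sq => n sMn.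
have [n' [m [ti [C [phi [tiT finC C1 EF ED]]]]]] := cyl n.
have [_ gM] := MnP n; rewrite ED in gM; rewrite EF.
exact: (cyl_duality tiT finC C1 sMn gM uvc).
Qed.

Lemma malliavin_orth (A : Om -> R) (G : R -> Om -> R) (Z : timeT * Om -> R) a b :
  cond_malliavin S A G -> sqint (dtP S) Z -> orth S Z ->
  0 <= a -> a < b -> b <= T ->
  \int[dtP S]_z (ext S G z * (ind a b z * Z z)) = 0.
Proof.
move=> [Fn [Dn [Mn [LG cyl MnP [mA FA] MG]]]] sZ oZ a0 ab bT.
have [mG _] := LG.
have MG' := sqnorm_cvg (fun n => (MnP n).1) mG MG.
have mM n : measurable_fun setT (ext S (Mn n)) by apply: measurable_ext; case: (MnP n).
have [near_sq c2] := ip_cvg mM (L2_ext LG) (sqint_time_ind a b sZ) MG'.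
apply: (cvg_eq_near _ c2 (cvg_cst 0)); apply: filterS near_sq => n sMn.
have [n' [m [ti [C [phi [tiT finC C1 EF ED]]]]]] := cyl n.
have [_ gM] := MnP n; rewrite ED in gM.
rewrite -[RHS](cyl_orth tiT finC C1 sMn gM sZ oZ a0 ab bT).
by apply: eq_Rintegral => z _; rewrite mulrCA mulrA.
Qed.

End cylindrical_functionals.

(** * The noisy memory *)

Section noisy_memory_field.
Context {R : realType} d (Om : measurableType d) (S : noise R Om).
Hypothesis HS : driving_noise S.
Local Notation T := (hor S).
Local Notation P := (prob S).
Local Notation B := (bm S).
Local Notation timeT := (measurableTypeR R).
Local Notation leb := (@lebesgue_measure R).
Local Notation ind s t z := (\1_(`]s, t] : set R) (fst z)).
Variables (A : R -> Om -> R) (EDL : R -> R -> Om -> R) (delta : R).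
Hypotheses (LA : L2_process S A) (d0 : 0 <= delta).
Hypothesis CF : cond_malliavin_field S A EDL.

Definition sfdtP : {sigma_finite_measure set (timeT * Om)%type -> \bar R} :=
  sfprod leb P.

(* E[D_t A(s) | F_t], as a function of (s, (t, w)) on the whole space *)
Definition mfield : timeT * (timeT * Om) -> R :=
  (fun z => EDL z.1 z.2.1 z.2.2) \_ (`[0, T] `*` time_space S).

Lemma mfieldE s z : 0 <= s <= T -> mfield (s, z) = ext S (EDL s) z.
Proof.
move=> sT; rewrite /mfield /ext !patchE; congr (if _ then _ else _).
apply/idP/idP; rewrite !inE; first by case.
by move=> h; split => //=; rewrite in_itv.
Qed.

Lemma mfield_out s z : ~~ (0 <= s <= T) -> mfield (s, z) = 0.
Proof.
move=> sT; rewrite /mfield patchE ifF//; apply/negP; rewrite inE => -[/= + _].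
by rewrite in_itv/=; exact/negP.
Qed.

Lemma measurable_mfield : measurable_fun setT mfield.
Proof.
have [mE _ _] := CF.
apply/(measurable_restrictT _ _).1 => //.
by apply: measurableX => //; exact: measurable_time_space.
Qed.

Lemma sqint_mfield : sqint (leb \x sfdtP)%E mfield.
Proof.
have mE := measurable_mfield.
have mE2 : measurable_fun setT (fun z => ((mfield z) ^+ 2)%:E).
  by apply/measurable_EFinP/measurable_funX.
split => //; rewrite (fubini_tonelli1 (fun z => ((mfield z) ^+ 2)%:E))//; last first.
  by move=> z; rewrite lee_fin sqr_ge0.
have [_ Eoo _] := CF; apply: le_lt_trans Eoo.
rewrite [leRHS]integral_mkcond le_eqVlt; apply/orP; left; apply/eqP.
apply: eq_integral => s _; rewrite patchE /fubini_F; case: ifPn => sT.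
  move: sT; rewrite inE /= in_itv/= => sT.
  rewrite sqnormE; last first.
    apply: ext_jointly_measurable; rewrite (_ : ext S (EDL s) = (fun z => mfield (s, z))).
      exact: measurableT_comp mE _.
    by apply/funext => z; rewrite mfieldE.
  by apply: eq_integral => z _; rewrite mfieldE.
rewrite integral0_eq// => z _; rewrite mfield_out ?expr0n//.
by apply: contra sT; rewrite inE /= in_itv.
Qed.

Lemma in_itv_shift s t : 0 < t ->
  (Num.max 0 (s - delta) < t <= s) = (t <= s < t + delta).
Proof.
by move=> t0; rewrite gt_max t0/= ltrBlDr andbC.
Qed.

(* At fixed t > 0, s ranges over [t, t + delta[; at fixed s, t ranges over the interval
   ]max(0, s - delta), s], which is of the kind that carries elementary integrands. *)
Definition memory_kernel (z : timeT * (timeT * Om)) : R :=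
  ind (Num.max 0 ((z.1 : R) - delta)) z.1 z.2 * mfield z.

Lemma measurable_ind_moving (f g : timeT * (timeT * Om) -> R) :
  measurable_fun setT f -> measurable_fun setT g ->
  measurable_fun setT (fun z : timeT * (timeT * Om) => ind (f z) (g z) z.2 : R).
Proof.
move=> mf mg.
have mt : measurable_fun setT (fun z : timeT * (timeT * Om) => z.2.1 : R).
  exact: (measurableT_comp measurable_fst measurable_snd).
pose D : set (timeT * (timeT * Om)) := [set z | (f z < z.2.1) && (z.2.1 <= g z)].
have mD : measurable D.
  rewrite -[D]setTI.
  apply: (measurable_and (f := fun z : timeT * (timeT * Om) => f z < z.2.1)
    (g := fun z : timeT * (timeT * Om) => z.2.1 <= g z)) => //.
  - exact: measurable_fun_ltr.
  - exact: measurable_fun_ler.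
rewrite (_ : (fun _ => _) = \1_D); first exact: measurable_indic.
apply/funext => z; rewrite !indicE; congr ((nat_of_bool _)%:R).
Qed.

Lemma sqint_memory_kernel : sqint (leb \x sfdtP)%E memory_kernel.
Proof.
apply: (sqintM_bounded (M := 1) sqint_mfield).
  apply: measurable_ind_moving; last exact: measurable_fst.
  apply: measurable_maxr; first exact: measurable_cst.
  by apply: measurable_funB; [exact: measurable_fst|exact: measurable_cst].
by move=> z; rewrite indicE normr_nat (ler_nat _ _ 1) leq_b1.
Qed.

Lemma memory_kernel_out s z : ~~ (0 <= s <= T) -> memory_kernel (s, z) = 0.
Proof. by move=> sT; rewrite /memory_kernel mfield_out// mulr0. Qed.

Definition memory (z : timeT * Om) : R := \int[leb]_s memory_kernel (s, z).

Lemma sqint_memory : sqint (dtP S) memory.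
Proof. exact: (time_integral_sqint (mu := sfdtP)
  (T_gt0 HS) sqint_memory_kernel memory_kernel_out). Qed.

Lemma memoryE t w : 0 < t -> t <= T ->
  memory (t, w) = \int[Defs.leb]_(s in `[t, t + delta]) (EDL s t w * \1_(`[0, T]) s).
Proof.
move=> t0 tT; have t0T : 0 <= t <= T by rewrite ltW.
have E s : EDL s t w * \1_(`[0, T] : set R) s = mfield (s, (t, w)).
  rewrite indicE; have [sT|sT] := boolP (0 <= s <= T).
    by rewrite mfieldE// extE// mem_set ?mulr1//= in_itv.
  rewrite mfield_out// memNset ?mulr0//=; rewrite in_itv/=; exact/negP.
have -> : \int[Defs.leb]_(s in `[t, t + delta]) (EDL s t w * \1_(`[0, T]) s) =
    \int[leb]_(s in `[t, t + delta]) mfield (s, (t, w)).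
  by apply: eq_Rintegral => s _; rewrite -E.
have mE : measurable_fun setT (fun s => (mfield (s, (t, w)))%:E).
  by apply/measurable_EFinP; exact: (measurableT_comp measurable_mfield).
rewrite /memory /Rintegral -integral_itv_bndo_bndc; last exact: measurable_funTS.
congr fine; rewrite [RHS]integral_mkcond; apply: eq_integral => s _.
rewrite patchE /memory_kernel /= indicE in_itv_oc in_itv_shift//.
have -> : (s \in `[t, t + delta[%classic) = (t <= s < t + delta).
  by apply/idP/idP; rewrite inE /= in_itv.
by case: ifP => _; rewrite ?mul1r ?mul0r.
Qed.

(** For fixed s, the process t |-> E[D_t A(s) | F_t] restricted to an interval is a limit
   of elementary ones, and memory is an integral over s of such processes. *)
Lemma memory_orth Z : sqint (dtP S) Z -> orth S Z ->
  \int[dtP S]_z (memory z * Z z) = 0.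
Proof.
move=> sZ oZ.
rewrite [LHS](time_integral_ip (mu := sfdtP)
  (T_gt0 HS) sqint_memory_kernel memory_kernel_out sZ).
have i := integrable_time_mul (mu := sfdtP)
  (T_gt0 HS) sqint_memory_kernel memory_kernel_out sZ.
have /integrableP[/measurable_EFinP mi _] := Rfubini1_integrable i.
rewrite (ae_eq_Rintegral (g := cst 0))//; first by rewrite Rintegral_cst// mul0r.
have [_ _ cm] := CF.
apply: ae_lebW (almost_all_timesP cm) => s cms.
have [sT|sT] := boolP (0 <= s <= T); last first.
  by rewrite /Rintegral integral0_eq// => z _; rewrite memory_kernel_out// mul0r.
have /andP[s0 sT'] := sT.
have [as_|as_] := ltP (Num.max 0 (s - delta)) s; last first.
  rewrite /Rintegral integral0_eq// => z _; congr EFin.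
  rewrite /memory_kernel /= indicE in_itv_oc; case: (boolP (_ && _)) =>
    [/andP[h1 h2]|]; last by rewrite !mul0r.
  by have := lt_le_trans h1 (le_trans h2 as_); rewrite ltxx.
rewrite -[RHS](malliavin_orth HS (cms sT) sZ oZ _ as_ sT'); last by rewrite le_max lexx.
by apply: eq_Rintegral => z _; rewrite /memory_kernel mfieldE//=; ring.
Qed.

Section elementary_test.
Variables (u v : R) (c : Om -> R).
Hypothesis uvc : ok_step S u v c.
Local Notation eta := (stepf u v c).

Let u0 : 0 <= u. Proof. exact: ok_ge0 uvc. Qed.
Let uv : u <= v. Proof. exact: ok_le uvc. Qed.
Let vT : v <= T. Proof. exact: ok_leT uvc. Qed.

(** c (B(clamp s) - B(u)) is the part of c (B(v) - B(u)) that is known at time s. *)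
Definition clamp (s : R) : R := Num.max u (Num.min v s).

Lemma clamp_le s : u <= clamp s <= v.
Proof. by rewrite /clamp le_max lexx ge_max uv ge_min lexx. Qed.

Lemma le_clamp s t : u < t -> t <= v -> (t <= clamp s) = (t <= s).
Proof. by move=> ut tv; rewrite /clamp le_max le_min leNgt ut tv. Qed.

Lemma clamp_lo s : s <= u -> clamp s = u.
Proof. by move=> su; rewrite /clamp max_l// ge_min su orbT. Qed.

Definition past_field (e : R) (z : timeT * (timeT * Om)) : R :=
  ind u (clamp ((z.1 : R) - e)) z.2 * mfield z.

Lemma sqint_past_field e : sqint (leb \x sfdtP)%E (past_field e).
Proof.
apply: (sqintM_bounded (M := 1) sqint_mfield).
  apply: measurable_ind_moving; first exact: measurable_cst.
  apply: measurable_maxr; first exact: measurable_cst.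
  apply: measurable_minr; first exact: measurable_cst.
  by apply: measurable_funB; [exact: measurable_fst|exact: measurable_cst].
by move=> z; rewrite indicE normr_nat (ler_nat _ _ 1) leq_b1.
Qed.

Lemma past_field_out e s z : ~~ (0 <= s <= T) -> past_field e (s, z) = 0.
Proof. by move=> sT; rewrite /past_field mfield_out// mulr0. Qed.

(** Duality turns past_ip e s into the expectation of A(s) c (B(clamp (s - e)) - B(u)),
   see past_duality; in the form of an integral its measurability in s is clear. *)
Definition past_ip e s := \int[dtP S]_z (past_field e (s, z) * eta z).

Let sqint_eta : sqint (dtP S) eta. Proof. exact: (stepf_sqint HS uvc). Qed.

Let past_prod_integrable e :=
  integrable_time_mul (mu := sfdtP) (T_gt0 HS) (sqint_past_field e)
    (@past_field_out e) sqint_eta.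

Lemma past_ip_integrable e : leb.-integrable setT (EFin \o past_ip e).
Proof. exact: (Rfubini1_integrable (past_prod_integrable e)). Qed.

Lemma past_ip_out e s : ~~ (0 <= s <= T) -> past_ip e s = 0.
Proof.
move=> sT; rewrite /past_ip /Rintegral integral0_eq// => z _.
by rewrite past_field_out// mul0r.
Qed.

Lemma past_ip_lo e s : s - e <= u -> past_ip e s = 0.
Proof.
move=> su; rewrite /past_ip /Rintegral integral0_eq// => z _.
by rewrite /past_field /= clamp_lo// indicE in_itv_oc ltNge andNb !mul0r.
Qed.

Lemma memory_kernel_past z : memory_kernel z * eta z.2 = past_field 0 z * eta z.2 -
  past_field delta z * eta z.2.
Proof.
case: z => s [t w]; rewrite /memory_kernel /past_field /stepf /= subr0 !indicE !in_itv_oc.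
case: (boolP ((u < t) && (t <= v))) => [/andP[ut tv]|_]; last by rewrite !mulr0 subrr.
rewrite !le_clamp// ut/= gt_max (le_lt_trans u0 ut)/=.
have [ts|st] := leP t s; have [ts'|st'] := leP t (s - delta); rewrite ?andbF/=; try ring.
by have := le_lt_trans ts' (le_lt_trans _ st); rewrite gerBl => /(_ d0); rewrite ltxx.
Qed.

Lemma memory_step : \int[dtP S]_z (memory z * eta z) =
  \int[leb]_s past_ip 0 s - \int[leb]_s past_ip delta s.
Proof.
rewrite [LHS](time_integral_prod (mu := sfdtP)
  (T_gt0 HS) sqint_memory_kernel memory_kernel_out sqint_eta).
rewrite -(Rfubini1 (past_prod_integrable 0)) -(Rfubini1 (past_prod_integrable delta)).
rewrite -RintegralB; [|by []|exact: past_prod_integrable|exact: past_prod_integrable].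
by apply: eq_Rintegral => z _; exact: memory_kernel_past.
Qed.

Lemma past_duality e : {ae leb, forall s, 0 <= s <= T -> sqint P (A s) /\
  past_ip e s = \int[P]_w (A s w * (c w * inc S u (clamp (s - e)) w))}.
Proof.
have [_ _ cm] := CF; apply: ae_lebW (almost_all_timesP cm) => s cms sT.
have /andP[uc cv] := clamp_le (s - e).
have oc : ok_step S u (clamp (s - e)) c by exact: (ok_sub uvc).
have [sA ->] := malliavin_duality HS (cms sT) oc; split => //.
apply: eq_Rintegral => z _; rewrite /past_field mfieldE//= /stepf !indicE !in_itv_oc.
case: (boolP (u < z.1)) => uz /=; last by rewrite !mul0r !mulr0.
case: (boolP (z.1 <= clamp (s - e))) => zc /=; last by rewrite !mul0r !mulr0.
by rewrite (le_trans zc)//=; ring.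
Qed.

Variable m : R -> Om -> R.
Hypothesis jm : jointly_measurable S (fun t w => - m t w).
Let mu2 t w := A t w - A (t + delta) w * \1_(`[0, T - delta]) t.
Hypothesis gm : almost_all_times S (fun t => cond_exp S (filt S t) (mu2 t) (m t)).

Let good s := [/\ 0 <= s <= T -> cond_exp S (filt S s) (mu2 s) (m s),
  0 <= s <= T -> sqint P (A s) /\
    past_ip 0 s = \int[P]_w (A s w * (c w * inc S u (clamp s) w))
  & 0 <= s + delta <= T -> sqint P (A (s + delta)) /\
    past_ip delta (s + delta) = \int[P]_w (A (s + delta) w * (c w * inc S u
      (clamp s) w))].

Let ae_good : {ae leb, forall s, good s}.
Proof.
have h0 := past_duality 0; have h1 := ae_shift delta (past_duality delta).
have h2 := almost_all_timesP gm.
apply: ae_lebW3 h2 h0 h1 => s c1 c2 c3; split => // sT.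
  by have := c2 sT; rewrite subr0.
by have := c3 sT; rewrite addrK.
Qed.

Let mu2E s w : 0 <= s <= T -> mu2 s w = A s w - ext S A (s + delta, w).
Proof.
move=> /andP[s0 sT]; rewrite /mu2 indicE.
have -> : (s \in `[0, T - delta]%classic) = (0 <= s + delta <= T).
  by apply/idP/idP; rewrite inE /= in_itv/= s0 lerBrDr addr_ge0.
have [h|h] := boolP (0 <= s + delta <= T); first by rewrite mulr1 extE.
by rewrite mulr0 ext_out.
Qed.

Let sqint_ext_shift s : good s -> sqint P (fun w => ext S A (s + delta, w)).
Proof.
move=> [_ _ g]; have [sT|sT] := boolP (0 <= s + delta <= T).
  by have [h _] := g sT; rewrite (_ : (fun _ => _) = A (s + delta))//;
    apply/funext => w; rewrite extE.
by rewrite (_ : (fun _ => _) = cst 0); [exact: sqint0|apply/funext => w; rewrite ext_out].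
Qed.

Let sqint_mu2 s : 0 <= s <= T -> good s -> sqint P (mu2 s).
Proof.
move=> sT gs; have [_ /(_ sT)[sA _] _] := gs.
rewrite (_ : mu2 s = A s \- (fun w => ext S A (s + delta, w))).
  exact: (sqintB sA (sqint_ext_shift gs)).
by apply/funext => w; rewrite mu2E.
Qed.

Let mfilt s : 0 <= s <= T -> filt S s `<=` measurable.
Proof. by move=> /andP[_ sT]; exact: (filt_measurable HS). Qed.

Let sqint_m s : 0 <= s <= T -> good s -> sqint P (m s) /\
  \int[P]_w (m s w) ^+ 2 <= \int[P]_w (mu2 s w) ^+ 2.
Proof.
move=> sT gs; have [cs _ _] := gs.
exact: (cond_exp_sqint (mfilt sT) (cs sT) (sqint_mu2 sT gs)).
Qed.

(** The part of the increment that follows s is orthogonal to m(s), which is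
   F_s-measurable; on the part that precedes s, m(s) may be replaced by mu2(s). *)
Lemma cond_exp_step s : 0 <= s <= T -> good s ->
  \int[P]_w (m s w * (c w * inc S u v w)) = past_ip 0 s - past_ip delta (s + delta).
Proof.
move=> sT gs; have [/(_ sT) cs /(_ sT)[sA e0] g3] := gs; have [sm _] := sqint_m sT gs.
have [_ _ wm _] := cs; have /andP[uc cv] := clamp_le s.
have o1 : ok_step S u (clamp s) c by exact: (ok_sub uvc).
have o2 : ok_step S (clamp s) v c by exact: (ok_sub uvc).
pose eta_s w := c w * inc S u (clamp s) w.
have s1 : sqint P eta_s by exact: (ok_sqint_inc HS o1).
have s2 := ok_sqint_inc HS o2.
transitivity (\int[P]_w (m s w * eta_s w)).
  transitivity (\int[P]_w (m s w * eta_s w) + \int[P]_w (m s w * (c w * inc S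
    (clamp s) v w))).
    rewrite -RintegralD//; [|exact: sqint_mulr_integrable|exact: sqint_mulr_integrable].
    by apply: eq_Rintegral => w _; rewrite /eta_s /inc; ring.
  rewrite [X in _ + X](_ : _ = 0) ?addr0//.
  have [vs|sv] := leP v s.
    rewrite (_ : clamp s = v); last by rewrite /clamp min_l// max_r.
    by rewrite /Rintegral integral0_eq// => w _; rewrite /inc subrr !mulr0.
  apply: (past_orth HS o2) => // V mV.
  have sc : s <= clamp s by rewrite /clamp min_r ?le_max ?lexx ?orbT// ltW.
  apply: (enl_le sc); apply: filt_enl; first by case/andP: sT.
  exact: wm.
have smu := sqint_mu2 sT gs.
transitivity (\int[P]_w (mu2 s w * eta_s w)).
  have [su|us] := leP s u.
    rewrite /eta_s clamp_lo// /inc.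
    by under eq_Rintegral do rewrite subrr !mulr0;
      under [in RHS]eq_Rintegral do rewrite subrr !mulr0.
  apply: (cond_exp_mul (mfilt sT) cs).
  - apply/wrtP; apply: measurable_funM; apply/wrtP => V mV.
      by apply: (filt_le (ltW us)); exact: (ok_wrt uvc).
    apply: sub_sigma_algebra; left; left.
    have cs' : clamp s <= s by rewrite /clamp ge_max (ltW us) ge_min lexx orbT.
    by apply: (sigma_bm_le cs'); exact: sigma_bm_inc.
  - exact: sqint_mulr_integrable.
  - exact: sqint_mulr_integrable.
rewrite e0.
transitivity (\int[P]_w (A s w * eta_s w) - \int[P]_w (ext S A (s + delta, w) * eta_s w)).
  rewrite -RintegralB//; [|exact: sqint_mulr_integrable|exact: (sqint_mulr_integrable
    (sqint_ext_shift gs) s1)].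
  by apply: eq_Rintegral => w _; rewrite mu2E// mulrBl.
congr (_ - _).
have [sdT|sdT] := boolP (0 <= s + delta <= T).
  have [_ ->] := g3 sdT; by apply: eq_Rintegral => w _; rewrite extE.
rewrite past_ip_out// /Rintegral integral0_eq// => w _; by rewrite ext_out// mul0r.
Qed.

(** Conditional expectations are contractions, and mu2(s) consists of A(s) and of
   A(s + delta). *)
Lemma sqint_drift : sqint (dtP S) (ext S (fun t w => - m t w)).
Proof.
have mE := measurable_ext jm.
have mE2 : measurable_fun setT (fun z => ((ext S (fun t w => - m t w) z) ^+ 2)%:E).
  by apply/measurable_EFinP/measurable_funX.
have E20 z : (0 <= ((ext S (fun t w => - m t w) z) ^+ 2)%:E)%E by rewrite lee_fin sqr_ge0.
have [jA _] := LA; have [mA Aoo] := L2_ext LA.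
have mA2 : measurable_fun setT (fun z => ((ext S A z) ^+ 2)%:E).
  by apply/measurable_EFinP/measurable_funX.
have A20 z : (0 <= ((ext S A z) ^+ 2)%:E)%E by rewrite lee_fin sqr_ge0.
pose alpha s := (\int[P]_w ((ext S A (s, w)) ^+ 2)%:E)%E.
have malpha : measurable_fun setT alpha.
  exact: (measurable_fun_fubini_tonelli_F (fun z => ((ext S A z) ^+ 2)%:E)).
have alpha0 s : (0 <= alpha s)%E by apply: integral_ge0 => w _.
have alphaoo : (\int[leb]_s alpha s < +oo)%E.
  by move: Aoo; rewrite (dtP_tonelli _ mA).
have malpha2 : measurable_fun setT (fun s : R => alpha (s + delta)).
  apply: (measurableT_comp malpha).
  by apply: measurable_funD; [exact: measurable_id|exact: measurable_cst].
split => //.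
rewrite (dtP_tonelli _ mE).
apply: (@le_lt_trans _ _ (\int[leb]_s (2%:E * alpha s + 2%:E * alpha (s + delta)%R))%E).
  apply: ae_ge0_le_integral => //.
  - by move=> s _; apply: integral_ge0 => w _.
  - exact: (measurable_fun_fubini_tonelli_F (fun z => ((ext S
    (fun t w => - m t w) z) ^+ 2)%:E)).
  - by move=> s _; rewrite adde_ge0// mule_ge0.
  - by apply: emeasurable_funD; apply: measurable_funeM.
  - apply: ae_lebW ae_good => s gs _; rewrite /fubini_F.
    have [sT|sT] := boolP (0 <= s <= T); last first.
      rewrite integral0_eq ?adde_ge0 ?mule_ge0// => w _.
      by rewrite ext_out// expr0n.
    have [sm le] := sqint_m sT gs; have [_ /(_ sT)[sA _] _] := gs.
    have sAd := sqint_ext_shift gs; have smu := sqint_mu2 sT gs.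
    have sqE (f : Om -> R) : sqint P f -> (\int[P]_w ((f w) ^+ 2)%:E = (\int[P]_w
      (f w) ^+ 2)%:E)%E.
      by move=> /sqintP[_ fi]; rewrite /Rintegral fineK//; exact: integrable_fin_num.
    have -> : (\int[P]_w ((ext S (fun t w => - m t w) (s, w)) ^+ 2)%:E = (\int[P]_w
      (m s w) ^+ 2)%:E)%E.
      by rewrite -sqE//; apply: eq_integral => w _; rewrite extE// sqrrN.
    rewrite /alpha.
    have -> : (\int[P]_w ((ext S A (s, w)) ^+ 2)%:E = (\int[P]_w (A s w) ^+ 2)%:E)%E.
      by rewrite -sqE//; apply: eq_integral => w _; rewrite extE.
    rewrite (sqE _ sAd) -!EFinM -EFinD lee_fin; apply: (le_trans le).
    have /sqintP[_ i1] := sA; have /sqintP[_ i2] := sAd; have /sqintP[_ i3] := smu.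
    rewrite -!RintegralZl// -RintegralD//; [|exact: integrableRZ|exact: integrableRZ].
    apply: le_Rintegral => //; first by apply: integrableRD; exact: integrableRZ.
    move=> w _; rewrite mu2E//.
    by have := sqr_ge0 (A s w + ext S A (s + delta, w)); rewrite sqrrB sqrrD; lra.
rewrite ge0_integralD//; last 4 first.
- by move=> s _; rewrite mule_ge0.
- exact: measurable_funeM.
- by move=> s _; rewrite mule_ge0.
- exact: measurable_funeM.
rewrite !ge0_integralZl// (ge0_integral_shift delta (f := alpha))//.
by rewrite lte_add_pinfty// lte_mul_pinfty.
Qed.

(** The substitution of s for s + delta in the delayed term of mu2 leaves
   E[A(s) c (B(clamp s) - B(clamp (s - delta)))] under the integral over s. *)
Lemma drift_step :
  sqint P (fun w => \int[leb]_s ext S (fun t w => - m t w) (s, w)) /\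
  \int[P]_w (\int[leb]_s ext S (fun t w => - m t w) (s, w) * (c w * inc S u v w)) =
  - \int[dtP S]_z (memory z * eta z).
Proof.
have out s w : ~~ (0 <= s <= T) -> ext S (fun t w => - m t w) (s, w) = 0.
  by move=> sT; rewrite ext_out.
have sE := sqint_drift; split.
  exact: (time_integral_sqint (mu := P) (T_gt0 HS) sE out).
have sinc := ok_sqint_inc HS uvc.
rewrite (time_integral_ip (mu := P) (T_gt0 HS) sE out sinc).
have i := integrable_time_mul (mu := P) (T_gt0 HS) sE out sinc.
have /integrableP[/measurable_EFinP mi _] := Rfubini1_integrable i.
have i0 := past_ip_integrable 0; have id := past_ip_integrable delta.
have /integrableP[/measurable_EFinP m0 _] := i0.
have /integrableP[/measurable_EFinP md md_oo] := id.
have msh : measurable_fun setT (fun s : timeT => past_ip delta ((s : R) + delta)).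
  apply: (measurableT_comp md).
  by apply: measurable_funD; [exact: measurable_id|exact: measurable_cst].
have ish : leb.-integrable setT (EFin \o (fun s : R => past_ip delta (s + delta))).
  apply/integrableP; split; first exact/measurable_EFinP.
  move: md_oo; rewrite -(ge0_integral_shift delta
    (f := fun s => `|(past_ip delta s)%:E|%E))//.
  by apply: measurableT_comp => //; exact/measurable_EFinP.
rewrite memory_step -(Rintegral_shift delta md) opprB -RintegralB//.
apply: ae_eq_Rintegral => //; first exact: measurable_funB.
apply: ae_lebW ae_good => s gs; have [sT|sT] := boolP (0 <= s <= T).
  under eq_Rintegral do rewrite extE// mulNr.
  have [sm _] := sqint_m sT gs.
  rewrite -[LHS]opprK -opprB -(cond_exp_step sT gs); congr (- _).
  have := sqint_mulr_integrable sm sinc => im.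
  rewrite -[LHS]mulN1r -RintegralZl//; last by apply: eq_integrable (integrableRZ
    (-1) im) => // w _ /=; rewrite mulN1r.
  by apply: eq_Rintegral => w _; rewrite mulN1r opprK.
rewrite (past_ip_out _ sT) subr0.
rewrite [LHS](_ : _ = 0); last first.
  by rewrite /Rintegral integral0_eq// => w _; rewrite ext_out// mul0r.
move: sT; rewrite negb_and -!ltNge => /orP[s0|Ts]; apply/esym.
  by apply: past_ip_lo; rewrite addrK (le_trans (ltW s0)).
apply: past_ip_out; rewrite negb_and -!ltNge; apply/orP; right.
by rewrite (lt_le_trans Ts)// lerDl.
Qed.

End elementary_test.

Lemma ae_eq0_sqr d' (X : measurableType d') (mu : {measure set X -> \bar R})
    (f : X -> \bar R) : measurable_fun setT f -> (forall x, 0 <= f x)%E ->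
  (\int[mu]_x f x = 0)%E -> {ae mu, forall x, f x = 0%E}.
Proof.
move=> mf f0 if0; have [h _] := ae_eq_integral_abs mu measurableT mf.
have : (\int[mu]_x `|f x| = 0)%E.
  by rewrite -[RHS]if0; apply: eq_integral => x _; rewrite gee0_abs.
by move=> /h; apply: filterS => x /(_ I).
Qed.

Section adjoint.
Variables (p2 q2 : R -> Om -> R) (r2 : R -> Om -> R -> R).
Hypothesis eq2 : backward_equation S p2
  (fun t w => A t w - A (t + delta) w * \1_(`[0, T - delta]) t) q2 r2 (fun=> 0).

Let D := ext S q2 \- memory.

(** Integrated up to T, the equation of p2 reads p2(0) + N + I(T) + J(T) = 0, where N is
   the drift; p2(0) and J(T) are orthogonal to c (B(v) - B(u)). *)
Lemma adjoint_gap_orth : sqint (dtP S) (ext S q2) /\ orth S D.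
Proof.
have [m [gm [I [J [ad jm itoI jumpJ eqn]]] pT]] := eq2.
have T0 : 0 <= T by exact: ltW (T_gt0 HS).
have sq : sqint (dtP S) (ext S q2) by apply: L2_ext; case: itoI.
split => // u v c uvc.
have [sI eI] := ito_ip HS itoI uvc; have [sJ eJ] := jump_ip HS jumpJ uvc.
have [sN eN] := drift_step uvc jm gm; move: sN eN.
set N := fun w => \int[leb]_s _ => sN eN.
have se := ok_sqint_inc HS uvc.
have p0E : {ae P, forall w, p2 0 w = - (N w + I T w + J T w)}.
  apply: filterS2 eqn pT => w [_ _ /(_ T)] + pTw.
  rewrite T0 lexx => /(_ isT); rewrite pTw.
  have -> : \int[Defs.leb]_(s in `[0, T]) - m s w = N w.
    rewrite /N Rintegral_mkcond; apply: eq_Rintegral => s _; rewrite patchE.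
    have -> : (s \in `[0, T]%classic) = (0 <= s <= T).
      by apply/idP/idP; rewrite inE /= in_itv.
    by have [sT|sT] := boolP (0 <= s <= T); [rewrite extE|rewrite ext_out].
  by move=> /eqP; rewrite eq_sym -!addrA addr_eq0 => /eqP ->; rewrite !addrA.
have wp : wrt (filt S 0) (p2 0) by apply: ad; rewrite lexx.
have mp : measurable_fun setT (p2 0) by apply: (wrt_measurable (filt_measurable HS T0)).
have sNIJ : sqint P (fun w => - (N w + I T w + J T w)).
  exact: (sqintN (sqintD (sqintD sN sI) sJ)).
have [mN _] := sNIJ; have [me _] := se.
have sp : sqint P (p2 0).
  split => //; have [_] := sNIJ; apply: le_lt_trans.
  rewrite le_eqVlt; apply/orP; left; apply/eqP; apply: ae_eq_integral => //.
  - by apply/measurable_EFinP/measurable_funX.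
  - by apply/measurable_EFinP/measurable_funX.
  - by apply: filterS p0E => w -> _.
have wpu : wrt <<s enl S u>> (p2 0).
  move=> V mV; apply: (filt_enl (ok_uT uvc)); apply: (filt_le (ok_ge0 uvc)); exact: wp.
have i (f : Om -> R) : sqint P f ->
    P.-integrable setT (EFin \o (fun w => f w * (c w * inc S u v w))).
  by move=> sf; exact: sqint_mulr_integrable.
have : \int[P]_w (N w * (c w * inc S u v w)) + \int[P]_w (I T w * (c w * inc S u v w))
    + \int[P]_w (J T w * (c w * inc S u v w)) = 0.
  rewrite -oppr0 -(past_orth HS uvc wpu sp).
  rewrite -RintegralD; [|by []|exact: i|exact: i].
  rewrite -RintegralD; [|by []|by apply: integrableRD; exact: i|exact: i].
  apply/eqP; rewrite -subr_eq0 opprK -RintegralD; [| by [] | |exact: i].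
    apply/eqP; rewrite (ae_eq_Rintegral (g := cst 0))//.
    - by rewrite Rintegral_cst// mul0r.
    - apply: measurable_funD; last exact: measurable_funM.
      by apply: measurable_funD; [apply: measurable_funD|];
        apply: measurable_funM => //; [case: sN|case: sI|case: sJ].
    - by apply: filterS p0E => w ->; rewrite /=; ring.
  by apply: integrableRD; [apply: integrableRD|]; exact: i.
rewrite eN eI eJ addr0 => e.
transitivity (\int[dtP S]_z (ext S q2 z * stepf u v c z)
   - \int[dtP S]_z (memory z * stepf u v c z)); last by rewrite -[RHS]e addrC.
have ss := stepf_sqint HS uvc.
rewrite -RintegralB; [|by []|exact: sqint_mulr_integrable|exact:
  (sqint_mulr_integrable sqint_memory ss)].
by apply: eq_Rintegral => z _; rewrite /D /=; ring.
Qed.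

(** D is orthogonal to the elementary processes, hence to their limits q2 and memory,
   hence to itself. *)
Lemma adjoint_gap_null : (\int[dtP S]_z ((D z) ^+ 2)%:E = 0)%E.
Proof.
have [sq oD] := adjoint_gap_orth; have sM := sqint_memory.
have sD : sqint (dtP S) D by exact: sqintB.
have [m [gm [I [J [ad jm itoI jumpJ eqn]]] pT]] := eq2.
have h : \int[dtP S]_z (D z) ^+ 2 = 0.
  transitivity (\int[dtP S]_z (ext S q2 z * D z) - \int[dtP S]_z (memory z * D z)).
    rewrite -RintegralB; [|by []|exact: sqint_mulr_integrable|exact:
      sqint_mulr_integrable].
    by apply: eq_Rintegral => z _; rewrite expr2 {1}/D mulrBl.
  by rewrite (ito_orth HS itoI sD oD) memory_orth// subrr.
have /sqintP[_ fi] := sD; rewrite -(fineK (integrable_fin_num measurableT fi)).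
by congr EFin.
Qed.

Local Notation Gam t w :=
  (\int[Defs.leb]_(s in `[t, t + delta]) (EDL s t w * \1_(`[0, T]) s)).

Lemma adjoint_noise_coefficient :
  almost_all_times S (fun t => [/\ measurable_fun setT (q2 t),
    measurable_fun setT (fun w => Gam t w) & {ae P, forall w, q2 t w = Gam t w}]).
Proof.
have [[mq _] _] := adjoint_gap_orth; have [mM _] := sqint_memory.
have mD : measurable_fun setT D by exact: measurable_funB.
have mD2 : measurable_fun setT (fun z => ((D z) ^+ 2)%:E).
  by apply/measurable_EFinP/measurable_funX.
have D20 z : (0 <= ((D z) ^+ 2)%:E)%E by rewrite lee_fin sqr_ge0.
have h := adjoint_gap_null; rewrite (dtP_tonelli _ mD) in h.
have {}h : {ae leb, forall t, (\int[P]_w ((D (t, w)) ^+ 2)%:E = 0)%E}.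
  apply: (ae_eq0_sqr _ _ h); last by move=> t; exact: integral_ge0.
  exact: (measurable_fun_fubini_tonelli_F (fun z => ((D z) ^+ 2)%:E)).
have n0 : {ae leb, forall t : R, t <> 0}.
  exists [set 0]; split; [by []|exact: lebesgue_measure_set1|].
  by move=> t /= /contrapT.
have hn : {ae leb, forall t : R, 0 <= t <= T -> [/\ measurable_fun setT (q2 t),
    measurable_fun setT (fun w => Gam t w) & {ae P, forall w, q2 t w = Gam t w}]}.
  apply: (ae_lebW3 _ h n0 n0) => t ht t0 _ tT; have /andP[t0' tT'] := tT.
  have tp : 0 < t by rewrite lt_neqAle t0' andbT eq_sym; apply/eqP.
  split.
  - rewrite (_ : q2 t = (fun w => ext S q2 (t, w))); first exact: measurableT_comp mq _.
    by apply/funext => w; rewrite extE.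
  - rewrite (_ : (fun w => _) = (fun w => memory (t, w))); first exact:
    measurableT_comp mM _.
    by apply/funext => w; rewrite memoryE.
  - have mDt : measurable_fun setT (fun w => ((D (t, w)) ^+ 2)%:E).
      exact: measurableT_comp mD2 _.
    apply: filterS (ae_eq0_sqr mDt (fun w => D20 (t, w)) ht) => w [].
    by move=> /eqP; rewrite sqrf_eq0 /D /= extE// memoryE// subr_eq0 => /eqP.
exact: hn.
Qed.

Lemma cond_exp_swap (X m : R -> Om -> R) :
  almost_all_times S (fun t => cond_exp S (filt S t) (fun w => q2 t w + X t w) (m t)) ->
  almost_all_times S (fun t => cond_exp S (filt S t) (fun w => X t w + Gam t w) (m t)).
Proof.
move=> cX; have h1 := almost_all_timesP cX.
have h2 := almost_all_timesP adjoint_noise_coefficient.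
suff hn : {ae leb, forall t : R, 0 <= t <= T ->
    cond_exp S (filt S t) (fun w => X t w + Gam t w) (m t)} by exact: hn.
apply: (ae_lebW3 _ h1 h2 h2) => t ct qt _ tT.
have [iX im wm Xm] := ct tT; have [mq mG qG] := qt tT.
have /andP[_ tT'] := tT.
have /integrableP[/measurable_EFinP mqX _] := iX.
have mX : measurable_fun setT (X t).
  rewrite (_ : X t = (fun w => q2 t w + X t w) \- q2 t); first exact: measurable_funB.
  by apply/funext => w /=; rewrite addrC addKr.
have mXG : measurable_fun setT (fun w => X t w + Gam t w) by exact: measurable_funD.
have e C : measurable C -> (\int[P]_(w in C) (q2 t w + X t w)%:E =
    \int[P]_(w in C) (X t w + Gam t w)%:E)%E.
  move=> mC; apply: ae_eq_integral => //.
  - exact/measurable_funTS/measurable_EFinP.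
  - exact/measurable_funTS/measurable_EFinP.
  - by apply: filterS qG => w -> _; rewrite addrC.
split => //.
- apply/integrableP; split; first exact/measurable_EFinP.
  have /integrableP[_] := iX; apply: le_lt_trans; rewrite le_eqVlt; apply/orP; left.
  apply/eqP; apply: ae_eq_integral => //.
  - by apply: measurableT_comp => //; exact/measurable_EFinP.
  - by apply: measurableT_comp => //; exact/measurable_EFinP.
  - by apply: filterS qG => w qw _ /=; rewrite qw addrC.
- move=> C fC; rewrite Xm// e//; exact: (filt_measurable HS tT').
Qed.

End adjoint.

End noisy_memory_field.

(** * The adjoint equations *)

Lemma derive1_addl {R : realType} (k : R) (F : R -> R) (x : R) :
  derive1 (fun a => k + F a) x = derive1 F x.
Proof.
rewrite /derive1; under eq_fun do rewrite opprD addrACA subrr add0r.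
by [].
Qed.

Section linear_in_state.
Context {R : realType} d (Om : measurableType d) (S : noise R Om).
Variables (k : R -> Om -> R) (Ham : R -> Om -> @harg R -> R)
  (V : R -> Om -> @harg R).
Let Hamk t w v := k t w * arg_x v + Ham t w v.

Lemma partial_linear_state c t w : (forall (v : @harg R) a, arg_x
  (put c v a) = arg_x v) ->
  partial c (Hamk t w) (V t w) = partial c (Ham t w) (V t w).
Proof.
move=> cx; rewrite /partial.
rewrite (_ : (fun a => _) = (fun a => k t w * arg_x (V t w) + Ham t w (put c (V t w) a))).
  exact: derive1_addl.
by apply/funext => a; rewrite /Hamk cx.
Qed.

Lemma frechet_linear_state t w D : frechet_density S (Hamk t w) (V t w) D ->
  frechet_density S (Ham t w) (V t w) D.
Proof.
move=> [K1 K2 h]; split => // e e0; have [eta eta0 he] := h e e0.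
exists eta => // l Ll le; have := he l Ll le; rewrite /Hamk /=.
by rewrite opprD addrACA subrr add0r.
Qed.

(** Adding a multiple of the state to the Hamiltonian changes neither its derivatives in
   w and z nor its Frechet derivative in k. *)
Lemma forward_linear_state lam init :
  forward_adjoint_equation S lam Hamk V init ->
  forward_adjoint_equation S lam Ham V init.
Proof.
move=> [grad [gradE lamD lam0]]; exists grad; split; last exact: lam0.
- apply: (ae_lebW _ (almost_all_timesP gradE)) => t gt tT.
  by apply: filterS (gt tT) => w; exact: frechet_linear_state.
- move: lamD; congr has_differential; apply/funext => t; apply/funext => w;
    by apply: partial_linear_state; case.
Qed.

End linear_in_state.

Theorem theorem5p1 (R : realType) (d : measure_display)
  (Om : measurableType d) (S : noise R Om)
  (b sigma : diff_coef) (gamma : jump_coef) (g : driver) (h : R -> Om -> R)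
  (f : payoff) (phi vphi : R -> R)
  (delta : 'I_2 -> R) (u : 'I_2 -> R -> Om -> R) (x0 : R)
  (X : R -> Om -> R) (L : 'I_2 -> R -> Om -> R)
  (W Z : R -> Om -> R) (K : R -> Om -> R -> R)
  (i : 'I_2)
  (lamt p1 q1 p2 q2 : R -> Om -> R) (r1 r2 : R -> Om -> R -> R)
  (EDL : R -> R -> Om -> R) :
  let T := hor S in
  let P := prob S in
  (* X is unconstrained at negative times *)
  let Y (j : 'I_2) (t : R) (w : Om) : R := X (t - delta j) w in
  let V (t : R) (w : Om) : harg :=
    Harg (X t w) (fun j => Y j t w) (fun j => L j t w) (W t w) (Z t w) (K t w)
      (fun j => u j t w) in
  let H (lam p q : R -> Om -> R) (r : R -> Om -> R -> R) (t : R) (w : Om)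
      : harg -> R :=
    fun v => hamiltonian S b sigma gamma g f i t w v
               (lam t w) (p t w) (q t w) (r t w) in
  let calH (t : R) (w : Om) : harg -> R :=
    fun v => extended_hamiltonian S b sigma gamma g f i t w v
               (lamt t w) (p1 t w) (p2 t w) (q1 t w) (q2 t w)
               (r1 t w) (r2 t w) in
  let dH (c : hvar) (lam p q : R -> Om -> R) (r : R -> Om -> R -> R)
      (t : R) (w : Om) : R := partial c (H lam p q r t w) (V t w) in
  let terminal (lam : R -> Om -> R) (w : Om) : R :=
    derive1 vphi (X T w) + derive1 (h ^~ w) (X T w) * lam T w in
  let Gam (t : R) (w : Om) : R :=
    \int[leb]_(s in `[t, t + delta i]) (EDL s t w * \1_(`[0, T]) s) in
  driving_noise S ->
  (forall j, 0 <= delta j) ->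
  predictable_coefficients S b sigma gamma g ->
  (forall x, wrt (filt S T) (h x)) ->
  (forall x w, derivable (h ^~ w) x 1) ->
  (forall x, derivable phi x 1) ->
  (forall x, derivable vphi x 1) ->
  regular_hamiltonian S b sigma gamma g f i ->
  (forall j, noisy_memory S (delta j) X (L j)) ->
  (exists2 J : R -> Om -> R -> R,
     almost_all_times S (fun t => {ae P, forall w, {ae nu S, forall z,
       gamma s (X s w) (fun j => Y j s w) (fun j => L j s w)
         (fun j => u j s w) z w @[s --> t^'-] --> J t w z}}) &
     has_differential S X
       (fun t w => b t (X t w) (fun j => Y j t w) (fun j => L j t w)
                     (fun j => u j t w) w)
       (fun t w => sigma t (X t w) (fun j => Y j t w) (fun j => L j t w)
                     (fun j => u j t w) w) J) ->
  {ae P, forall w, X 0 w = x0} ->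
  has_differential S W
    (fun t w => - g t (X t w) (fun j => Y j t w) (fun j => L j t w)
                    (W t w) (Z t w) (K t w) (fun j => u j t w) w) Z K ->
  {ae P, forall w, W T w = h (X T w) w} ->
  forward_adjoint_equation S lamt calH V (fun w => derive1 phi (W 0 w)) ->
  backward_equation S p1
    (fun t w => q2 t w + dH Cx lamt p1 q1 r1 t w
       + dH (Cy i) lamt p1 q1 r1 (t + delta i) w * \1_(`[0, T - delta i]) t)
    q1 r1 (terminal lamt) ->
  backward_equation S p2
    (fun t w => dH (CL i) lamt p1 q1 r1 t w
       - dH (CL i) lamt p1 q1 r1 (t + delta i) w * \1_(`[0, T - delta i]) t)
    q2 r2 (fun=> 0) ->
  (sqnorm S (dH Cz lamt p1 q1 r1) < +oo)%E ->
  (* EDL s t is E[D_t[dH/dLambda(s)] | F_t] *)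
  L2_process S (dH (CL i) lamt p1 q1 r1) ->
  cond_malliavin_field S (dH (CL i) lamt p1 q1 r1) EDL ->
  let lam := lamt in let p := p1 in let q := q1 in let r := r1 in
  [/\ forward_adjoint_equation S lam (H lam p q r) V
        (fun w => derive1 phi (W 0 w)),
      backward_equation S p
        (fun t w => dH Cx lam p q r t w
           + dH (Cy i) lam p q r (t + delta i) w * \1_(`[0, T - delta i]) t
           + Gam t w)
        q r (terminal lam)
    & almost_all_times S (fun t => {ae P, forall w, q2 t w = Gam t w})].
Proof.
move=> T P Y V H calH dH terminal Gam HS delta0 _ _ _ _ _ _ _ _ _ _ _ lamE p1E p2E _ LL CL
  lam p q r.
split.
- exact: (forward_linear_state (k := q2) lamE).
- have [m [mE pD pT]] := p1E; exists m; split; [|exact: pD|exact: pT].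
  pose Xf t w := dH Cx lam p q r t w
    + dH (Cy i) lam p q r (t + delta i) w * \1_(`[0, T - delta i]) t.
  apply: (cond_exp_swap HS LL (delta0 i) CL p2E (X := Xf)).
  move: mE; congr almost_all_times; apply/funext => t; congr cond_exp.
  by apply/funext => w; rewrite /Xf addrA.
- apply: (ae_lebW _ (almost_all_timesP (adjoint_noise_coefficient HS LL (delta0 i) CL p2E))).
  by move=> t qt tT; have [] := qt tT.
Qed.
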